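(* For each $n$ let $X_n=(x_{ij})$ be an $m\times n$ complex random matrix ($m=m(n)$) with independent entries (whose laws may depend on $n$), let $S_n=(s_{ij})_{1\le i\le m,1\le j\le n}$, and assume: (i) $\mathbb Ex_{ij}=0$ and $\mathbb E|x_{ij}|^2=s_{ij}$ for all $1\le i\le m$, $1\le j\le n$; (ii) for every constant $\eta>0$, $\lim_{n\to\infty}\frac1{nm}\sum_{i=1}^m\sum_{j=1}^n\mathbb E\big[|x_{ij}|^2\mathbf 1(|x_{ij}|\ge\eta\sqrt n)\big]=0$; (iii) $\sup_{ij}s_{ij}\le C$ for some constant $C\ge0$ (not depending on $n$); (iv) $\lim_{n\to\infty}\frac mn=y\in(0,\infty)$. Let $M_n:=\frac1nX_nX_n^*$ and let $W_n$ be the graphon representation of the $(n+m)\times(n+m)$ matrix $\Sigma_n:=\begin{bmatrix}0&S_n\\S_n^T&0\end{bmatrix}$. If for every finite tree $T$, $t(T,W_n)$ converges as $n\to\infty$, then the empirical spectral distribution of $M_n$ converges almost surely to a probability measure $\mu$ such that for all $k\ge1$ $$\int x^k\,d\mu=\frac{(1+y)^{k+1}}{2y}\sum_{j=1}^{C_k}\lim_{n\to\infty}t(T_j^{k+1},W_n),$$ where $T^{k+1}_1,\dots,T^{k+1}_{C_k}$ are all the rooted planar trees with $k+1$ vertices and $C_k$ is the $k$-th Catalan number.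
   Context: The graphon representation of a symmetric $N\times N$ matrix $(\sigma_{ij})$ is the function on $[0,1]^2$ obtained by dividing $[0,1]$ into consecutive intervals $I_1,\dots,I_N$ of length $1/N$ and taking the value $\sigma_{ij}$ on $I_i\times I_j$. For a finite graph $F=(V,E)$ and a symmetric integrable $W$ on $[0,1]^2$, $t(F,W)=\int_{[0,1]^{|V|}}\prod_{ij\in E}W(x_i,x_j)\prod_{i\in V}dx_i$. A rooted planar tree is a finite planar tree with a distinguished root vertex and a choice of ordering at each vertex; there are $C_k=\frac1{k+1}\binom{2k}{k}$ of them with $k+1$ vertices. The empirical spectral distribution of an $m\times m$ Hermitian matrix $A$ with eigenvalues $\lambda_1,\dots,\lambda_m$ is $F^A(x)=\frac1m\sum_{i=1}^m\mathbf 1_{\{\lambda_i\le x\}}$. All $X_n$ are defined on a common probability space, and ''converges almost surely to $\mu$'' means that almost surely the empirical spectral distributions converge weakly to $\mu$. *)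

(* Defs.v *)
From HB Require Import structures.
From mathcomp Require Import all_boot all_order all_algebra.
From mathcomp Require Import sesquilinear spectral.
From mathcomp Require Import complex zify.
From mathcomp Require Import all_classical all_reals all_analysis.

Set Implicit Arguments.
Unset Strict Implicit.
Unset Printing Implicit Defensive.

Import Order.TTheory GRing.Theory Num.Theory.
Import numFieldTopology.Exports numFieldNormedType.Exports.

Local Open Scope classical_set_scope.
Local Open Scope ring_scope.
Local Open Scope sesquilinear_scope.

Section Graphs.

(* A finite graph is given by its adjacency relation on the vertex set 'I_k. *)
Definition is_tree (k : nat) (e : rel 'I_k) : Prop :=
  [/\ (0 < k)%N, symmetric e, irreflexive e,
      (forall u v, connect e u v) &
      (forall c : seq 'I_k, ucycle e c -> (size c <= 2)%N)].

Inductive ptree : Type := PNode of seq ptree.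

(* Vertices in Ulam-Harris form: the root is [::], and the i-th child of the
   vertex a is rcons a i. *)
Fixpoint vertices (t : ptree) : seq (seq nat) :=
  let: PNode ts := t in
  [::] :: flatten [seq [seq p.1 :: a | a <- p.2]
                  | p <- zip (iota 0 (size ts)) (map vertices ts)].

Definition nvertices (t : ptree) : nat := size (vertices t).

Definition parent_of (a b : seq nat) : bool :=
  prefix a b && (size b == (size a).+1).

Definition ptree_graph (t : ptree) : rel 'I_(nvertices t) :=
  fun u v => let a := nth [::] (vertices t) u in
             let b := nth [::] (vertices t) v in
             parent_of a b || parent_of b a.

Definition catalan (k : nat) : nat := 'C(2 * k, k) %/ k.+1.

Definition all_ptrees (k : nat) (T : 'I_(catalan k) -> ptree) : Prop :=
  injective T /\ forall t, nvertices t = k.+1 <-> exists j, T j = t.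

(* Forests with n vertices in total, in r-tuples: the first one is empty, or it
   starts with a tree, whose root is removed. *)
Fixpoint forests (n : nat) : nat -> seq (seq (seq ptree)) :=
  match n with
  | 0 => fun r => [:: nseq r [::]]
  | n'.+1 => fix aux r := match r with
    | 0 => [::]
    | r'.+1 =>
        map (cons [::]) (aux r') ++
        map (fun L => match L with
                      | f :: g :: L' => (PNode f :: g) :: L'
                      | _ => L
                      end) (forests n' r'.+2)
    end
  end.

Let weight (L : seq (seq ptree)) : nat :=
  sumn (map (fun f => sumn (map nvertices f)) L).

Lemma nverticesE ts : nvertices (PNode ts) = (sumn (map nvertices ts)).+1.
Proof.
rewrite /nvertices /= size_flatten /shape -map_comp; congr (_.+1).
elim: ts 0%N => //= t ts IH i; rewrite size_map; congr (_ + _)%N.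
exact: (IH i.+1).
Qed.

Let graft (L : seq (seq ptree)) : seq (seq ptree) :=
  match L with f :: g :: L' => (PNode f :: g) :: L' | _ => L end.

Lemma forestsS n r : forests n.+1 r.+1 =
  map (cons [::]) (forests n.+1 r) ++ map graft (forests n r.+2).
Proof. by []. Qed.

Lemma size_forests n r :
  (size (forests n.+1 r) + 'C(2 * n + 1 + r, n) = 'C(2 * n + 1 + r, n.+1))%N.
Proof.
elim: n r => [|n IHn] r.
  by elim: r => [|r IHr] //=; move: IHr;
    rewrite size_cat !size_map !bin1 !bin0 /=; lia.
elim: r => [|r IHr].
  by rewrite /= add0n addn0 -(@bin_sub _ n.+2) ?leq_subr; first congr 'C(_, _); lia.
have := IHn r.+2.
have -> : (2 * n + 1 + r.+2 = 2 * n.+1 + 1 + r)%N by lia.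
rewrite (forestsS n.+1 r) size_cat !size_map.
have -> : (2 * n.+1 + 1 + r.+1 = (2 * n.+1 + 1 + r).+1)%N by lia.
by rewrite !(binS (2 * n.+1 + 1 + r)); move: IHr; lia.
Qed.

#[local] HB.instance Definition _ := gen_eqMixin ptree.

Lemma forestsP n r L : reflect (size L = r /\ weight L = n) (L \in forests n r).
Proof.
apply: (iffP idP).
  elim: n r L => [|n IHn] r L.
    by rewrite /= mem_seq1 => /eqP->; rewrite size_nseq; split=> //; elim: r.
  elim: r L => [|r IHr] L //; rewrite forestsS mem_cat => /orP[] /mapP[L' L'in ->].
    by have [<- <-] := IHr _ L'in.
  have := IHn _ _ L'in; case: L' {L'in} => [|f [|g L']] [] // [<-].
  by rewrite /weight /= nverticesE => <-; split=> //; lia.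
elim: n r L => [|n IHn] r L.
  move=> [<- wL]; rewrite /= mem_seq1; apply/eqP.
  elim: L wL => [|[|t f] L IHL] //= wL; first by rewrite -IHL.
  by case: t wL => ts; rewrite /weight /= nverticesE.
elim: r L => [|r IHr] [|f L] // []// [Lr] wL.
rewrite forestsS mem_cat; apply/orP; case: f wL => [|[ts] f] wL.
  by left; apply: map_f; apply: IHr.
right; apply/mapP; exists (ts :: f :: L) => //; apply: IHn; split=> /=.
  by rewrite Lr.
by move: wL; rewrite /weight /= nverticesE; lia.
Qed.

Lemma forests_uniq n r : uniq (forests n r).
Proof.
elim: n r => [|n IHn] r //; elim: r => [|r IHr] //.
rewrite forestsS cat_uniq map_inj_uniq ?IHr; last by move=> ? ? [].
rewrite map_inj_in_uniq ?IHn ?andbT; last first.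
  move=> L1 L2 /forestsP[+ _] /forestsP[+ _].
  by case: L1 => [|f1 [|g1 L1]] // _; case: L2 => [|f2 [|g2 L2]] // _ [-> -> ->].
apply/hasPn => _ /mapP[L /forestsP[Lr _] ->].
by case: L Lr => [|f [|g L]] // _; apply/mapP => -[].
Qed.

Lemma size_forests1 k : size (forests k 1) = catalan k.
Proof.
case: k => [|k]; first by rewrite /catalan bin0.
have := size_forests k 1; have := mul_bin_left (2 * k.+1) k.
have -> : (2 * k + 1 + 1 = 2 * k.+1)%N by lia.
have -> : (2 * k.+1 - k = k.+2)%N by lia.
rewrite /catalan; set A := 'C(_, k.+1); set B := 'C(_, k) => AB sAB.
have -> : A = (size (forests k.+1 1) * k.+2)%N by nia.
by rewrite mulnK.
Qed.

Lemma all_ptrees_exists k : exists T : 'I_(catalan k) -> ptree, all_ptrees T.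
Proof.
pose s := [seq PNode (head [::] L) | L <- forests k 1].
have s_size : size s = catalan k by rewrite size_map size_forests1.
have s_uniq : uniq s.
  rewrite map_inj_in_uniq ?forests_uniq // => L1 L2.
  move=> /forestsP[+ _] /forestsP[+ _].
  by case: L1 => [|f [|]] // _; case: L2 => [|g [|]] // _ /= [->].
exists (fun j => nth (PNode [::]) s j); split=> [i j /eqP|t].
  by rewrite nth_uniq ?s_size // => /eqP /val_inj.
have <- : (t \in s) <-> nvertices t = k.+1; last first.
  split=> [/(nthP (PNode [::])) [ i]|[j <-]].
    by rewrite s_size => lti <-; exists (Ordinal lti).
  by rewrite mem_nth ?s_size.
split=> [/mapP[L /forestsP[]]|].
  by case: L => [|f [|]] // _; rewrite /weight /= addn0 => <- ->; rewrite nverticesE.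
case: t => ts; rewrite nverticesE => -[tsk].
by apply/mapP; exists [:: ts] => //; apply/forestsP; rewrite /weight /= addn0.
Qed.

End Graphs.

Section Graphons.
Variable R : realType.

(* Closed on the left only for i = 0, so that the intervals partition [0,1]. *)
Definition block (N : nat) (i : 'I_N) : set R :=
  if val i == 0%N then `[0, N%:R^-1]%classic
  else `]i%:R / N%:R, i.+1%:R / N%:R]%classic.

Definition graphon_of (N : nat) (A : 'M[R]_N) (x y : R) : R :=
  \sum_(i < N) \sum_(j < N) A i j * \1_(block i) x * \1_(block j) y.

(* Integral over [0,1]^k as an iterated integral (Fubini), as the library has
   no k-fold product of the Lebesgue measure. *)
Fixpoint cube_integral (k : nat) : (k.-tuple R -> R) -> R :=
  match k with
  | 0 => fun f => f [tuple]
  | k'.+1 => fun f =>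
      \int[@lebesgue_measure R]_(x in `[0, 1])
        cube_integral (fun v : k'.-tuple R => f [tuple of x :: v])
  end.

(* Each edge is taken once, in the orientation i < j; W is symmetric. *)
Definition hom_density (k : nat) (e : rel 'I_k) (W : R -> R -> R) : R :=
  cube_integral (fun x : k.-tuple R =>
    \prod_(p : 'I_k * 'I_k | (p.1 < p.2)%N && e p.1 p.2)
      W (tnth x p.1) (tnth x p.2)).

End Graphons.

Section RandomMatrices.
Variable R : realType.

Definition mutually_independent d (Omega : measurableType d)
    (P : probability Omega R) (I : finType) d' (T : measurableType d')
    (Z : I -> Omega -> T) : Prop :=
  forall (J : {set I}) (B : I -> set T), (forall i, measurable (B i)) ->
    P (\bigcap_(i in [set` J]) (Z i @^-1` B i)) =
    (\prod_(i in J) P (Z i @^-1` B i))%E.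

(* R[i] carries no sigma-algebra in the library; its Borel structure is that
   of R * R. *)
Definition reim (z : R[i]) : R * R := (complex.Re z, complex.Im z).

Definition sample_cov (m n : nat) (A : 'M[R[i]]_(m, n)) : 'M[R[i]]_m :=
  (n%:R)^-1 *: (A *m A^t*).

(* For a Hermitian A, spectral_diag A lists the (real) eigenvalues of A with
   multiplicity. *)
Definition esd (m : nat) (A : 'M[R[i]]_m) (x : R) : R :=
  m%:R^-1 * \sum_(i < m) (complex.Re (spectral_diag A 0 i) <= x)%R%:R.

Definition distr_fun (mu : probability (measurableTypeR R) R) (x : R) : R :=
  fine (mu `]-oo, x]%classic).

Definition weak_cvg (F : nat -> R -> R)
    (mu : probability (measurableTypeR R) R) : Prop :=
  forall x : R, {for x, continuous (distr_fun mu)} ->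
    F n x @[n --> \oo] --> distr_fun mu x.

End RandomMatrices.

(* Main.v *)
(** Put A = X_n / sqrt n, of size m x n, and p_i(t) = t ((A A^* + t)^-1)_ii for t > 0.  The
    Stieltjes-type transform (1/m) sum_i t / (lambda_i + t) of the spectrum of M_n is the average
    of the p_i.  Removing a row of A is a rank-one perturbation, which gives
    p_i = 1 / (1 + a_i Q_i a_i^* ) with a_i independent of Q_i; orthogonality of increments (with a
    truncation of the diagonal part only, controlled by the Lindeberg condition) replaces the
    quadratic form by sum_j (s_ij / n) E (Q_i)_jj.  Hence the vector of the E p_i and of its
    column analogues almost solves g_i (1 + t^-1 sum_j (sigma_ij / n) g_j) = 1.  For t large
    this system is stable and its solution expands in powers of -1/t, with the sums over rooted
    planar trees as coefficients, by the root decomposition T = (first subtree, rest).  The averages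
    of these sums are the homomorphism densities t(T, W_n), so the expected transforms
    converge; the fourth moment of a martingale with bounded increments makes the convergence almost
    sure.  Finally a sequence of measures on [0, +oo[ whose transforms converge for all large t
    converges weakly, and the 1/t expansion of the limit gives its moments. *)

Require Import Defs.
From HB Require Import structures.
From mathcomp Require Import all_boot all_order all_algebra.
From mathcomp Require Import sesquilinear spectral complex.
From mathcomp Require Import all_classical all_reals all_analysis.
From mathcomp Require Import measurable_realfun zify ring lra.

Set Implicit Arguments.
Unset Strict Implicit.
Unset Printing Implicit Defensive.

Import Order.TTheory GRing.Theory Num.Theory.
Import numFieldTopology.Exports numFieldNormedType.Exports.

Local Open Scope classical_set_scope.
Local Open Scope ring_scope.

(** * Independent families *)

(** The spectral parameter stays on the negative real axis. Resolvents are then positive, every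
    [p_i] lies in [0, 1], and zeroing a row moves the trace of a resolvent by at most [t^-1]
    whatever the size of the row, so large entries do no harm to the martingale bounds. The price is
    that the transform is controlled for large real [t] only. This still determines the measure:
    powers of the single kernel [t0 / (x + t0)] are limits of combinations of kernels at [t >= t0],
    and polynomials in that kernel approximate every test function that is needed. The unknowns of
    the limit system live on all [m + n] vertices of the bipartite matrix, as the graphon does,
    while the spectrum of M_n sees the [m] row unknowns only. The two Gram matrices of A share their
    nonzero spectrum, so the row sum exceeds the column sum by [m - n], and half of the total
    recovers the row part. This is the origin of the 2 in [(1 + y)^(k+1) / (2 y)], and of the
    separate value at [k = 0]. *)

Section Family.
Context {d' : measure_display} {T : measurableType d'}.
Variable I : finType.

(* The library has no product sigma-algebra on [I -> T] with [I] an abstract finite type. *)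
Definition rectangles : set (set (I -> T)) :=
  [set E | exists2 B : I -> set T, (forall i, measurable (B i)) &
    E = [set z | forall i, B i (z i)]].

Definition famType := g_sigma_algebraType rectangles.
HB.instance Definition _ := Measurable.on famType.

Lemma measurable_coord i : measurable_fun [set: famType] (fun z : famType => z i).
Proof.
move=> _ B mB; rewrite setTI; apply: sub_sigma_algebra.
exists (fun j => if j == i then B else setT) => [j|]; first by case: ifP.
apply/seteqP; split=> [z Bz j|z Bz] /=; first by case: eqP => // ->.
by have := Bz i; rewrite eqxx.
Qed.

Lemma measurable_to_family d (Omega : measurableType d) (f : Omega -> famType) :
  (forall i, measurable_fun setT (fun w => f w i)) -> measurable_fun setT f.
Proof.
move=> mf; apply: (@measurability _ _ _ famType setT f rectangles) => //.
move=> _ [_ [B mB ->] <-]; rewrite setTI.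
rewrite [X in measurable X](_ : _ = \bigcap_(i in [set: I]) ((fun w => f w i) @^-1` B i)).
  by apply: fin_bigcap_measurable => // i _; rewrite -[X in measurable X]setTI; exact: mf.
by apply/seteqP; split=> [w Bw i _|w Bw i] /=; [exact: Bw | exact: Bw].
Qed.

Lemma rectangles_setI : setI_closed rectangles.
Proof.
move=> _ _ [B mB ->] [D mD ->]; exists (fun i => B i `&` D i) => [i|].
  exact: measurableI.
by apply/seteqP; split=> [z [Bz Dz] i|z BDz]; [split; [exact: Bz|exact: Dz]
  |split=> i; case: (BDz i)].
Qed.

(** Resampling: integrating over [z'] plays the part of the conditional expectation given the
    coordinates in [J]. *)
Definition mix (J : {set I}) (z z' : famType) : famType :=
  fun i => if i \in J then z i else z' i.

End Family.

Section Decouple.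
Context {R : realType} {d d' : measure_display} {Omega : measurableType d}
  {T : measurableType d'}.
Variables (P : probability Omega R) (I : finType) (Z : I -> Omega -> T).
Hypothesis Z_meas : forall i, measurable_fun setT (Z i).
Hypothesis Z_indep : mutually_independent P Z.

Definition joint (w : Omega) : famType I := fun i => Z i w.

Lemma measurable_joint : measurable_fun setT joint.
Proof. exact: measurable_to_family. Qed.

Definition joint_mix (J : {set I}) (u : Omega * Omega) : famType I :=
  mix J (joint u.1) (joint u.2).

Lemma measurable_joint_mix J : measurable_fun setT (joint_mix J).
Proof.
apply: measurable_to_family => i; rewrite /joint_mix /mix.
case: (i \in J); first exact: measurableT_comp (Z_meas i) measurable_fst.
exact: measurableT_comp (Z_meas i) measurable_snd.
Qed.

HB.instance Definition _ := isMeasurableFun.Build _ _ _ _ joint measurable_joint.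
HB.instance Definition _ J :=
  isMeasurableFun.Build _ _ _ _ (joint_mix J) (measurable_joint_mix J).

(** On a rectangle both laws are the product of the marginal probabilities, and the rectangles form
    a generating family closed under intersection. *)
Lemma joint_mix_law J (A : set (famType I)) : measurable A ->
  distribution P joint A = distribution (P \x P)%E (joint_mix J) A.
Proof.
move=> mA; apply: (@g_sigma_algebra_measure_unique _ _ (famType I) (@rectangles _ T I)
  _ (fun=> setT)) => //.
- by move=> E GE; exact: sub_sigma_algebra.
- by move=> _; exists (fun=> setT) => //; apply/seteqP; split.
- by apply/seteqP; split=> // z _; exists 0%N.
- exact: rectangles_setI.
- move=> _ [B mB ->].
  change (P (joint @^-1` [set z | forall i, B i (z i)]) =
    (P \x P)%E (joint_mix J @^-1` [set z | forall i, B i (z i)])).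
  pose H (K : {set I}) := \bigcap_(i in [set` K]) (Z i @^-1` B i).
  have mH K : measurable (H K).
    apply: fin_bigcap_measurable => // i _; rewrite -[X in measurable X]setTI.
    exact: Z_meas.
  rewrite [joint @^-1` _](_ : _ = H [set: I]%SET); last first.
    by apply/seteqP; split=> [w Bw i _|w Bw i] /=; [exact: Bw|apply: Bw; rewrite /= inE].
  rewrite [joint_mix J @^-1` _](_ : _ = H J `*` H (~: J)%SET); last first.
    apply/seteqP; split=> [[w w'] Bw|[w w'] [/= Bw Bw'] i] /=.
      split=> i /= iJ; have := Bw i; rewrite /joint_mix /mix /=.
        by rewrite iJ.
      by move: iJ; rewrite inE => /negbTE ->.
    rewrite /joint_mix /mix /=; case: ifP => iJ; first exact: Bw.
    by apply: Bw'; rewrite /= inE iJ.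
  rewrite product_measure1E // !Z_indep // (bigID (mem J)) /=.
  by congr (_ * _)%E; rewrite Z_indep //; apply: eq_bigl => i; rewrite !inE.
- by move=> _; rewrite -ge0_fin_numE ?measure_ge0 //; exact: (fin_num_measure (distribution P joint)).
Qed.

(** The form in which independence is used throughout: the inner integral is the conditional
    expectation given the coordinates in [J]. *)
Lemma decouple (J : {set I}) (F : @famType _ T I -> \bar R) :
  measurable_fun [set: @famType _ T I] F ->
  (forall z, 0 <= F z)%E ->
  (\int[P]_w F (joint w) = \int[P]_w \int[P]_w' F (mix J (joint w) (joint w')))%E.
Proof.
move=> mF F0; rewrite -(ge0_integral_distribution [the {mfun Omega >-> famType I} of joint]) //.
rewrite (eq_measure_integral (distribution (P \x P)%E (joint_mix J))); last first.
  by move=> A mA _; exact: joint_mix_law.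
rewrite ge0_integral_distribution // fubini_tonelli1 //.
  exact: measurableT_comp mF (measurable_joint_mix J).
by move=> u; exact: F0.
Qed.

Lemma decouple_integrable (J : {set I}) (F : @famType _ T I -> \bar R) :
  measurable_fun [set: @famType _ T I] F ->
  P.-integrable setT (F \o joint) ->
  (\int[P]_w F (joint w) = \int[P]_w \int[P]_w' F (mix J (joint w) (joint w')))%E.
Proof.
move=> mF iF; rewrite -(integral_distribution (X := [the {mfun Omega >-> famType I} of joint]) mF iF).
rewrite (eq_measure_integral (distribution (P \x P)%E (joint_mix J))); last first.
  by move=> A mA _; exact: joint_mix_law.
have mFm : measurable_fun setT (F \o joint_mix J).
  exact: measurableT_comp mF (measurable_joint_mix J).
have iFm : (P \x P)%E.-integrable setT (F \o joint_mix J).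
  apply/integrableP; split => //.
  have mabsF : measurable_fun [set: @famType _ T I] (abse \o F) by exact: measurableT_comp.
  move/integrableP : iF => [_]; rewrite (decouple J mabsF) => [|z]; last exact: abse_ge0.
  rewrite (fubini_tonelli1 (fun u => `|F (joint_mix J u)|%E)) //.
  exact: measurableT_comp mabsF (measurable_joint_mix J).
by rewrite integral_distribution // -integral12_prod_meas1.
Qed.

End Decouple.

(** * Bounded measurable functions and their integrals *)

Section BoundedMeasurable.
Context {R : realType} {d : measure_display} {Omega : measurableType d}.
Implicit Types f g : Omega -> R.

(** This class is closed under the ring operations and integrable under every probability, which
    disposes of most integrability side conditions. *)
Definition bmeas f := measurable_fun setT f /\ exists K, forall w, `|f w| <= K.

Lemma bmeas_cst c : bmeas (fun=> c).
Proof. by split; [exact: measurable_cst|exists `|c|]. Qed.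

Lemma bmeasD f g : bmeas f -> bmeas g -> bmeas (fun w => f w + g w).
Proof.
move=> [mf [K fK]] [mg [L gL]]; split; first exact: measurable_funD.
by exists (K + L) => w; apply: le_trans (ler_normD _ _) _; exact: lerD.
Qed.

Lemma bmeasM f g : bmeas f -> bmeas g -> bmeas (fun w => f w * g w).
Proof.
move=> [mf [K fK]] [mg [L gL]]; split; first exact: measurable_funM.
by exists (K * L) => w; rewrite normrM; apply: ler_pM.
Qed.

Lemma bmeasZ c f : bmeas f -> bmeas (fun w => c * f w).
Proof. by move=> bf; apply: bmeasM => //; exact: bmeas_cst. Qed.

Lemma bmeasN f : bmeas f -> bmeas (fun w => - f w).
Proof.
move=> bf; have := bmeasZ (-1) bf; congr bmeas.
by apply/funext => w; rewrite mulN1r.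
Qed.

Lemma bmeasB f g : bmeas f -> bmeas g -> bmeas (fun w => f w - g w).
Proof. by move=> bf bg; apply: bmeasD => //; exact: bmeasN. Qed.

Lemma bmeasX f n : bmeas f -> bmeas (fun w => f w ^+ n).
Proof.
move=> bf; elim: n => [|n IH].
  by under eq_fun do rewrite expr0; exact: bmeas_cst.
by under eq_fun do rewrite exprS; exact: bmeasM.
Qed.

Lemma bmeas_norm f : bmeas f -> bmeas (fun w => `|f w|).
Proof.
move=> [mf [K fK]]; split; first exact: measurableT_comp.
by exists K => w; rewrite normr_id.
Qed.

Lemma bmeas_sum (I : Type) (r : seq I) (Q : pred I) (f : I -> Omega -> R) :
  (forall i, bmeas (f i)) -> bmeas (fun w => \sum_(i <- r | Q i) f i w).
Proof.
move=> bf; elim: r => [|i r IH].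
  by under eq_fun do rewrite big_nil; exact: bmeas_cst.
under eq_fun do rewrite big_cons; case: (Q i) => //.
exact: bmeasD.
Qed.

Variable P : probability Omega R.

Lemma integrable_sub f g : P.-integrable setT (EFin \o g) -> measurable_fun setT f ->
  (forall w, `|f w| <= g w) -> P.-integrable setT (EFin \o f).
Proof.
move=> ig mf fg; apply: le_integrable ig => //; first exact/measurable_EFinP.
by move=> w _ /=; rewrite lee_fin (le_trans (fg w)) // ler_norm.
Qed.

Lemma bmeas_integrable f : bmeas f -> P.-integrable setT (EFin \o f).
Proof.
move=> [mf [K fK]]; apply: (@integrable_sub _ (fun=> K)) => //.
by apply: finite_measure_integrable_cst.
Qed.

Lemma RintegralZ c f : P.-integrable setT (EFin \o f) ->
  \int[P]_w (c * f w) = c * \int[P]_w f w.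
Proof. by move=> iF; rewrite RintegralZl. Qed.

Lemma Rintegral_prob_cst c : \int[P]_w c = c :> R.
Proof.
rewrite Rintegral_cst // [X in fine X](_ : _ = 1%E) ?mulr1 //.
exact: probability_setT.
Qed.

Lemma le_Rintegral_all f g : P.-integrable setT (EFin \o f) ->
  P.-integrable setT (EFin \o g) -> (forall w, f w <= g w) ->
  \int[P]_w f w <= \int[P]_w g w.
Proof. by move=> intf intg fg; apply: le_Rintegral => // w _. Qed.

Lemma norm_Rintegral_le f g : P.-integrable setT (EFin \o f) ->
  P.-integrable setT (EFin \o g) -> (forall w, `|f w| <= g w) ->
  `|\int[P]_w f w| <= \int[P]_w g w.
Proof.
move=> intf intg fg; apply: le_trans (le_normr_Rintegral _ intf) _ => //.
apply: le_Rintegral_all => //; exact: (integrable_norm intf).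
Qed.

Lemma Rintegral_norm_bound f K : measurable_fun setT f -> (forall w, `|f w| <= K) ->
  `|\int[P]_w f w| <= K.
Proof.
move=> mf fK; rewrite -[leRHS]Rintegral_prob_cst.
apply: norm_Rintegral_le => //; apply: bmeas_integrable; last exact: bmeas_cst.
by split; last exists K.
Qed.

Lemma Rintegral_sum (I : Type) (r : seq I) (Q : pred I) (f : I -> Omega -> R) :
  (forall i, P.-integrable setT (EFin \o f i)) ->
  \int[P]_w (\sum_(i <- r | Q i) f i w) = \sum_(i <- r | Q i) \int[P]_w f i w.
Proof.
move=> intf.
suff [] : P.-integrable setT (EFin \o (fun w => \sum_(i <- r | Q i) f i w)) /\
  \int[P]_w (\sum_(i <- r | Q i) f i w) = \sum_(i <- r | Q i) \int[P]_w f i w by [].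
elim: r => [|i r [IHi IH]].
  under [in X in _ /\ X]eq_Rintegral do rewrite big_nil.
  rewrite big_nil Rintegral_prob_cst; split => //.
  under [X in EFin \o X]eq_fun do rewrite big_nil.
  exact: finite_measure_integrable_cst.
rewrite big_cons; under [X in EFin \o X]eq_fun do rewrite big_cons.
under [in X in _ /\ X]eq_Rintegral do rewrite big_cons.
case: (Q i) => //; rewrite -IH -RintegralD //; split => //.
exact: (integrableD measurableT (intf i) IHi).
Qed.

Lemma integrable_sumR (I : Type) (r : seq I) (Q : pred I) (f : I -> Omega -> R) :
  (forall i, P.-integrable setT (EFin \o f i)) ->
  P.-integrable setT (EFin \o (fun w => \sum_(i <- r | Q i) f i w)).
Proof.
move=> intf; elim: r => [|i r IHi].
  under [X in EFin \o X]eq_fun do rewrite big_nil.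
  exact: finite_measure_integrable_cst.
under [X in EFin \o X]eq_fun do rewrite big_cons.
by case: (Q i) => //; exact: (integrableD measurableT (intf i) IHi).
Qed.

(** Integrate [2 c f - c^2 <= f^2] with [c] the mean of [f]. *)
Lemma sqr_Rintegral_le f : P.-integrable setT (EFin \o f) ->
  P.-integrable setT (EFin \o (fun w => f w ^+ 2)) ->
  (\int[P]_w f w) ^+ 2 <= \int[P]_w (f w ^+ 2).
Proof.
move=> if1 if2; set c := \int[P]_w f w.
have ic : P.-integrable setT (EFin \o (fun w => 2 * c * f w - c ^+ 2)).
  apply: (@integrableB _ _ _ _ _ measurableT (EFin \o (fun w => 2 * c * f w)) (fun=> (c ^+ 2)%:E)).
    exact: (integrableZl measurableT (2 * c) if1).
  exact: finite_measure_integrable_cst.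
have : \int[P]_w (2 * c * f w - c ^+ 2) <= \int[P]_w (f w ^+ 2).
  by apply: le_Rintegral_all => // w; have := sqr_ge0 (f w - c); lra.
rewrite RintegralB //; last exact: finite_measure_integrable_cst.
  by rewrite RintegralZ // Rintegral_prob_cst -/c; apply: le_trans; lra.
exact: (integrableZl measurableT (2 * c) if1).
Qed.

End BoundedMeasurable.

(** * Concentration *)

Section FourthMoment.
Context {R : realType} {d : measure_display} {Omega : measurableType d}
  (P : probability Omega R).

(** The square [(x (s - x))^2 >= 0] trades [4 s x^3] for [2 s^2 x^2 + 2 x^4], whence 8 = 6 + 2 and 3
    = 1 + 2. The term [x s^3] is kept because its integral vanishes for a martingale. *)
Lemma fourth_power_step (s x a : R) : `|x| <= a ->
  (s + x) ^+ 4 <= s ^+ 4 + 4 * (x * s ^+ 3) + 8 * a ^+ 2 * s ^+ 2 + 3 * a ^+ 4.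
Proof.
move=> xa; have a0 : 0 <= a by apply: le_trans xa.
have x2 : x ^+ 2 <= a ^+ 2 by rewrite -[x ^+ 2]real_normK ?num_real // lerXn2r ?nnegrE.
have x4 : x ^+ 4 <= a ^+ 4.
  by rewrite -[4%N]/(2 * 2)%N !exprM lerXn2r ?nnegrE ?sqr_ge0.
have sx : s ^+ 2 * x ^+ 2 <= s ^+ 2 * a ^+ 2 by apply: ler_wpM2l; rewrite ?sqr_ge0.
have : 0 <= (x * (s - x)) ^+ 2 by apply: sqr_ge0.
have -> : (s + x) ^+ 4 = s ^+ 4 + 4 * (x * s ^+ 3) + 6 * (s ^+ 2 * x ^+ 2)
  + 4 * (s * x ^+ 3) + x ^+ 4 by ring.
have -> : (x * (s - x)) ^+ 2 = s ^+ 2 * x ^+ 2 - 2 * (s * x ^+ 3) + x ^+ 4 by ring.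
lra.
Qed.

Variables (S : nat -> Omega -> R) (a : R).
Hypothesis S_bmeas : forall k, bmeas (S k).
Hypothesis S0 : forall w, S 0%N w = 0.
Hypothesis S_step : forall k w, `|S k.+1 w - S k w| <= a.
(** The martingale property, tested against powers of the past partial sum. *)
Hypothesis S_orth : forall k j,
  \int[P]_w ((S k.+1 w - S k w) * S k w ^+ j) = 0.

Lemma martingale_moment2 k : \int[P]_w (S k w ^+ 2) <= k%:R * a ^+ 2.
Proof.
elim: k => [|k IH].
  by under eq_Rintegral do rewrite S0 expr0n; rewrite Rintegral_prob_cst mul0r.
pose D w := S k.+1 w - S k w.
have bD : bmeas D by apply: bmeasB.
have i1 : P.-integrable setT (EFin \o (fun w => S k w ^+ 2)).
  by apply/bmeas_integrable/bmeasX.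
have i2 : P.-integrable setT (EFin \o (fun w => 2 * (D w * S k w ^+ 1))).
  by apply/bmeas_integrable/bmeasZ/bmeasM => //; exact: bmeasX.
have i3 : P.-integrable setT (EFin \o (fun=> a ^+ 2)).
  exact/bmeas_integrable/bmeas_cst.
apply: (@le_trans _ _ (\int[P]_w (S k w ^+ 2 + 2 * (D w * S k w ^+ 1) + a ^+ 2))).
  apply: le_Rintegral_all; first exact/bmeas_integrable/bmeasX.
    by apply/bmeas_integrable/bmeasD; [apply: bmeasD|apply: bmeas_cst];
      [exact: bmeasX|apply/bmeasZ/bmeasM => //; exact: bmeasX].
  move=> w; rewrite -[S k.+1 w](subrK (S k w)) -/(D w) expr1.
  have : D w ^+ 2 <= a ^+ 2.
    have a0 : 0 <= a by apply: le_trans (S_step 0 w).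
    by rewrite -[D w ^+ 2]real_normK ?num_real // lerXn2r ?nnegrE //; exact: S_step.
  by move=> h; have -> : (D w + S k w) ^+ 2 = D w ^+ 2 + 2 * (D w * S k w) + S k w ^+ 2; [ring|lra].
rewrite RintegralD //; last exact: (integrableD measurableT i1 i2).
rewrite RintegralD // RintegralZ; last by apply/bmeas_integrable/bmeasM => //; exact: bmeasX.
rewrite S_orth mulr0 addr0 Rintegral_prob_cst -natr1 mulrDl mul1r lerD2r.
exact: IH.
Qed.

(** Induction on [k]: one step adds at most [8 k a^4 + 3 a^4], by [fourth_power_step] and
    [martingale_moment2], which fits into the increment [14 k a^4 + 7 a^4] of the bound. *)
Lemma martingale_moment4 k : \int[P]_w (S k w ^+ 4) <= 7 * (k%:R ^+ 2 * a ^+ 4).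
Proof.
have a4 : 0 <= a ^+ 4 by rewrite -[4%N]/(2 * 2)%N exprM sqr_ge0.
elim: k => [|k IH].
  by under eq_Rintegral do rewrite S0 expr0n; rewrite Rintegral_prob_cst expr0n mul0r mulr0.
pose D w := S k.+1 w - S k w.
have bD : bmeas D by apply: bmeasB.
have b1 : bmeas (fun w => S k w ^+ 4) by exact: bmeasX.
have b2 : bmeas (fun w => D w * S k w ^+ 3) by apply/bmeasM => //; exact: bmeasX.
have b3 : bmeas (fun w => S k w ^+ 2) by exact: bmeasX.
apply: (@le_trans _ _ (\int[P]_w (S k w ^+ 4 + 4 * (D w * S k w ^+ 3) +
    8 * a ^+ 2 * S k w ^+ 2 + 3 * a ^+ 4))).
  apply: le_Rintegral_all; first exact/bmeas_integrable/bmeasX.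
    apply/bmeas_integrable; apply: bmeasD (bmeas_cst _).
    by apply: bmeasD; [apply: bmeasD => //|]; exact: bmeasZ.
  move=> w; rewrite -[S k.+1 w](subrK (S k w)) -/(D w) addrC.
  exact/fourth_power_step/S_step.
have b12 : bmeas (fun w => S k w ^+ 4 + 4 * (D w * S k w ^+ 3)).
  by apply: bmeasD => //; exact: bmeasZ.
have b3' : bmeas (fun w => 8 * a ^+ 2 * S k w ^+ 2) by exact: bmeasZ.
have b123 := bmeasD b12 b3'.
rewrite (RintegralD measurableT (bmeas_integrable P b123)); last first.
  exact/bmeas_integrable/bmeas_cst.
rewrite (RintegralD measurableT (bmeas_integrable P b12) (bmeas_integrable P b3')).
rewrite (RintegralD measurableT (bmeas_integrable P b1)); last first.
  exact/bmeas_integrable/bmeasZ.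
rewrite (RintegralZ _ (bmeas_integrable P b2)) (RintegralZ _ (bmeas_integrable P b3)).
rewrite S_orth mulr0 addr0 Rintegral_prob_cst.
have := martingale_moment2 k; rewrite -(ler_pM2l (x := 8)) // => m2.
have : 8 * a ^+ 2 * \int[P]_w (S k w ^+ 2) <= 8 * k%:R * a ^+ 4.
  have -> : 8 * k%:R * a ^+ 4 = a ^+ 2 * (8 * (k%:R * a ^+ 2)) by ring.
  rewrite [8 * a ^+ 2]mulrC -mulrA; apply: ler_wpM2l => //; exact: sqr_ge0.
rewrite -[k.+1%:R]natr1; set N := k%:R; have N0 : 0 <= N :> R by apply: ler0n.
have : 0 <= N * a ^+ 4 by apply: mulr_ge0.
have -> : 7 * ((N + 1) ^+ 2 * a ^+ 4) = 7 * (N ^+ 2 * a ^+ 4) + 14 * (N * a ^+ 4) + 7 * a ^+ 4.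
  by ring.
have -> : 8 * N * a ^+ 4 = 8 * (N * a ^+ 4) by ring.
by move: IH; rewrite -/N; lra.
Qed.

End FourthMoment.

Section Concentration.
Context {R : realType} {d d' : measure_display} {Omega : measurableType d}
  {T : measurableType d'}.
Variables (P : probability Omega R) (I : finType) (Z : I -> Omega -> T).
Hypothesis Z_meas : forall i, measurable_fun setT (Z i).
Hypothesis Z_indep : mutually_independent P Z.
Local Notation fam := (@famType _ T I).
Local Notation joint := (joint Z).

Lemma decouple_R (J : {set I}) (F : fam -> R) : bmeas F ->
  \int[P]_w F (joint w) = \int[P]_w \int[P]_w' F (mix J (joint w) (joint w')).
Proof.
move=> bF; have [mF [K FK]] := bF.
rewrite [LHS]/Rintegral (decouple_integrable Z_meas Z_indep J
  (F := fun z => (F z)%:E)) /=; last 2 first.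
- exact/measurable_EFinP.
- apply: bmeas_integrable; split; last by exists K.
  exact: measurableT_comp mF (measurable_joint Z_meas).
congr fine; apply: eq_integral => w _; rewrite fineK //.
have iF : P.-integrable setT (EFin \o (fun w' => F (mix J (joint w) (joint w')))).
  apply: bmeas_integrable; split; last by exists K.
  have := measurable_joint_mix Z_meas J; move/(measurableT_comp mF).
  exact: (measurable_fun_pair2 w).
exact: integrable_fin_num iF.
Qed.

Variables (n : nat) (r : I -> nat).
Hypothesis r_lt : forall i, (r i < n)%N.
Variables (F : fam -> R) (a : R).
Hypothesis F_bmeas : bmeas F.
Hypothesis F_block : forall k z z', (forall i, r i != k -> z i = z' i) ->
  `|F z - F z'| <= a.

(** The Doob martingale of [F] along the filtration that reveals the blocks [r i = 0, 1, ...] one at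
    a time: [Fk k] averages out the coordinates whose block is at least [k]. *)
Let J (k : nat) : {set I} := [set i | (r i < k)%N]%SET.
Let Fk (k : nat) (z : fam) : R := \int[P]_w F (mix (J k) z (joint w)).

Lemma measurable_mix2 (K : {set I}) :
  measurable_fun setT (fun u : fam * fam => mix K u.1 u.2).
Proof.
apply: measurable_to_family => i; rewrite /mix; case: (i \in K).
  exact: measurableT_comp (measurable_coord i) measurable_fst.
exact: measurableT_comp (measurable_coord i) measurable_snd.
Qed.

Let bmeas_mix (k : nat) z : bmeas (fun w => F (mix (J k) z (joint w))).
Proof.
have [mF [K FK]] := F_bmeas; split; last by exists K.
apply: measurableT_comp mF _.
have := measurable_mix2 (J k) => /(measurable_fun_pair2 z) h.
exact: measurableT_comp h (measurable_joint Z_meas).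
Qed.

Let Fk_bmeas k : bmeas (Fk k).
Proof.
have [mF [K FK]] := F_bmeas; split; last first.
  by exists K => z; apply: Rintegral_norm_bound => //; exact: (bmeas_mix k z).1.
have mj := measurable_joint Z_meas.
pose g (u : fam * Omega) : R := F (mix (J k) u.1 (joint u.2)).
have mg : measurable_fun setT g.
  apply: measurableT_comp mF _.
  have mp : measurable_fun setT (fun u : fam * Omega => (u.1, joint u.2)); last first.
    exact: measurableT_comp (measurable_mix2 (J k)) mp.
  apply: measurable_fun_pair; first exact: measurable_fst.
  exact: measurableT_comp mj measurable_snd.
(* Measurability in [z] is obtained from Fubini on [fam * Omega], where [fam] carries the law of
   [joint]. *)
pose mu := distribution P (mfun_Sub (mem_set mj)).
apply: (@measurableT_comp _ _ _ _ _ _ (@fine R)); first exact: fine_measurable.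
apply: (@measurable_fubini_F _ _ _ _ _ mu P (EFin \o g)).
apply: (bmeas_integrable (mu \x P)%E); split => //.
by exists K => u; exact: FK.
Qed.

Lemma mix_comp k z z' z'' :
  mix (J k) z (mix (J k.+1) z' z'') = mix (J k.+1) (mix (J k) z z') z'' :> fam.
Proof.
apply/funext => i; rewrite /mix !inE ltnS.
by case: (ltnP (r i) k) => [/ltnW ->|_].
Qed.

(** The tower property: resampling the blocks from [k] on and then those from [k.+1] on amounts to
    one resampling, by [decouple_R]. *)
Lemma Fk_tower k z : \int[P]_w Fk k.+1 (mix (J k) z (joint w)) = Fk k z.
Proof.
have [mF [K FK]] := F_bmeas.
rewrite [RHS](@decouple_R (J k.+1) (fun z' => F (mix (J k) z z'))); last first.
  split; last by exists K.
  apply: measurableT_comp mF _.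
  exact: (measurable_fun_pair2 z (measurable_mix2 (J k))).
apply: eq_Rintegral => w _; apply: eq_Rintegral => w' _.
by rewrite mix_comp.
Qed.

Let S k w := Fk k (joint w) - \int[P]_w' F (joint w').

Let Fk0 z : Fk 0 z = \int[P]_w F (joint w).
Proof.
apply: eq_Rintegral => w _; congr F; apply/funext => i.
by rewrite /mix inE ltn0.
Qed.

Let Fkn z : Fk n z = F z.
Proof.
rewrite /Fk -[RHS](Rintegral_prob_cst P); apply: eq_Rintegral => w _; congr F.
by apply/funext => i; rewrite /mix inE r_lt.
Qed.

Let Fk_mix k z z' : Fk k (mix (J k) z z') = Fk k z.
Proof.
apply: eq_Rintegral => w _; congr F; apply/funext => i.
by rewrite /mix; case: (i \in J k).
Qed.

(** Both averages use the same resampled point, so the integrands are compared at two points that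
    differ in block [k] only. *)
Let Fk_step k z : `|Fk k.+1 z - Fk k z| <= a.
Proof.
rewrite /Fk -RintegralB //; try exact/bmeas_integrable/bmeas_mix.
apply: Rintegral_norm_bound => [|w].
  by apply: (bmeasB _ _).1; exact: bmeas_mix.
apply: (F_block (k := k)) => i ik; rewrite /mix !inE ltnS leq_eqVlt (negbTE ik).
by case: ltnP.
Qed.

Let S_bmeas k : bmeas (S k).
Proof.
apply: bmeasB; last exact: bmeas_cst.
have [mFk [K FkK]] := Fk_bmeas k; split; last by exists K.
exact: measurableT_comp mFk (measurable_joint Z_meas).
Qed.

Let S_orth k j : \int[P]_w ((S k.+1 w - S k w) * S k w ^+ j) = 0.
Proof.
set c := \int[P]_w F (joint w).
pose G (z : fam) := (Fk k.+1 z - Fk k z) * (Fk k z - c) ^+ j.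
have bG : bmeas G.
  by apply: bmeasM; [exact: bmeasB|apply/bmeasX/bmeasB => //; exact: bmeas_cst].
transitivity (\int[P]_w G (joint w)).
  by apply: eq_Rintegral => w _; rewrite /S /G -/c; congr (_ * _); ring.
(* With the blocks below [k] fixed, the power of [Fk k - c] is constant and the increment averages
   to zero by [Fk_tower]. *)
rewrite (decouple_R (J k) bG) -[RHS](Rintegral_prob_cst P).
apply: eq_Rintegral => w _; rewrite /G.
under eq_Rintegral do rewrite Fk_mix mulrC.
have bmk : bmeas (fun w' => Fk k.+1 (mix (J k) (joint w) (joint w'))).
  have [mFk [K FkK]] := Fk_bmeas k.+1; split; last by exists K.
  apply: measurableT_comp mFk _.
  have := measurable_mix2 (J k) => /(measurable_fun_pair2 (joint w)) h.
  exact: measurableT_comp h (measurable_joint Z_meas).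
rewrite RintegralZ; last by apply/bmeas_integrable/bmeasB => //; exact: bmeas_cst.
rewrite RintegralB //; last 2 first.
- exact: bmeas_integrable.
- exact/bmeas_integrable/bmeas_cst.
by rewrite Fk_tower Rintegral_prob_cst subrr mulr0.
Qed.

Let S_step k w : `|S k.+1 w - S k w| <= a.
Proof. by rewrite /S opprB addrA subrK; exact: Fk_step. Qed.

Let S0 w : S 0 w = 0. Proof. by rewrite /S Fk0 subrr. Qed.

Lemma block_variance :
  \int[P]_w ((F (joint w) - \int[P]_w' F (joint w')) ^+ 2) <= n%:R * a ^+ 2.
Proof.
have := martingale_moment2 S_bmeas S0 S_step S_orth n.
by under eq_Rintegral do rewrite /S Fkn.
Qed.

Lemma block_moment4 :
  \int[P]_w ((F (joint w) - \int[P]_w' F (joint w')) ^+ 4)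
    <= 7 * (n%:R ^+ 2 * a ^+ 4).
Proof.
have := martingale_moment4 S_bmeas S0 S_step S_orth n.
by under eq_Rintegral do rewrite /S Fkn.
Qed.

End Concentration.

(** * Functions of disjoint sets of coordinates *)

Section Independence.
Context {R : realType} {d d' : measure_display} {Omega : measurableType d}
  {T : measurableType d'}.
Variables (P : probability Omega R).

Lemma mutually_independent_sub (I I' : finType) (h : I' -> I) (Z : I -> Omega -> T) :
  injective h -> mutually_independent P Z -> mutually_independent P (Z \o h).
Proof.
move=> hinj ZI J B mB.
(* The events are carried along [h]; outside its image the full space is a harmless default. *)
pose B' i := if [pick j | h j == i] is Some j then B j else setT.
have B'h j : B' (h j) = B j.
  by rewrite /B'; case: pickP => [k /eqP/hinj ->|/(_ j)] //; rewrite eqxx.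
have mB' i : measurable (B' i) by rewrite /B'; case: pickP.
have := ZI (h @: J)%SET B' mB'; rewrite big_imset /=; last by move=> ? ? _ _; exact: hinj.
rewrite [X in P X](_ : _ = \bigcap_(j in [set` J]) ((Z \o h) j @^-1` B j)).
  by move=> ->; apply: eq_bigr => j _; rewrite B'h.
apply/seteqP; split=> w Bw => [j jJ|_ /= /imsetP[j jJ ->]].
  by have := Bw (h j) (imset_f _ jJ); rewrite /= B'h.
by rewrite B'h; exact: Bw.
Qed.

Lemma mutually_independent_comp d'' (T' : measurableType d'') (I : finType)
    (Z : I -> Omega -> T) (phi : T -> T') :
  measurable_fun setT phi -> mutually_independent P Z ->
  mutually_independent P (fun i => phi \o Z i).
Proof.
move=> mphi ZI J B mB; have := ZI J (fun i => phi @^-1` B i).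
by apply => i; rewrite -[X in measurable X]setTI; exact: mphi.
Qed.

Variables (I : finType) (Z : I -> Omega -> T).
Hypothesis Z_meas : forall i, measurable_fun setT (Z i).
Hypothesis Z_indep : mutually_independent P Z.
Local Notation fam := (@famType _ T I).
Local Notation joint := (joint Z).

Variables (J : {set I}) (f g : fam -> R).
Hypothesis f_meas : measurable_fun setT f.
Hypothesis g_meas : measurable_fun setT g.
Hypothesis f_J : forall z z' : fam, (forall i, i \in J -> z i = z' i) -> f z = f z'.
Hypothesis g_J : forall z z' : fam, (forall i, i \notin J -> z i = z' i) -> g z = g z'.
Hypothesis f_int : P.-integrable setT (EFin \o (f \o joint)).
Hypothesis g_int : P.-integrable setT (EFin \o (g \o joint)).

Let f_mix z z' : f (mix J z z') = f z.
Proof. by apply: f_J => i iJ; rewrite /mix iJ. Qed.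

Let g_mix z z' : g (mix J z z') = g z'.
Proof. by apply: g_J => i iJ; rewrite /mix (negbTE iJ). Qed.

Let mjoint := measurable_joint Z_meas.

Lemma indep_integrableM : P.-integrable setT (EFin \o (fun w => f (joint w) * g (joint w))).
Proof.
apply/integrableP; split.
  apply/measurable_EFinP/measurable_funM; exact: measurableT_comp mjoint.
pose F (z : fam) : \bar R := `|(f z * g z)%:E|%E.
have mF : measurable_fun setT F.
  by apply: measurableT_comp => //; apply/measurable_EFinP/measurable_funM.
rewrite (_ : (\int[P]_x _)%E = \int[P]_w F (joint w))%E //.
rewrite (decouple Z_meas Z_indep J mF) => [|z]; last exact: abse_ge0.
have mf : measurable_fun setT (fun w => `|(f (joint w))%:E|%E).
  apply: measurableT_comp => //; apply/measurable_EFinP.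
  exact: measurableT_comp f_meas mjoint.
have mg : measurable_fun setT (fun w => `|(g (joint w))%:E|%E).
  apply: measurableT_comp => //; apply/measurable_EFinP.
  exact: measurableT_comp g_meas mjoint.
have [_ gfin] := integrableP _ _ _ g_int; have [_ ffin] := integrableP _ _ _ f_int.
set G := (\int[P]_w `|(g (joint w))%:E|)%E.
have -> : (\int[P]_w \int[P]_w' F (mix J (joint w) (joint w')) =
   \int[P]_w (`|(f (joint w))%:E| * G))%E.
  apply: eq_integral => w _; rewrite -ge0_integralZl //.
  by apply: eq_integral => w' _; rewrite /F f_mix g_mix EFinM abseM.
rewrite ge0_integralZr //; last exact: integral_ge0.
rewrite lte_mul_pinfty ?integral_ge0 // ge0_fin_numE ?integral_ge0 //.
Qed.

Lemma indep_RintegralM : \int[P]_w (f (joint w) * g (joint w)) =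
  (\int[P]_w f (joint w)) * \int[P]_w g (joint w).
Proof.
have mfg : measurable_fun setT (fun z : fam => (f z * g z)%:E).
  by apply/measurable_EFinP/measurable_funM.
rewrite [LHS]/Rintegral (decouple_integrable Z_meas Z_indep J mfg); last first.
  exact: indep_integrableM.
have gE : (\int[P]_w (g (joint w))%:E)%E = (\int[P]_w g (joint w))%:E.
  by rewrite fineK //; exact: integrable_fin_num g_int.
transitivity (fine (\int[P]_w ((\int[P]_w g (joint w))%:E * (f (joint w))%:E))%E).
  congr fine; apply: eq_integral => w _.
  rewrite -gE muleC -integralZl //.
  by apply: eq_integral => w' _; rewrite f_mix g_mix EFinM.
have fE : (\int[P]_w (f (joint w))%:E)%E = (\int[P]_w f (joint w))%:E.
  by rewrite fineK //; exact: integrable_fin_num f_int.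
by rewrite (integralZl measurableT f_int) fE /= mulrC.
Qed.

End Independence.

(** * Square-integrable functions and orthogonal sums *)

Section SquareIntegrable.
Context {R : realType} {d : measure_display} {Omega : measurableType d}
  (P : probability Omega R).
Implicit Types f g : Omega -> R.

Definition sqint f := measurable_fun setT f /\
  P.-integrable setT (EFin \o (fun w => f w ^+ 2)).

Lemma sqint_mul f g : sqint f -> sqint g ->
  P.-integrable setT (EFin \o (fun w => f w * g w)).
Proof.
move=> [mf f2] [mg g2].
apply: (@integrable_sub _ _ _ _ _ (fun w => f w ^+ 2 + g w ^+ 2)).
- exact: (integrableD measurableT f2 g2).
- exact: measurable_funM.
move=> w; rewrite ler_norml; have := sqr_ge0 (f w + g w).
have := sqr_ge0 (f w - g w); have := sqr_ge0 (f w); have := sqr_ge0 (g w).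
by move=> *; apply/andP; split; lra.
Qed.

Lemma sqint_cst c : sqint (fun=> c).
Proof. by split; [exact: measurable_cst|exact: finite_measure_integrable_cst]. Qed.

Lemma sqint_integrable f : sqint f -> P.-integrable setT (EFin \o f).
Proof.
move=> sf; have := sqint_mul sf (sqint_cst 1).
by under [X in EFin \o X]eq_fun do rewrite mulr1.
Qed.

Lemma sqintD f g : sqint f -> sqint g -> sqint (fun w => f w + g w).
Proof.
move=> [mf f2] [mg g2]; split; first exact: measurable_funD.
apply: (@integrable_sub _ _ _ _ _ (fun w => 2 * (f w ^+ 2 + g w ^+ 2))).
- exact: (integrableZl measurableT 2 (integrableD measurableT f2 g2)).
- by apply: measurable_funX; exact: measurable_funD.
by move=> w; rewrite ger0_norm ?sqr_ge0 //; have := sqr_ge0 (f w - g w); lra.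
Qed.

Lemma sqintZ c f : sqint f -> sqint (fun w => c * f w).
Proof.
move=> [mf f2]; split; first exact: measurable_funM.
under [X in EFin \o X]eq_fun do rewrite exprMn.
exact: (integrableZl measurableT (c ^+ 2) f2).
Qed.

Lemma sqint_sum (I : Type) (r : seq I) (A : pred I) (f : I -> Omega -> R) :
  (forall i, sqint (f i)) -> sqint (fun w => \sum_(i <- r | A i) f i w).
Proof.
move=> sf; elim: r => [|i r IH].
  by under eq_fun do rewrite big_nil; exact: sqint_cst.
under eq_fun do rewrite big_cons; case: (A i) => //.
exact: sqintD.
Qed.

Lemma bmeas_sqint f : bmeas f -> sqint f.
Proof. by move=> bf; split; [exact: bf.1|exact/bmeas_integrable/bmeasX]. Qed.

Lemma sqint_sum_orth (I : finType) (A : pred I) (f : I -> Omega -> R) :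
  (forall i, sqint (f i)) ->
  (forall i j, i != j -> \int[P]_w (f i w * f j w) = 0) ->
  \int[P]_w ((\sum_(i | A i) f i w) ^+ 2) = \sum_(i | A i) \int[P]_w (f i w ^+ 2).
Proof.
move=> sf forth.
under eq_Rintegral => w _.
  rewrite expr2 mulr_suml; under eq_bigr do rewrite mulr_sumr; over.
rewrite Rintegral_sum => [|i]; last first.
  by apply: integrable_sumR => j; exact: sqint_mul.
apply: eq_bigr => i Ai; rewrite Rintegral_sum => [|j]; last exact: sqint_mul.
rewrite (bigD1 i) //= big1 ?addr0 //.
by move=> j /andP[_ ji]; apply: forth; rewrite eq_sym.
Qed.

Lemma Rintegral_norm_sqrt f K : sqint f -> \int[P]_w (f w ^+ 2) <= K ->
  \int[P]_w `|f w| <= Num.sqrt K.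
Proof.
move=> sf fK; have [mf f2] := sf.
have f0 : 0 <= \int[P]_w `|f w| by apply: Rintegral_ge0.
rewrite -(ger0_norm f0) -sqrtr_sqr ler_wsqrtr //.
apply: le_trans fK; apply: le_trans (sqr_Rintegral_le _ _) _.
- exact: (integrable_norm (sqint_integrable sf)).
- by under [X in EFin \o X]eq_fun do rewrite real_normK ?num_real //.
by under eq_Rintegral do rewrite real_normK ?num_real //.
Qed.

End SquareIntegrable.

Lemma measurable_sum_cond {R : realType} {d} {T : measurableType d} (I : Type)
    (r : seq I) (Q : pred I) (f : I -> T -> R) :
  (forall i, measurable_fun setT (f i)) ->
  measurable_fun setT (fun w => \sum_(i <- r | Q i) f i w).
Proof.
move=> mf; elim: r => [|i r IH].
  by under eq_fun do rewrite big_nil; exact: measurable_cst.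
under eq_fun do rewrite big_cons; case: (Q i) => //.
exact: measurable_funD.
Qed.

(** * Concentration of a quadratic form in independent entries *)

Section QuadraticForm.
Context {R : realType} {d : measure_display} {Omega : measurableType d}.
Variables (P : probability Omega R) (n : nat) (Z : 'I_n -> Omega -> R * R).
Hypothesis Z_meas : forall i, measurable_fun setT (Z i).
Hypothesis Z_indep : mutually_independent P Z.
Local Notation fam := (@famType _ (R * R)%type 'I_n).
Local Notation joint := (joint Z).

Definition abs2 (z : R * R) : R := z.1 ^+ 2 + z.2 ^+ 2.

Variables (v : 'I_n -> R) (c : R).
Hypothesis Z_int : forall i, P.-integrable setT (EFin \o (fun w => abs2 (Z i w))).
Hypothesis Z_var : forall i, \int[P]_w abs2 (Z i w) = v i.
Hypothesis Z_mean1 : forall i, \int[P]_w (Z i w).1 = 0.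
Hypothesis Z_mean2 : forall i, \int[P]_w (Z i w).2 = 0.
Hypothesis v_le : forall i, v i <= c.

(** [p] and [q] stand for the real and imaginary parts of a Hermitian matrix [Q]; for the resolvent,
    [b] will be [t^-1]. *)
Variables (p q : 'I_n -> 'I_n -> R) (b : R).
Hypothesis b_ge0 : 0 <= b.
Hypothesis diag_le : forall j, `|p j j| <= b.
Hypothesis row_le : forall j, \sum_k (p j k ^+ 2 + q j k ^+ 2) <= b ^+ 2.

Let v_ge0 i : 0 <= v i.
Proof. by rewrite -Z_var; apply: Rintegral_ge0 => w _; rewrite addr_ge0 ?sqr_ge0. Qed.

Let c_ge0 (i : 'I_n) : 0 <= c. Proof. exact: le_trans (v_ge0 i) (v_le i). Qed.

Let x (j : 'I_n) (z : fam) : R := (z j).1.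
Let y (j : 'I_n) (z : fam) : R := (z j).2.
Let mx j : measurable_fun setT (x j).
Proof. exact: measurableT_comp measurable_fst (measurable_coord j). Qed.
Let my j : measurable_fun setT (y j).
Proof. exact: measurableT_comp measurable_snd (measurable_coord j). Qed.
Let mjoint := measurable_joint Z_meas.

Let sx j : sqint P (x j \o joint).
Proof.
split; first exact: measurableT_comp (mx j) mjoint.
apply: (integrable_sub (Z_int j)).
  by apply: measurable_funX; exact: measurableT_comp (mx j) mjoint.
by move=> w; rewrite ger0_norm ?sqr_ge0 // lerDl sqr_ge0.
Qed.

Let sy j : sqint P (y j \o joint).
Proof.
split; first exact: measurableT_comp (my j) mjoint.
apply: (integrable_sub (Z_int j)).
  by apply: measurable_funX; exact: measurableT_comp (my j) mjoint.
by move=> w; rewrite ger0_norm ?sqr_ge0 // lerDr sqr_ge0.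
Qed.

Let lin (s t : R) (k : 'I_n) (z : fam) : R := s * x k z + t * y k z.

Let mlin s t k : measurable_fun setT (lin s t k).
Proof. by apply: measurable_funD; apply: measurable_funM. Qed.

Let slin s t k : sqint P (lin s t k \o joint).
Proof. by apply: sqintD; apply: sqintZ; [exact: sx|exact: sy]. Qed.

Let lin_mean s t k : \int[P]_w lin s t k (joint w) = 0.
Proof.
have ix := sqint_integrable (sx k); have iy := sqint_integrable (sy k).
rewrite RintegralD //; last 2 first.
- exact: (integrableZl measurableT s ix).
- exact: (integrableZl measurableT t iy).
by rewrite !RintegralZ // Z_mean1 Z_mean2 !mulr0 addr0.
Qed.

Let lin_orth s t k s' t' l : k != l ->
  \int[P]_w (lin s t k (joint w) * lin s' t' l (joint w)) = 0.
Proof.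
move=> kl; rewrite (indep_RintegralM Z_meas Z_indep (J := [set k]%SET)) //.
- by rewrite lin_mean mul0r.
- by move=> z z' zz'; rewrite /lin /x /y zz' ?inE.
- by move=> z z' zz'; rewrite /lin /x /y zz' // inE eq_sym.
- exact: sqint_integrable (slin _ _ _).
- exact: sqint_integrable (slin _ _ _).
Qed.

(** With [Q = p + i q], the number [U j - i V j] is the sum over [k < j] of [Q_jk] times the
    conjugate of [z_k]. It depends on the coordinates before [j] only, and [D j] below is the real
    part of its product with [z_j]. *)
Let U (j : 'I_n) (z : fam) : R := \sum_(k < n | (k < j)%N) lin (p j k) (q j k) k z.
Let V (j : 'I_n) (z : fam) : R := \sum_(k < n | (k < j)%N) lin (- q j k) (p j k) k z.

Let mU j : measurable_fun setT (U j). Proof. exact: measurable_sum_cond. Qed.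
Let mV j : measurable_fun setT (V j). Proof. exact: measurable_sum_cond. Qed.
Let sU j : sqint P (U j \o joint). Proof. by apply: sqint_sum => k; exact: slin. Qed.
Let sV j : sqint P (V j \o joint). Proof. by apply: sqint_sum => k; exact: slin. Qed.

Let UV2 j : \int[P]_w (U j (joint w) ^+ 2 + V j (joint w) ^+ 2) <= c * b ^+ 2.
Proof.
rewrite RintegralD //; [|exact: (sU j).2|exact: (sV j).2].
rewrite (@sqint_sum_orth _ _ _ P _ _ (fun k w => lin (p j k) (q j k) k (joint w))
  (fun k => slin (p j k) (q j k) k) (fun k l kl => lin_orth _ _ _ _ kl)).
rewrite (@sqint_sum_orth _ _ _ P _ _ (fun k w => lin (- q j k) (p j k) k (joint w))
  (fun k => slin (- q j k) (p j k) k) (fun k l kl => lin_orth _ _ _ _ kl)).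
rewrite -big_split /=.
apply: (@le_trans _ _ (\sum_(k < n) c * (p j k ^+ 2 + q j k ^+ 2))); last first.
  by rewrite -mulr_sumr ler_wpM2l //; exact: c_ge0 j.
rewrite big_mkcond /=; apply: ler_sum => k _.
have pq0 : 0 <= p j k ^+ 2 + q j k ^+ 2 by rewrite addr_ge0 ?sqr_ge0.
case: ifP => _; last by rewrite mulr_ge0 //; exact: c_ge0 k.
rewrite -RintegralD //; [|exact: (slin _ _ _).2|exact: (slin _ _ _).2].
apply: (@le_trans _ _ (v k * (p j k ^+ 2 + q j k ^+ 2))); last by rewrite ler_wpM2r.
(* The cross terms of the two squares cancel, leaving [p^2 + q^2] times [abs2]. *)
rewrite mulrC -Z_var -RintegralZ // le_eqVlt; apply/orP; left; apply/eqP.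
by apply: eq_Rintegral => w _; rewrite /lin /x /y /abs2 /=; ring.
Qed.

Let D j (z : fam) : R := x j z * U j z + y j z * V j z.

Let mD j : measurable_fun setT (D j).
Proof. by apply: measurable_funD; apply: measurable_funM. Qed.

Let U_dep (j : 'I_n) (z z' : fam) : (forall k : 'I_n, (k < j)%N -> z k = z' k) -> U j z = U j z'.
Proof. by move=> zz'; apply: eq_bigr => k kj; rewrite /lin /x /y zz'. Qed.

Let V_dep (j : 'I_n) (z z' : fam) : (forall k : 'I_n, (k < j)%N -> z k = z' k) -> V j z = V j z'.
Proof. by move=> zz'; apply: eq_bigr => k kj; rewrite /lin /x /y zz'. Qed.

Let D_dep (j : 'I_n) (z z' : fam) : (forall k : 'I_n, (k <= j)%N -> z k = z' k) -> D j z = D j z'.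
Proof.
move=> zz'; rewrite /D (U_dep (z' := z')) => [|k kj]; last by apply: zz'; exact: ltnW.
rewrite (V_dep (z' := z')) => [|k kj]; last by apply: zz'; exact: ltnW.
by rewrite /x /y zz'.
Qed.

Let norm2 (j : 'I_n) (z : fam) : R := abs2 (z j).
Let mnorm2 j : measurable_fun setT (norm2 j).
Proof. by apply: measurable_funD; apply: measurable_funX; [exact: mx|exact: my]. Qed.

Let UV (j : 'I_n) (z : fam) : R := U j z ^+ 2 + V j z ^+ 2.
Let mUV j : measurable_fun setT (UV j).
Proof. by apply: measurable_funD; apply: measurable_funX. Qed.
Let iUV j : P.-integrable setT (EFin \o (UV j \o joint)).
Proof. exact: (integrableD measurableT (sU j).2 (sV j).2). Qed.

Let norm2_UV_J j (z z' : fam) : (forall i, i \in [set j]%SET -> z i = z' i) ->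
  norm2 j z = norm2 j z'.
Proof. by move=> zz'; rewrite /norm2 zz' ?inE. Qed.

Let UV_J j (z z' : fam) : (forall i, i \notin [set j]%SET -> z i = z' i) -> UV j z = UV j z'.
Proof.
move=> zz'; have h (k : 'I_n) : (k < j)%N -> z k = z' k.
  by move=> kj; apply: zz'; rewrite inE; apply: contraTneq kj => ->; rewrite ltnn.
by rewrite /UV (U_dep h) (V_dep h).
Qed.

Let iprod j : P.-integrable setT (EFin \o (fun w => norm2 j (joint w) * UV j (joint w))).
Proof.
exact: (indep_integrableM Z_meas Z_indep (mnorm2 j) (mUV j) (@norm2_UV_J j) (@UV_J j)
  (Z_int j) (iUV j)).
Qed.

Let D2_le j z : D j z ^+ 2 <= norm2 j z * UV j z.
Proof.
have := sqr_ge0 (x j z * V j z - y j z * U j z).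
have -> : norm2 j z * UV j z = D j z ^+ 2 + (x j z * V j z - y j z * U j z) ^+ 2.
  by rewrite /norm2 /abs2 -/(x j z) -/(y j z) /D /UV; ring.
by rewrite lerDl.
Qed.

Let sD j : sqint P (D j \o joint).
Proof.
have mDj : measurable_fun setT (D j \o joint) by exact: measurableT_comp mjoint.
split => //; apply: (integrable_sub (iprod j)); first exact: measurable_funX.
by move=> w; rewrite ger0_norm ?sqr_ge0 //; exact: D2_le.
Qed.

Let D2_int j : \int[P]_w (D j (joint w) ^+ 2) <= c * (c * b ^+ 2).
Proof.
apply: (@le_trans _ _ (\int[P]_w (norm2 j (joint w) * UV j (joint w)))).
  apply: le_Rintegral_all => [| |w]; [exact: (sD j).2|exact: iprod|exact: D2_le].
rewrite (indep_RintegralM Z_meas Z_indep (mnorm2 j) (mUV j) (@norm2_UV_J j) (@UV_J j) (Z_int j) (iUV j)).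
rewrite [X in X * _]Z_var; apply: ler_pM => //; last exact: UV2.
by apply: Rintegral_ge0 => w _; rewrite addr_ge0 ?sqr_ge0.
Qed.

(** [D j] is linear in the centred coordinate [j], with coefficients which, like [D k], depend on
    earlier coordinates only. *)
Let D_orth_lt (k j : 'I_n) : (k < j)%N -> \int[P]_w (D j (joint w) * D k (joint w)) = 0.
Proof.
move=> kj.
have depJ (f : fam -> R) : (forall z z' : fam, (forall k : 'I_n, (k < j)%N -> z k = z' k) -> f z = f z') ->
    forall z z' : fam, (forall i, i \notin [set j]%SET -> z i = z' i) -> f z = f z'.
  move=> fd z z' zz'; apply: fd => l lj; apply: zz'; rewrite inE.
  by apply: contraTneq lj => ->; rewrite ltnn.
have Dkj (z z' : fam) : (forall k : 'I_n, (k < j)%N -> z k = z' k) -> D k z = D k z'.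
  by move=> zz'; apply: D_dep => l lk; apply: zz'; exact: leq_ltn_trans kj.
have UDi := sqint_mul (sU j) (sD k); have VDi := sqint_mul (sV j) (sD k).
have xUD : P.-integrable setT (EFin \o (fun w => x j (joint w) * (U j (joint w) * D k (joint w)))) /\
    \int[P]_w (x j (joint w) * (U j (joint w) * D k (joint w))) = 0.
  have H1 : forall z z' : fam, (forall i, i \in [set j]%SET -> z i = z' i) -> x j z = x j z'.
    by move=> z z' zz'; rewrite /x zz' ?inE.
  have H2 := depJ (fun z => U j z * D k z) (fun z z' h => congr2 *%R (U_dep h) (Dkj z z' h)).
  have mUD : measurable_fun setT (fun z => U j z * D k z) by apply: measurable_funM.
  split; first exact: (indep_integrableM Z_meas Z_indep (mx j) mUD H1 H2 (sqint_integrable (sx j)) UDi).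
  rewrite (indep_RintegralM Z_meas Z_indep (mx j) mUD H1 H2 (sqint_integrable (sx j)) UDi).
  by rewrite [X in X * _]Z_mean1 mul0r.
have yVD : P.-integrable setT (EFin \o (fun w => y j (joint w) * (V j (joint w) * D k (joint w)))) /\
    \int[P]_w (y j (joint w) * (V j (joint w) * D k (joint w))) = 0.
  have H1 : forall z z' : fam, (forall i, i \in [set j]%SET -> z i = z' i) -> y j z = y j z'.
    by move=> z z' zz'; rewrite /y zz' ?inE.
  have H2 := depJ (fun z => V j z * D k z) (fun z z' h => congr2 *%R (V_dep h) (Dkj z z' h)).
  have mVD : measurable_fun setT (fun z => V j z * D k z) by apply: measurable_funM.
  split; first exact: (indep_integrableM Z_meas Z_indep (my j) mVD H1 H2 (sqint_integrable (sy j)) VDi).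
  rewrite (indep_RintegralM Z_meas Z_indep (my j) mVD H1 H2 (sqint_integrable (sy j)) VDi).
  by rewrite [X in X * _]Z_mean2 mul0r.
transitivity (\int[P]_w (x j (joint w) * (U j (joint w) * D k (joint w)) +
    y j (joint w) * (V j (joint w) * D k (joint w)))).
  by apply: eq_Rintegral => w _; rewrite {1}/D; ring.
by rewrite (RintegralD measurableT xUD.1 yVD.1) xUD.2 yVD.2 addr0.
Qed.

Let D_orth j k : j != k -> \int[P]_w (D j (joint w) * D k (joint w)) = 0.
Proof.
move=> jk; have [kj|jk'|/val_inj/eqP] := ltngtP k j; first exact: D_orth_lt.
  by under eq_Rintegral do rewrite mulrC; exact: D_orth_lt.
by rewrite eq_sym (negbTE jk).
Qed.

Let offdiag_L1 : \int[P]_w `|\sum_j D j (joint w)| <= Num.sqrt (n%:R * (c ^+ 2 * b ^+ 2)).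
Proof.
apply: Rintegral_norm_sqrt; first exact: sqint_sum.
rewrite (@sqint_sum_orth _ _ _ P _ _ (fun j w => D j (joint w)) sD D_orth).
apply: (@le_trans _ _ (\sum_(j < n) c ^+ 2 * b ^+ 2)).
  by apply: ler_sum => j _; apply: le_trans (D2_int j) _; rewrite expr2 mulrA.
by rewrite sumr_const card_ord -[leLHS]mulr_natl.
Qed.

Variable eta : R.

(** Both functions are applied to a squared modulus, whence the threshold [eta ^+ 2]. *)
Let cut (t : R) : R := t * (t < eta ^+ 2)%R%:R.
Let tail (t : R) : R := t * (eta ^+ 2 <= t)%R%:R.

Let cut_tail t : t = cut t + tail t.
Proof. by rewrite /cut /tail; case: ltP => _; rewrite ?mulr1 ?mulr0 ?addr0 ?add0r. Qed.

Let mlt : measurable_fun setT (fun t : R => ((t < eta ^+ 2)%R%:R : R)).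
Proof.
rewrite (_ : (fun t : R => _) = \1_(`]-oo, (eta ^+ 2)[%classic)).
  exact: measurable_indic.
by apply/funext => t; rewrite indicE mem_setE in_itv.
Qed.

Let mcut : measurable_fun setT cut. Proof. exact: measurable_funM. Qed.

Let mtail : measurable_fun setT tail.
Proof.
rewrite (_ : tail = fun t => t - cut t); first exact: measurable_funB.
by apply/funext => t; apply/eqP; rewrite eq_sym subr_eq addrC -cut_tail.
Qed.

Let N2 j w := norm2 j (joint w).
Let mN2 j : measurable_fun setT (N2 j).
Proof. exact: measurableT_comp (mnorm2 j) mjoint. Qed.
Let N2_ge0 j w : 0 <= N2 j w. Proof. by rewrite addr_ge0 ?sqr_ge0. Qed.

Let cut_ge0 j w : 0 <= cut (N2 j w).
Proof. by rewrite mulr_ge0 ?ler0n. Qed.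
Let tail_ge0 j w : 0 <= tail (N2 j w).
Proof. by rewrite mulr_ge0 ?ler0n. Qed.

Let cut_le j w : cut (N2 j w) <= N2 j w.
Proof. by rewrite [leRHS]cut_tail lerDl. Qed.
Let tail_le j w : tail (N2 j w) <= N2 j w.
Proof. by rewrite [leRHS]cut_tail lerDr. Qed.

Let cut_le_eta j w : cut (N2 j w) <= eta ^+ 2.
Proof. by rewrite /cut; case: ltP => [/ltW|_]; rewrite ?mulr1 // mulr0 sqr_ge0. Qed.

Let icut j : P.-integrable setT (EFin \o (cut \o N2 j)).
Proof.
apply: (integrable_sub (Z_int j)); first exact: measurableT_comp.
by move=> w; rewrite ger0_norm //=.
Qed.
Let itail j : P.-integrable setT (EFin \o (tail \o N2 j)).
Proof.
apply: (integrable_sub (Z_int j)); first exact: measurableT_comp.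
by move=> w; rewrite ger0_norm //=.
Qed.

Let ecut j := \int[P]_w cut (N2 j w).
Let etail j := \int[P]_w tail (N2 j w).

Let v_split j : v j = ecut j + etail j.
Proof.
rewrite -Z_var -(RintegralD measurableT (icut j) (itail j)).
by apply: eq_Rintegral => w _; exact: cut_tail.
Qed.

Let ccut (j : 'I_n) (z : fam) : R := p j j * (cut (norm2 j z) - ecut j).

Let mccut j : measurable_fun setT (ccut j).
Proof.
by apply: measurable_funM => //; apply: measurable_funB => //; exact: measurableT_comp.
Qed.

Let bccut j : bmeas (ccut j \o joint).
Proof.
apply: bmeasZ; apply: bmeasB (bmeas_cst _); split; first exact: measurableT_comp (mN2 j).
by exists (eta ^+ 2) => w; rewrite ger0_norm; [exact: cut_le_eta|exact: cut_ge0].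
Qed.

Let ccut_mean j : \int[P]_w ccut j (joint w) = 0.
Proof.
rewrite RintegralZ; last first.
  exact: (integrableB measurableT (icut j) (finite_measure_integrable_cst P (ecut j) measurableT)).
rewrite (RintegralB measurableT (icut j) (finite_measure_integrable_cst P (ecut j) measurableT)).
by rewrite Rintegral_prob_cst subrr mulr0.
Qed.

Let ccut_orth j k : j != k -> \int[P]_w (ccut j (joint w) * ccut k (joint w)) = 0.
Proof.
move=> jk; rewrite (indep_RintegralM Z_meas Z_indep (J := [set j]%SET)) //.
- by rewrite ccut_mean mul0r.
- by move=> z z' zz'; rewrite /ccut /norm2 zz' ?inE.
- by move=> z z' zz'; rewrite /ccut /norm2 zz' // inE eq_sym.
- exact: bmeas_integrable (bccut j).
- exact: bmeas_integrable (bccut k).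
Qed.

(** The variance is at most the second moment, and a variable with values between 0 and [eta ^+ 2]
    has second moment at most [eta ^+ 2] times its mean. *)
Let ccut2 j : \int[P]_w (ccut j (joint w) ^+ 2) <= b ^+ 2 * (eta ^+ 2 * c).
Proof.
have p2 : p j j ^+ 2 <= b ^+ 2.
  by rewrite -[p j j ^+ 2]real_normK ?num_real // lerXn2r ?nnegrE.
have bcut : bmeas (cut \o N2 j).
  split; first exact: measurableT_comp (mN2 j).
  by exists (eta ^+ 2) => w; rewrite ger0_norm; [exact: cut_le_eta|exact: cut_ge0].
under eq_Rintegral do rewrite exprMn.
rewrite RintegralZ; last by apply/bmeas_integrable/bmeasX/bmeasB => //; exact: bmeas_cst.
apply: ler_pM => //; [exact: sqr_ge0|by apply: Rintegral_ge0 => w _; rewrite sqr_ge0|].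
have icut2 : P.-integrable setT (EFin \o (fun w => cut (N2 j w) ^+ 2)).
  by apply/bmeas_integrable/bmeasX.
have i2 : P.-integrable setT (EFin \o (fun w => 2 * ecut j * cut (N2 j w))).
  by apply/bmeas_integrable/bmeasZ.
rewrite (_ : \int[P]_w _ = \int[P]_w (cut (N2 j w) ^+ 2 - 2 * ecut j * cut (N2 j w) + ecut j ^+ 2));
  last by apply: eq_Rintegral => w _; rewrite -/(N2 j w); ring.
rewrite (RintegralD measurableT (integrableB measurableT icut2 i2)
  (finite_measure_integrable_cst P (ecut j ^+ 2) measurableT)).
rewrite (RintegralB measurableT icut2 i2) (RintegralZ _ (icut j)) Rintegral_prob_cst -/(ecut j).
apply: (@le_trans _ _ (\int[P]_w (cut (N2 j w) ^+ 2))).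
  by have := sqr_ge0 (ecut j); lra.
apply: (@le_trans _ _ (\int[P]_w (eta ^+ 2 * N2 j w))).
  apply: le_Rintegral_all => //; first exact: (integrableZl measurableT (eta ^+ 2) (Z_int j)).
  by move=> w; rewrite expr2; apply: ler_pM.
rewrite RintegralZ; last exact: Z_int.
by apply: ler_wpM2l; [exact: sqr_ge0|rewrite [leLHS]Z_var; exact: v_le].
Qed.

Let diag_L1 : \int[P]_w `|\sum_j ccut j (joint w)| <= Num.sqrt (n%:R * (b ^+ 2 * (eta ^+ 2 * c))).
Proof.
apply: Rintegral_norm_sqrt; first by apply: sqint_sum => j; exact: bmeas_sqint (bccut j).
rewrite (@sqint_sum_orth _ _ _ P _ _ (fun j w => ccut j (joint w))
  (fun j => bmeas_sqint P (bccut j)) ccut_orth).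
apply: (@le_trans _ _ (\sum_(j < n) b ^+ 2 * (eta ^+ 2 * c))); first exact: ler_sum.
by rewrite sumr_const card_ord -[leLHS]mulr_natl.
Qed.

Definition quad_form_re (z : 'I_n -> R * R) : R :=
  \sum_j p j j * abs2 (z j) +
  2 * \sum_(j < n) \sum_(k < n | (k < j)%N)
    (p j k * ((z j).1 * (z k).1 + (z j).2 * (z k).2) -
     q j k * ((z j).2 * (z k).1 - (z j).1 * (z k).2)).

(* Only the diagonal part needs the truncation at [eta]: the off-diagonal increments are orthogonal
   and bounded in L^2 by the second moments alone. *)
Lemma quad_form_concentration :
  P.-integrable setT (EFin \o (fun w => `|quad_form_re (joint w) - \sum_j v j * p j j|)) /\
  \int[P]_w `|quad_form_re (joint w) - \sum_j v j * p j j| <=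
    2 * Num.sqrt (n%:R * (c ^+ 2 * b ^+ 2)) +
    Num.sqrt (n%:R * (b ^+ 2 * (eta ^+ 2 * c))) +
    2 * b * \sum_j \int[P]_w (abs2 (Z j w) * (eta ^+ 2 <= abs2 (Z j w))%R%:R).
Proof.
pose Ds w := \sum_j D j (joint w); pose Cs w := \sum_j ccut j (joint w).
pose Ts w := \sum_j b * (tail (N2 j w) + etail j).
have sDs : sqint P Ds by apply: sqint_sum.
have sCs : sqint P Cs by apply: sqint_sum => j; exact: bmeas_sqint (bccut j).
have iT j : P.-integrable setT (EFin \o (fun w => b * (tail (N2 j w) + etail j))).
  exact: (integrableZl measurableT b (integrableD measurableT (itail j)
    (finite_measure_integrable_cst P (etail j) measurableT))).
have iTs : P.-integrable setT (EFin \o Ts) by apply: integrable_sumR.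
have quadE w : quad_form_re (joint w) - \sum_j v j * p j j =
  2 * Ds w + Cs w + \sum_j p j j * (tail (N2 j w) - etail j).
  rewrite /quad_form_re addrAC -sumrB addrC -addrA; congr (2 * _ + _).
    apply: eq_bigr => j _; rewrite /D /U /V !mulr_sumr -big_split /=.
    by apply: eq_bigr => k _; rewrite /lin /x /y; ring.
  rewrite /Cs -big_split /=; apply: eq_bigr => j _.
  by rewrite /ccut v_split -/(norm2 j (joint w)) -/(N2 j w) {1}(cut_tail (N2 j w)); ring.
have etail_ge0 j : 0 <= etail j by apply: Rintegral_ge0.
(* On the tails only the triangle inequality is used; a tail and its mean contribute equally, whence
   the factor [2 * b]. *)
have bound w : `|quad_form_re (joint w) - \sum_j v j * p j j| <= 2 * `|Ds w| + `|Cs w| + Ts w.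
  rewrite quadE; apply: le_trans (ler_normD _ _) _; apply: lerD.
    by apply: le_trans (ler_normD _ _) _; rewrite normrM ger0_norm.
  apply: le_trans (ler_norm_sum _ _ _) _; apply: ler_sum => j _.
  rewrite normrM; apply: ler_pM => //; apply: le_trans (ler_normB _ _) _.
  by rewrite !ger0_norm.
have iD : P.-integrable setT (EFin \o (fun w => `|Ds w|)).
  exact: integrable_norm (sqint_integrable sDs).
have iC : P.-integrable setT (EFin \o (fun w => `|Cs w|)).
  exact: integrable_norm (sqint_integrable sCs).
have i2D := integrableZl measurableT 2 iD.
have i12 := integrableD measurableT i2D iC.
have iB : P.-integrable setT (EFin \o (fun w => 2 * `|Ds w| + `|Cs w| + Ts w)).
  exact: (integrableD measurableT i12 iTs).
have mq : measurable_fun setT (fun w => `|quad_form_re (joint w) - \sum_j v j * p j j|).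
  apply: measurableT_comp => //; under eq_fun do rewrite quadE.
  apply: measurable_funD; first apply: measurable_funD.
  - apply: measurable_funM => //; exact: sDs.1.
  - exact: sCs.1.
  apply: measurable_sum => j; apply: measurable_funM => //.
  by apply: measurable_funB => //; exact: measurableT_comp.
have iQ : P.-integrable setT (EFin \o (fun w => `|quad_form_re (joint w) - \sum_j v j * p j j|)).
  by apply: integrable_sub iB _ _ => // w; rewrite normr_id.
split => //; apply: le_trans (le_Rintegral_all iQ iB bound) _.
rewrite (RintegralD measurableT i12 iTs) (RintegralD measurableT i2D iC).
rewrite RintegralZ //; apply: lerD; first by apply: lerD => //; rewrite ler_pM2l.
rewrite Rintegral_sum // mulr_sumr; apply: ler_sum => j _.
rewrite RintegralZ; last first.
  exact: (integrableD measurableT (itail j) (finite_measure_integrable_cst P (etail j) measurableT)).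
rewrite (RintegralD measurableT (itail j) (finite_measure_integrable_cst P (etail j) measurableT)).
by rewrite Rintegral_prob_cst -[X in X + _]/(etail j) [2 * b]mulrC -mulrA mulr2n mulrDl mul1r.
Qed.

End QuadraticForm.

HB.instance Definition _ := gen_eqMixin ptree.

(** * Planar trees and the perturbative solution of the limit system *)

Section PlanarTrees.

Fixpoint ptree_nested_ind (Q : ptree -> Prop)
    (H : forall ts, (forall c, List.In c ts -> Q c) -> Q (PNode ts)) (t : ptree) : Q t :=
  let: PNode ts := t in
  H ts ((fix loop ts : forall c, List.In c ts -> Q c :=
    if ts is c0 :: ts' then fun c h =>
      match h with
      | or_introl e => eq_ind c0 Q (ptree_nested_ind H c0) c e
      | or_intror h' => loop ts' c h'
      end
    else fun c h => match h with end) ts).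

(** Every tree with at least one edge is [add_first c t] for exactly one pair; this bijection is the
    Catalan recursion. *)
Definition add_first (c t : ptree) : ptree :=
  let: PNode ts := t in PNode (c :: ts).

(** [k] counts edges. The calls at [a] and [k' - a] are not structural in [k], hence the fuel; any
    amount above [k] gives the same list. *)
Fixpoint ptrees_fuel (f k : nat) : seq ptree :=
  if f is f'.+1 then
    if k is k'.+1 then
      flatten [seq [seq add_first c t | c <- ptrees_fuel f' a, t <- ptrees_fuel f' (k' - a)]
                | a <- iota 0 k'.+1]
    else [:: PNode [::]]
  else [::].

Definition ptrees k := ptrees_fuel k.+1 k.

Lemma ptrees_fuelE f f' k : (k < f)%N -> (k < f')%N -> ptrees_fuel f k = ptrees_fuel f' k.
Proof.
elim: f f' k => // f IH [|f'] // [|k] // kf kf'.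
rewrite /ptrees_fuel -/ptrees_fuel; congr flatten; apply/eq_in_map => a.
rewrite mem_iota add0n => /andP[_ ak].
by rewrite (IH f' a) 1?(IH f' (k - a)%N) //; lia.
Qed.

Lemma ptreesS k : ptrees k.+1 =
  flatten [seq [seq add_first c t | c <- ptrees a, t <- ptrees (k - a)] | a <- iota 0 k.+1].
Proof.
rewrite [LHS]/ptrees -[LHS]/(flatten [seq [seq add_first c t | c <- ptrees_fuel k.+1 a,
  t <- ptrees_fuel k.+1 (k - a)] | a <- iota 0 k.+1]).
congr flatten; apply/eq_in_map => a.
rewrite mem_iota add0n => /andP[_ ak].
by rewrite /ptrees (@ptrees_fuelE k.+1 a.+1 a) 1?(@ptrees_fuelE k.+1 (k - a).+1 (k - a)) //; lia.
Qed.

Lemma nvertices_add_first c t : nvertices (add_first c t) = (nvertices c + nvertices t)%N.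
Proof. by case: t => ts; rewrite /= !nverticesE /= addnS. Qed.

Lemma nvertices_gt0 t : (0 < nvertices t)%N.
Proof. by case: t => ts; rewrite nverticesE. Qed.

Lemma add_first_inj c c' t t' : add_first c t = add_first c' t' -> c = c' /\ t = t'.
Proof. by case: t t' => ts [ts'] [-> ->]. Qed.

Lemma mem_ptrees k t : (t \in ptrees k) = (nvertices t == k.+1).
Proof.
elim/ltn_ind: k t => -[|k] IH t.
  rewrite mem_seq1; case: t => -[|c ts]; first by rewrite eqxx nverticesE.
  have := nvertices_gt0 c; rewrite nverticesE /=.
  by case: (nvertices c) => // n _; apply/negbTE; apply/eqP.
rewrite ptreesS; apply/flatten_mapP/eqP => [[a]|].
  rewrite mem_iota add0n => /andP[_ ak] /allpairsP[[c s] [/= cin sin ->]].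
  have ca : nvertices c = a.+1 by apply/eqP; rewrite -IH.
  have sa : nvertices s = (k - a).+1 by apply/eqP; rewrite -IH // ltnS leq_subr.
  rewrite nvertices_add_first; lia.
case: t => -[|c ts]; first by rewrite nverticesE.
rewrite -/(add_first c (PNode ts)) nvertices_add_first => cts.
have c0 := nvertices_gt0 c; have s0 := nvertices_gt0 (PNode ts).
exists (nvertices c).-1; first by rewrite mem_iota; lia.
apply/allpairsP; exists (c, PNode ts); split => //=; rewrite IH; apply/eqP; lia.
Qed.

Lemma ptrees_uniq k : uniq (ptrees k).
Proof.
elim/ltn_ind: k => -[|k] IH //; rewrite ptreesS.
have : all (fun a => a < k.+1)%N (iota 0 k.+1) by apply/allP => a; rewrite mem_iota add0n => /andP[].
have : uniq (iota 0 k.+1) by exact: iota_uniq.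
elim: (iota 0 k.+1) => //= a s IHs /andP[ans us] /andP[ak sk].
rewrite cat_uniq IHs // andbT; apply/andP; split.
  apply: allpairs_uniq; rewrite ?IH ?ltnS ?leq_subr //.
  by move=> [c t] [c' t'] _ _ /= /add_first_inj[-> ->].
apply/hasPn => x /flatten_mapP[b bs /allpairsP[[c t] [/= cb tb ->]]].
apply/allpairsP => -[[c' t'] [/= ca ta /add_first_inj[cc _]]].
move: cb ca; rewrite -cc !mem_ptrees => /eqP -> /eqP[ab].
by move: ans; rewrite -ab bs.
Qed.

Lemma all_ptrees_perm k (T : 'I_(catalan k) -> ptree) : all_ptrees T ->
  perm_eq (ptrees k) [seq T j | j <- enum 'I_(catalan k)].
Proof.
move=> [Tinj Tall]; apply: uniq_perm; first exact: ptrees_uniq.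
  by rewrite map_inj_uniq // enum_uniq.
move=> t; rewrite mem_ptrees; apply/eqP/mapP => [/Tall[j <-]|[j _ ->]].
  by exists j => //; rewrite mem_enum.
by apply/Tall; exists j.
Qed.

Lemma sum_all_ptrees (V : nmodType) k (T : 'I_(catalan k) -> ptree) (f : ptree -> V) :
  all_ptrees T -> \sum_(j < catalan k) f (T j) = \sum_(t <- ptrees k) f t.
Proof.
by move=> /all_ptrees_perm/(perm_big _) ->; rewrite big_map big_enum.
Qed.

Lemma size_ptrees k : size (ptrees k) = catalan k.
Proof.
have [T /all_ptrees_perm/perm_size ->] := all_ptrees_exists k.
by rewrite size_map size_enum_ord.
Qed.

(** The growth rate 4 fixes the range [4 B tau <= 1/2] in which the tree series is summed below. *)
Lemma catalan_le k : (catalan k <= 4 ^ k)%N.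
Proof.
apply: (@leq_trans 'C(2 * k, k)); first exact: leq_div.
have -> : (4 ^ k = (1 + 1) ^ (2 * k))%N by rewrite expnM.
have kk : (k < (2 * k).+1)%N by lia.
rewrite expnDn (bigD1 (Ordinal kk)) //= !exp1n !muln1; exact: leq_addr.
Qed.

End PlanarTrees.

(** * Weighted sums over planar trees *)

Section TreeSums.
Variables (R : realFieldType) (N : nat) (w : 'I_N -> 'I_N -> R).

(** The weighted count of maps from the vertices of [t] to the indices that send the root to [i], a
    fact proved as [rooted_sumE]. *)
Fixpoint tree_weight (t : ptree) (i : 'I_N) : R :=
  let: PNode ts := t in
  foldr (fun c acc => (\sum_j w i j * tree_weight c j) * acc) 1 ts.

Lemma tree_weight_add_first c t i : tree_weight (add_first c t) i =
  (\sum_j w i j * tree_weight c j) * tree_weight t i.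
Proof. by case: t. Qed.

Definition tree_sum k i := \sum_(t <- ptrees k) tree_weight t i.

Lemma tree_sum0 i : tree_sum 0 i = 1.
Proof. by rewrite /tree_sum big_seq1. Qed.

(** The weighted Catalan recursion. It says that the formal series of the [(- tau)^k tree_sum k]
    solves [g (1 + tau w g) = 1]. *)
Lemma tree_sumS k i : tree_sum k.+1 i =
  \sum_(a < k.+1) (\sum_j w i j * tree_sum a j) * tree_sum (k - a) i.
Proof.
rewrite /tree_sum ptreesS big_flatten big_map -(big_mkord xpredT (fun a =>
  (\sum_j w i j * tree_sum a j) * tree_sum (k - a) i)) /index_iota subn0.
apply: eq_bigr => a _; rewrite big_allpairs_dep /=.
under eq_bigr do under eq_bigr do rewrite tree_weight_add_first.
under eq_bigr do rewrite -mulr_sumr.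
rewrite -mulr_suml; congr (_ * _).
by under [RHS]eq_bigr do rewrite /tree_sum mulr_sumr; rewrite exchange_big.
Qed.

Variable B : R.
Hypothesis w_ge0 : forall i j, 0 <= w i j.
Hypothesis w_row : forall i, \sum_j w i j <= B.

Let B_ge0 (i : 'I_N) : 0 <= B.
Proof. by apply: le_trans (w_row i); apply: sumr_ge0. Qed.

Lemma tree_weight_bound t i : 0 <= tree_weight t i <= B ^+ (nvertices t).-1.
Proof.
elim/ptree_nested_ind: t i => ts IH i; rewrite nverticesE /=.
have B0 := B_ge0 i.
elim: ts IH => [|c ts IHts] IH /=; first by rewrite expr0 ler01 lexx.
have /andP[t0 tB] := IHts (fun c' h => IH c' (or_intror h)).
have s0 : 0 <= \sum_j w i j * tree_weight c j.
  by apply: sumr_ge0 => j _; rewrite mulr_ge0 //; case/andP: (IH c (or_introl erefl) j).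
rewrite mulr_ge0 //= exprD ler_pM //.
rewrite -(prednK (nvertices_gt0 c)) exprSr.
rewrite mulrC; apply: (@le_trans _ _ (\sum_j w i j * B ^+ (nvertices c).-1)).
  by apply: ler_sum => j _; rewrite ler_wpM2l //; case/andP: (IH c (or_introl erefl) j).
by rewrite -mulr_suml ler_wpM2r // exprn_ge0.
Qed.

Lemma tree_sum_ge0 k i : 0 <= tree_sum k i.
Proof. by apply: sumr_ge0 => t _; case/andP: (tree_weight_bound t i). Qed.

Lemma tree_sum_le k i : tree_sum k i <= (4 * B) ^+ k.
Proof.
apply: (@le_trans _ _ (\sum_(t <- ptrees k) B ^+ k)).
  rewrite /tree_sum [leLHS]big_seq [leRHS]big_seq; apply: ler_sum => t; rewrite mem_ptrees => /eqP tk.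
  by case/andP: (tree_weight_bound t i) => _; rewrite tk.
rewrite big_const_seq count_predT size_ptrees iter_addr_0 exprMn -[leLHS]mulr_natl.
by rewrite ler_wpM2r ?exprn_ge0 ?(B_ge0 i) // -natrX ler_nat catalan_le.
Qed.

End TreeSums.

(** The square of side [M] may exceed the triangle of side [K]: in [tree_series_residual] they
    differ by one. *)
Lemma sum_antidiagonal (V : nmodType) (f : nat -> nat -> V) K M : (K <= M)%N ->
  \sum_(k < K) \sum_(a < k.+1) f a (k - a)%N =
  \sum_(a < M) \sum_(b < M | (a + b < K)%N) f a b.
Proof.
elim: K => [|K IH] KM.
  by rewrite big_ord0 big1 // => a _; rewrite big_pred0.
rewrite big_ord_recr /= IH; last exact: ltnW.
rewrite (big_ord_widen M (fun a => f a (K - a)%N)) // [X in _ + X]big_mkcond -big_split /=.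
apply: eq_bigr => a _; rewrite [RHS](bigID (fun b : 'I_M => (a + b < K)%N)) /=.
congr (_ + _); first by apply: eq_bigl => b; lia.
case: ltnP => aK; last by rewrite big_pred0 // => b; lia.
have bM : (K - a < M)%N by lia.
rewrite (big_pred1 (Ordinal bM)) // => b; apply/idP/eqP => [h|->] /=; last by lia.
by apply: val_inj => /=; lia.
Qed.

(** * Stability of the self-consistent system *)

Section Stability.
Variables (R : realFieldType) (N : nat) (w : 'I_N -> 'I_N -> R) (B tau : R).
Hypothesis w_ge0 : forall i j, 0 <= w i j.
Hypothesis w_row : forall i, \sum_j w i j <= B.
(** Row sums bound the tree series entry by entry; column sums give the contraction in the l^1
    norm. *)
Hypothesis w_col : forall j, \sum_i w i j <= B.
Hypothesis tau_ge0 : 0 <= tau.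
Hypothesis Btau : 8 * (B * tau) <= 1.

Let x := 4 * (B * tau).

Let B_ge0 (i : 'I_N) : 0 <= B.
Proof. by apply: le_trans (w_row i); apply: sumr_ge0. Qed.

Let x_ge0 (i : 'I_N) : 0 <= x.
Proof. by rewrite /x !mulr_ge0 // B_ge0. Qed.

Let x_le : x <= 1 / 2. Proof. by rewrite /x; move: Btau; lra. Qed.

Definition tree_series K i := \sum_(k < K) (- tau) ^+ k * tree_sum w k i.

Lemma geom_half (y : R) K : 0 <= y -> y <= 1 / 2 -> \sum_(k < K) y ^+ k <= 2.
Proof.
move=> y0 y2; suff : \sum_(k < K) y ^+ k <= 2 - 2 * (1 / 2) ^+ K.
  have h : 0 <= (1 / 2 : R) ^+ K by apply: exprn_ge0; lra.
  by move=> h'; lra.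
elim: K => [|K IH]; first by rewrite big_ord0 expr0; lra.
rewrite big_ord_recr /=.
have h0 : 0 <= 1 / 2 :> R by lra.
have : y ^+ K <= (1 / 2) ^+ K by apply: lerXn2r; rewrite ?nnegrE.
by rewrite exprS; move: IH; lra.
Qed.

Lemma tree_series_norm K i : `|tree_series K i| <= 2.
Proof.
apply: le_trans (geom_half K (x_ge0 i) x_le); apply: le_trans (ler_norm_sum _ _ _) _.
apply: ler_sum => k _; rewrite normrM normrX normrN (ger0_norm tau_ge0).
rewrite ger0_norm ?(tree_sum_ge0 w_ge0 w_row) // /x.
have -> : (4 * (B * tau)) ^+ k = tau ^+ k * (4 * B) ^+ k by rewrite -exprMn; congr (_ ^+ _); ring.
by rewrite ler_wpM2l ?exprn_ge0 // (tree_sum_le w_ge0 w_row).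
Qed.

Let c (i : 'I_N) a b := (\sum_j w i j * tree_sum w a j) * tree_sum w b i.

Let c_ge0 i a b : 0 <= c i a b.
Proof.
rewrite mulr_ge0 ?(tree_sum_ge0 w_ge0 w_row) // sumr_ge0 // => j _.
by rewrite mulr_ge0 ?(tree_sum_ge0 w_ge0 w_row).
Qed.

Let c_le i a b : c i a b <= B * (4 * B) ^+ (a + b).
Proof.
have B0 := B_ge0 i.
rewrite exprD mulrA ler_pM //.
- by rewrite sumr_ge0 // => j _; rewrite mulr_ge0 ?(tree_sum_ge0 w_ge0 w_row).
- exact: tree_sum_ge0 w_row _ _.
- apply: (@le_trans _ _ (\sum_j w i j * (4 * B) ^+ a)).
    by apply: ler_sum => j _; rewrite ler_wpM2l // (tree_sum_le w_ge0 w_row).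
  by rewrite -mulr_suml ler_wpM2r // exprn_ge0 // mulr_ge0.
- exact: tree_sum_le w_ge0 w_row _ _.
Qed.

(** By [tree_sumS] all products of total degree below [K] cancel. At most [K^2] products remain,
    each bounded by [x ^+ K]. *)
Lemma tree_series_residual K i : (0 < K)%N ->
  `|tree_series K i * (1 + tau * \sum_j w i j * tree_series K j) - 1| <= (K * K)%:R * x ^+ K.
Proof.
move=> K0.
have E : tau * \sum_j w i j * tree_series K j =
    - \sum_(a < K) (- tau) ^+ a.+1 * (\sum_j w i j * tree_sum w a j).
  rewrite -sumrN mulr_sumr.
  under [LHS]eq_bigr do rewrite /tree_series mulr_sumr mulr_sumr.
  rewrite exchange_big /=; apply: eq_bigr => a _; rewrite mulr_sumr -sumrN.
  by apply: eq_bigr => j _; rewrite exprS; ring.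
have P1 : tree_series K i * (tau * \sum_j w i j * tree_series K j) =
    - \sum_(a < K) \sum_(b < K) (- tau) ^+ (a + b).+1 * c i a b.
  rewrite E mulrN mulrC mulr_suml; congr (- _); apply: eq_bigr => a _.
  rewrite mulr_sumr; apply: eq_bigr => b _; rewrite /c -addSn exprD; ring.
have P2 : tree_series K i - 1 =
    \sum_(a < K) \sum_(b < K | (a + b < K.-1)%N) (- tau) ^+ (a + b).+1 * c i a b.
  rewrite /tree_series; case: K K0 {E P1} => // K _ /=.
  rewrite big_ord_recl expr0 mul1r tree_sum0 addrAC subrr add0r.
  rewrite -(sum_antidiagonal (M := K.+1) (fun a b => (- tau) ^+ (a + b).+1 * c i a b)) //.
  apply: eq_bigr => k _; rewrite tree_sumS mulr_sumr; apply: eq_bigr => a _.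
  by rewrite subnKC // -ltnS.
rewrite mulrDr mulr1 P1 addrAC P2 -sumrB.
apply: (@le_trans _ _ (\sum_(a < K) \sum_(b < K) x ^+ K)); last first.
  by rewrite !sumr_const !card_ord -mulrnA -[leLHS]mulr_natl.
apply: le_trans (ler_norm_sum _ _ _) _; apply: ler_sum => a _.
rewrite [X in X - _]big_mkcond -sumrB.
apply: le_trans (ler_norm_sum _ _ _) _; apply: ler_sum => b _.
case: ltnP => abK; first by rewrite subrr normr0 exprn_ge0 // x_ge0.
rewrite sub0r normrN normrM normrX normrN (ger0_norm tau_ge0) (ger0_norm (c_ge0 _ _ _)).
have B0 := B_ge0 i; have x0 := x_ge0 i.
apply: (@le_trans _ _ (tau ^+ (a + b).+1 * (B * (4 * B) ^+ (a + b)))).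
  by rewrite ler_wpM2l ?exprn_ge0.
apply: (@le_trans _ _ (x ^+ (a + b).+1)).
  have -> : tau ^+ (a + b).+1 * (B * (4 * B) ^+ (a + b)) = (B * tau) * x ^+ (a + b).
    rewrite exprSr -mulrA /x (_ : 4 * (B * tau) = tau * (4 * B)); last by ring.
    by rewrite [(tau * (4 * B)) ^+ _]exprMn; ring.
  rewrite exprS ler_wpM2r ?exprn_ge0 // /x.
  have : 0 <= B * tau by rewrite mulr_ge0.
  by move=> ?; lra.
apply: ler_wiXn2l => //; first by move: x_le; lra.
by move: abK; lia.
Qed.

Variables (g e : 'I_N -> R).
Hypothesis g_ge0 : forall i, 0 <= g i.
Hypothesis g_eq : forall i, `|g i * (1 + tau * \sum_j w i j * g j) - 1| <= e i.

Lemma approx_solution_tree_series K : (0 < K)%N ->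
  `|\sum_i g i - \sum_i tree_series K i| <= 2 * (\sum_i e i + N%:R * ((K * K)%:R * x ^+ K)).
Proof.
move=> K0; set E := (K * K)%:R * x ^+ K; set h := tree_series K.
pose dd i := `|g i - h i|.
rewrite -sumrB; apply: le_trans (ler_norm_sum _ _ _) _; rewrite -/dd.
have S0 : 0 <= \sum_i dd i by apply: sumr_ge0 => i _; exact: normr_ge0.
have dle i : dd i <= e i + E + 2 * tau * \sum_j w i j * dd j.
  have wg0 : 0 <= tau * \sum_j w i j * g j.
    by rewrite mulr_ge0 // sumr_ge0 // => j _; rewrite mulr_ge0.
  apply: (@le_trans _ _ `|(g i - h i) * (1 + tau * \sum_j w i j * g j)|).
    rewrite normrM [X in _ * X]ger0_norm ?addr_ge0 //.
    by apply: ler_peMr; [exact: normr_ge0|rewrite lerDl].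
  have -> : (g i - h i) * (1 + tau * \sum_j w i j * g j) =
     (g i * (1 + tau * \sum_j w i j * g j) - 1) - (h i * (1 + tau * \sum_j w i j * h j) - 1)
     - h i * (tau * \sum_j w i j * (g j - h j)).
    have -> : \sum_j w i j * (g j - h j) = \sum_j w i j * g j - \sum_j w i j * h j.
      by rewrite -sumrB; apply: eq_bigr => j _; rewrite mulrBr.
    by ring.
  apply: le_trans (ler_normB _ _) _; apply: lerD.
    by apply: le_trans (ler_normB _ _) _; apply: lerD => //; exact: tree_series_residual.
  rewrite normrM -mulrA; apply: ler_pM => //; first exact: tree_series_norm.
  rewrite normrM (ger0_norm tau_ge0) ler_wpM2l //.
  apply: le_trans (ler_norm_sum _ _ _) _; apply: ler_sum => j _.
  by rewrite normrM ger0_norm.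
have : \sum_i dd i <= \sum_i (e i + E + 2 * tau * \sum_j w i j * dd j).
  exact: ler_sum.
rewrite !big_split /= sumr_const card_ord -[E *+ N]mulr_natl -mulr_sumr.
have : \sum_i \sum_j w i j * dd j <= B * \sum_i dd i.
  rewrite exchange_big mulr_sumr /=; apply: ler_sum => j _.
  by rewrite -mulr_suml ler_wpM2r // normr_ge0.
move=> h1 h2.
have h3 : 2 * tau * \sum_i \sum_j w i j * dd j <= 1 / 4 * \sum_i dd i.
  apply: (@le_trans _ _ (2 * tau * (B * \sum_i dd i))); first by rewrite ler_wpM2l // mulr_ge0.
  have -> : 2 * tau * (B * \sum_i dd i) = 2 * (B * tau) * \sum_i dd i by ring.
  by rewrite ler_wpM2r //; move: Btau; lra.
have e0 : 0 <= \sum_i e i.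
  by apply: sumr_ge0 => i _; apply: le_trans (g_eq i).
have E0 : 0 <= N%:R * E.
  case: (posnP N) => [->|N0]; first by rewrite mul0r.
  by rewrite /E !mulr_ge0 ?exprn_ge0 // (x_ge0 (Ordinal N0)).
by move: h2 h3 S0 e0 E0; set S := \sum_i dd i; set S' := \sum_i _; lra.
Qed.

End Stability.

(** * Tree densities of step graphons *)

Section Vertices.

(** The offset [i] is the label of the first child; it varies in inductions along the list of
    children. *)
Definition forest_vertices (i : nat) (ts : seq ptree) : seq (seq nat) :=
  flatten [seq [seq p.1 :: a | a <- vertices p.2] | p <- zip (iota i (size ts)) ts].

Lemma vertices_node ts : vertices (PNode ts) = [::] :: forest_vertices 0 ts.
Proof.
rewrite /= /forest_vertices; congr (_ :: flatten _).
elim: ts 0%N => //= c ts IH i; congr (_ :: _); exact: IH.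
Qed.

Lemma forest_vertices_cons i c ts :
  forest_vertices i (c :: ts) = [seq i :: a | a <- vertices c] ++ forest_vertices i.+1 ts.
Proof. by []. Qed.

Lemma forest_vertices_head i ts a : a \in forest_vertices i ts ->
  exists j b, a = j :: b /\ (i <= j)%N.
Proof.
elim: ts i => //= c ts IH i; rewrite forest_vertices_cons mem_cat.
case/orP => [/mapP[b _ ->]|/IH[j [b [-> ij]]]]; first by exists i, b.
by exists j, b; split => //; exact: ltnW.
Qed.

Lemma parent_of_cons i a j b : parent_of (i :: a) (j :: b) = (i == j) && parent_of a b.
Proof. by rewrite /parent_of prefix_cons /= eqSS andbA. Qed.

Lemma parent_of_nil a : parent_of a [::] = false.
Proof. by rewrite /parent_of andbF. Qed.

Lemma nil_parent_of a : parent_of [::] a = (size a == 1)%N.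
Proof. by rewrite /parent_of prefix0s. Qed.

Lemma vertices_uniq t : uniq (vertices t).
Proof.
elim/ptree_nested_ind: t => ts IH; rewrite vertices_node cons_uniq; apply/andP; split.
  by apply/negP => /forest_vertices_head[j [b []]].
elim: ts 0%N IH => //= c ts IHts i IH; rewrite forest_vertices_cons cat_uniq.
rewrite map_inj_uniq; last by move=> ? ? [].
rewrite (IH c (or_introl erefl)) (IHts i.+1 (fun c' h => IH c' (or_intror h))) /=.
rewrite andbT; apply/hasPn => a /forest_vertices_head[j [b [-> ij]]].
by apply/mapP => -[a' _ [ji _]]; move: ij; rewrite ji ltnn.
Qed.

(** Parents are listed before their children, so the orientation [i < j] of edges in [hom_density]
    runs from parent to child. *)
Lemma vertices_preorder t : pairwise (fun a b => ~~ parent_of b a) (vertices t).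
Proof.
elim/ptree_nested_ind: t => ts IH; rewrite vertices_node /=; apply/andP; split.
  by apply/allP => a _; rewrite parent_of_nil.
elim: ts 0%N IH => //= c ts IHts i IH; rewrite forest_vertices_cons pairwise_cat.
rewrite IHts; last by move=> c' h; apply: IH; right.
rewrite andbT; apply/andP; split.
  apply/allrelP => _ b /mapP[a _ ->] /forest_vertices_head[j [b' [-> ij]]].
  by rewrite parent_of_cons; apply/nandP; left; rewrite neq_ltn ij orbT.
rewrite pairwise_map; apply: sub_pairwise (IH c (or_introl erefl)) => a b /=.
by rewrite parent_of_cons eqxx.
Qed.

Lemma vertices_parent t b : b \in vertices t -> b != [::] ->
  exists2 a, a \in vertices t & parent_of a b.
Proof.
elim/ptree_nested_ind: t b => ts IH b; rewrite vertices_node inE => /orP[->//|].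
have gen i : (forall c, List.In c ts -> forall b, b \in vertices c -> b != [::] ->
    exists2 a, a \in vertices c & parent_of a b) -> b \in forest_vertices i ts ->
    exists2 a, a \in [::] :: forest_vertices i ts & parent_of a b.
  elim: ts i {IH} => //= c ts IHts i IH.
  rewrite forest_vertices_cons mem_cat => /orP[/mapP[b' b'c ->]|b_ts].
    have [->|b'0] := eqVneq b' [::].
      by exists [::]; rewrite ?inE ?nil_parent_of.
    have [a ac ab] := IH c (or_introl erefl) b' b'c b'0.
    exists (i :: a); last by rewrite parent_of_cons eqxx.
    by rewrite inE mem_cat map_f ?orbT.
  have [a] := IHts i.+1 (fun c' h => IH c' (or_intror h)) b_ts.
  rewrite inE => /orP[/eqP -> ab|a_ts ab]; first by exists [::]; rewrite ?inE.
  by exists a => //; rewrite inE mem_cat a_ts !orbT.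
by move=> bf _; exact: gen IH bf.
Qed.

Lemma nil_vertices t : [::] \in vertices t.
Proof. by case: t => ts; rewrite vertices_node inE eqxx. Qed.

End Vertices.

(** * The graph of a planar tree is a tree *)

Section PtreeGraph.
Variable t : ptree.
Local Notation vtx u := (nth [::] (vertices t) (val u)).
Local Notation e := (@ptree_graph t).

Lemma ptree_graphE u v : e u v = parent_of (vtx u) (vtx v) || parent_of (vtx v) (vtx u).
Proof. by []. Qed.

Lemma ptree_graph_sym : symmetric e.
Proof. by move=> u v; rewrite !ptree_graphE orbC. Qed.

Lemma parent_of_irr a : parent_of a a = false.
Proof. by rewrite /parent_of; case: eqP => [|_]; [lia|rewrite andbF]. Qed.

Lemma parent_of_unique a a' b : parent_of a b -> parent_of a' b -> a = a'.
Proof.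
rewrite /parent_of !prefixE => /andP[/eqP pa /eqP sa] /andP[/eqP pa' /eqP sa'].
by rewrite -pa -pa'; congr take; move: sa'; rewrite sa => -[].
Qed.

Lemma vtx_inj (u v : 'I_(nvertices t)) : vtx u = vtx v -> u = v.
Proof.
by move/eqP; rewrite nth_uniq ?vertices_uniq ?ltn_ord // => /eqP; exact: val_inj.
Qed.

Lemma vtx_root (u : 'I_(nvertices t)) : exists r : 'I_(nvertices t), vtx r = [::] /\ connect e u r.
Proof.
have [n] := ubnP (size (vtx u)); elim: n u => // n IH u un.
have [u0|u0] := eqVneq (vtx u) [::]; first by exists u.
have [a av au] := vertices_parent (mem_nth _ (ltn_ord u)) u0.
have ai : (index a (vertices t) < nvertices t)%N by rewrite index_mem.
have va : vtx (Ordinal ai) = a by rewrite /= nth_index.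
have [|r [r0 cr]] := IH (Ordinal ai).
  rewrite va; move: au un; rewrite /parent_of => /andP[_ /eqP ->]; lia.
exists r; split => //; apply: connect_trans (connect1 _) cr.
by rewrite ptree_graphE va au orbT.
Qed.

(** Connectedness: every vertex climbs to the root. Acyclicity: at a deepest vertex of a cycle both
    neighbours along the cycle must be its parent, hence coincide, which a cycle of length at least
    3 forbids. *)
Lemma ptree_graph_tree : is_tree e.
Proof.
split.
- exact: nvertices_gt0.
- exact: ptree_graph_sym.
- by move=> u; rewrite ptree_graphE parent_of_irr.
- move=> u v; have [r [r0 ur]] := vtx_root u; have [s [s0 vs]] := vtx_root v.
  have rs : r = s by apply: vtx_inj; rewrite r0 s0.
  by apply: connect_trans ur _; rewrite rs (sym_connect_sym ptree_graph_sym).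
move=> c /andP[cyc unq]; rewrite leqNgt; apply/negP => c3.
case: c cyc unq c3 => [|u0 c'] // cyc unq c3; set c := u0 :: c' in cyc unq c3.
have [u uc umax] : exists2 u, u \in c & forall v, v \in c -> (size (vtx v) <= size (vtx u))%N.
  have := @arg_maxnP _ u0 (mem c) (fun v => size (vtx v)) (mem_head _ _).
  by case=> u uc h; exists u.
have nb v : v \in c -> e u v || e v u -> parent_of (vtx v) (vtx u).
  move=> vc; rewrite (ptree_graph_sym v) orbb ptree_graphE => /orP[|//].
  move=> /andP[_ /eqP h]; by have := umax v vc; rewrite h ltnn.
have pu := nb _ (etrans (mem_next _ _) uc) (introT orP (or_introl (next_cycle cyc uc))).
have pp := nb _ (etrans (mem_prev _ _) uc) (introT orP (or_intror (prev_cycle cyc uc))).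
have npE : next c u = prev c u by apply: vtx_inj; exact: parent_of_unique pu pp.
have nnu : next c (next c u) = u by rewrite npE next_prev.
have [i p def_c] := rot_to uc.
have uu : uniq (u :: p) by rewrite -def_c rot_uniq.
have np : next (u :: p) =1 next c by move=> v; rewrite -def_c next_rot.
have sp : size (u :: p) = size c by rewrite -def_c size_rot.
case: p {def_c} uu np sp => [|v [|z p]] uu np sp; try by move: c3; rewrite -sp.
have nu : next c u = v by rewrite -np /= eqxx.
move: nnu; rewrite nu -np /=.
move: uu; rewrite /= !inE => /and3P[]; rewrite !negb_or => /and3P[uv uz _] _ _.
by rewrite eq_sym (negbTE uv) eqxx => zu; move: uz; rewrite zu eqxx.
Qed.

Lemma ptree_graph_lt (u v : 'I_(nvertices t)) :
  ((u < v)%N && e u v) = parent_of (vtx u) (vtx v).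
Proof.
have lt_np (a b : 'I_(nvertices t)) : (a < b)%N -> ~~ parent_of (vtx b) (vtx a).
  move=> ab; have /(pairwiseP [::]) h := vertices_preorder t.
  by apply: h => //; rewrite inE; exact: ltn_ord.
rewrite ptree_graphE; case: (ltngtP u v) => [uv|vu|/val_inj ->] /=.
- by rewrite (negbTE (lt_np _ _ uv)) orbF.
- by rewrite (negbTE (lt_np _ _ vu)).
- by rewrite parent_of_irr.
Qed.

End PtreeGraph.

Section AssignSum.
Variables (R : realFieldType) (N : nat) (w : 'I_N -> 'I_N -> R) (x0 : 'I_N).
Implicit Types (phi psi : seq 'I_N -> R).

(** Iterated one variable at a time like [cube_integral], so that the two are matched by a plain
    induction. *)
Fixpoint assign_sum (k : nat) phi : R :=
  if k is k'.+1 then \sum_i assign_sum k' (fun s => phi (i :: s)) else phi [::].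

Lemma eq_assign_sum k phi psi : (forall s, size s = k -> phi s = psi s) ->
  assign_sum k phi = assign_sum k psi.
Proof.
elim: k phi psi => [|k IH] phi psi h /=; first exact: h.
by apply: eq_bigr => i _; apply: IH => s sk; apply: h; rewrite /= sk.
Qed.

Lemma assign_sumZ k c phi : assign_sum k (fun s => c * phi s) = c * assign_sum k phi.
Proof.
elim: k phi => [|k IH] phi //=; rewrite mulr_sumr; apply: eq_bigr => i _; exact: IH.
Qed.

Lemma assign_sum_cat k l phi : assign_sum (k + l) phi =
  assign_sum k (fun s => assign_sum l (fun s' => phi (s ++ s'))).
Proof. by elim: k phi => [|k IH] phi //=; apply: eq_bigr => i _; rewrite IH. Qed.

(* [s] assigns values to the vertices listed in [V], in the same order. *)
Definition lookup (V : seq (seq nat)) (s : seq 'I_N) (a : seq nat) : 'I_N :=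
  nth x0 s (index a V).

Definition edge_prod (V : seq (seq nat)) (F : seq nat -> 'I_N) : R :=
  \prod_(a <- V) \prod_(b <- V | parent_of a b) w (F a) (F b).

Lemma eq_edge_prod V F F' : {in V, F =1 F'} -> edge_prod V F = edge_prod V F'.
Proof.
move=> FF'; rewrite /edge_prod big_seq [RHS]big_seq; apply: eq_bigr => a aV.
rewrite big_seq_cond [RHS]big_seq_cond; apply: eq_bigr => b /andP[bV _].
by rewrite !FF'.
Qed.

(** What [edge_prod] becomes once the root value [y] is fixed: one factor per child, over disjoint
    sets of vertices. *)
Fixpoint forest_prod (y : 'I_N) (i : nat) (ts : seq ptree) (F : seq nat -> 'I_N) : R :=
  if ts is c :: ts' then
    w y (F [:: i]) * edge_prod (vertices c) (fun a => F (i :: a)) * forest_prod y i.+1 ts' F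
  else 1.

Lemma eq_forest_prod y i ts F F' : {in forest_vertices i ts, F =1 F'} ->
  forest_prod y i ts F = forest_prod y i ts F'.
Proof.
elim: ts i => //= c ts IH i; rewrite forest_vertices_cons => FF'.
congr (_ * _ * _).
- by rewrite FF' // mem_cat map_f // nil_vertices.
- by apply: eq_edge_prod => a ac; apply: FF'; rewrite mem_cat map_f.
- by apply: IH => a ac; apply: FF'; rewrite mem_cat ac orbT.
Qed.

Lemma edge_prod_cat i c ts (F : seq nat -> 'I_N) :
  edge_prod (forest_vertices i (c :: ts)) F =
  edge_prod (vertices c) (fun a => F (i :: a)) * edge_prod (forest_vertices i.+1 ts) F.
Proof.
rewrite /edge_prod forest_vertices_cons big_cat big_map /=; congr (_ * _).
  apply: eq_bigr => a _; rewrite big_cat big_map /= [X in _ * X]big1_seq ?mulr1 => [|b].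
    by apply: eq_bigl => b; rewrite parent_of_cons eqxx.
  case/andP=> ab /forest_vertices_head[j [b' [bE ij]]].
  by move: ab; rewrite bE parent_of_cons => /andP[/eqP ji]; move: ij; rewrite ji ltnn.
rewrite !big_seq; apply: eq_bigr => a /forest_vertices_head[j [a' [-> ij]]].
rewrite big_cat big_map /= [X in X * _]big1 ?mul1r // => b.
by rewrite parent_of_cons => /andP[/eqP ji]; move: ij; rewrite ji ltnn.
Qed.

Lemma edge_prod_node ts F :
  edge_prod (vertices (PNode ts)) F = forest_prod (F [::]) 0 ts F.
Proof.
have root i : \prod_(b <- forest_vertices i ts | parent_of [::] b) w (F [::]) (F b) *
    edge_prod (forest_vertices i ts) F = forest_prod (F [::]) i ts F.
  elim: ts i => [|c ts IH] i /=; first by rewrite /edge_prod !big_nil mulr1.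
  rewrite edge_prod_cat forest_vertices_cons big_cat big_map /= -IH.
  have -> : \prod_(a <- vertices c | parent_of [::] (i :: a)) w (F [::]) (F (i :: a)) =
      w (F [::]) (F [:: i]).
    case: c => ds; rewrite vertices_node big_cons nil_parent_of /= big_seq_cond big1 ?mulr1 //.
    by move=> a /andP[/forest_vertices_head[j [b [-> _]]]]; rewrite nil_parent_of.
  by rewrite mulrACA mulrA.
rewrite -root /edge_prod vertices_node big_cons big_cons parent_of_nil.
congr (_ * _); apply: eq_bigr => a _; rewrite big_cons.
by rewrite parent_of_nil.
Qed.

Lemma lookup_cat_left i c ts s1 s2 a : size s1 = nvertices c -> a \in vertices c ->
  lookup (forest_vertices i (c :: ts)) (s1 ++ s2) (i :: a) = lookup (vertices c) s1 a.
Proof.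
move=> s1c ac; have hi : injective (cons i) by move=> ? ? [].
rewrite /lookup forest_vertices_cons index_cat map_f // index_map //.
by rewrite nth_cat s1c /nvertices index_mem ac.
Qed.

Lemma lookup_cat_right i c ts s1 s2 a : size s1 = nvertices c ->
  a \in forest_vertices i.+1 ts ->
  lookup (forest_vertices i (c :: ts)) (s1 ++ s2) a = lookup (forest_vertices i.+1 ts) s2 a.
Proof.
move=> s1c /forest_vertices_head[j [b [-> ij]]].
rewrite /lookup forest_vertices_cons index_cat.
have -> : (j :: b \in [seq i :: a0 | a0 <- vertices c]) = false.
  by apply/mapP => -[? _ [ji _]]; move: ij; rewrite ji ltnn.
rewrite size_map nth_cat s1c -/(nvertices c).
by rewrite -[X in (_ < X)%N]addn0 ltn_add2l ltn0 addKn.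
Qed.

Definition rooted_sum (t : ptree) (y : 'I_N) : R :=
  assign_sum (nvertices t).-1 (fun s => edge_prod (vertices t) (lookup (vertices t) (y :: s))).

(** For a fixed root value an assignment splits into one block per subtree, and the sum of products
    becomes a product of sums. *)
Lemma rooted_sumE t y : rooted_sum t y = tree_weight w t y.
Proof.
elim/ptree_nested_ind: t y => ts IH y; rewrite /rooted_sum nverticesE succnK.
under eq_assign_sum do rewrite edge_prod_node.
transitivity (assign_sum (sumn (map nvertices ts)) (fun s =>
    forest_prod y 0 ts (lookup (forest_vertices 0 ts) s))).
  apply: eq_assign_sum => s _; rewrite vertices_node {1}/lookup /=.
  apply: eq_forest_prod => a /forest_vertices_head[j [b [-> _]]].
  by rewrite /lookup /=.
elim: ts 0%N IH => //= c ts IHts i IH.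
have nc : nvertices c = (nvertices c).-1.+1 by rewrite prednK ?nvertices_gt0.
rewrite assign_sum_cat.
transitivity (assign_sum (nvertices c) (fun s1 =>
    (w y (head x0 s1) * edge_prod (vertices c) (lookup (vertices c) s1)) *
    \prod_(d <- ts) (\sum_j w y j * tree_weight w d j))).
  apply: eq_assign_sum => s1 s1c.
  have -> : \prod_(d <- ts) (\sum_j w y j * tree_weight w d j) =
      assign_sum (sumn (map nvertices ts)) (fun s2 =>
        forest_prod y i.+1 ts (lookup (forest_vertices i.+1 ts) s2)).
    by rewrite IHts ?foldrE //;
      [rewrite unlock /reducebig; elim: ts {IHts IH} => //= d ts ->|move=> d h; apply: IH; right].
  rewrite -assign_sumZ; apply: eq_assign_sum => s2 _.
  congr (_ * _ * _).
  - rewrite lookup_cat_left ?nil_vertices // /lookup; case: (c) => ds.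
    by rewrite vertices_node /=; case: (s1).
  - by apply: eq_edge_prod => a ac; rewrite lookup_cat_left.
  - by apply: eq_forest_prod => a ac; rewrite lookup_cat_right.
rewrite nc /=.
have -> : foldr (fun c acc => (\sum_j w y j * tree_weight w c j) * acc) 1 ts =
   \prod_(d <- ts) (\sum_j w y j * tree_weight w d j).
  by elim: (ts) => [|d ds]; rewrite ?big_nil ?big_cons //= => ->.
rewrite mulr_suml; apply: eq_bigr => j _; rewrite -(IH c (or_introl erefl)) /rooted_sum.
under eq_assign_sum do rewrite mulrC.
by rewrite assign_sumZ mulrC assign_sumZ.
Qed.

Lemma graph_edge_prod t (s : seq 'I_N) : size s = nvertices t ->
  \prod_(p : 'I_(nvertices t) * 'I_(nvertices t) |
     (p.1 < p.2)%N && ptree_graph p.1 p.2) w (nth x0 s p.1) (nth x0 s p.2) =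
  edge_prod (vertices t) (lookup (vertices t) s).
Proof.
move=> st.
have look (u : 'I_(nvertices t)) : lookup (vertices t) s (nth [::] (vertices t) u) = nth x0 s u.
  by rewrite /lookup index_uniq // vertices_uniq.
rewrite /edge_prod (big_nth [::]) big_mkord -(pair_big_dep xpredT
  (fun u v : 'I_(nvertices t) => (u < v)%N && ptree_graph u v)
  (fun u v => w (nth x0 s u) (nth x0 s v))) /=.
apply: eq_bigr => u _; rewrite (big_nth [::]) big_mkord.
by apply: eq_big => [v|v _]; [exact: ptree_graph_lt|rewrite !look].
Qed.

Lemma assign_sum_tree t :
  assign_sum (nvertices t) (fun s => edge_prod (vertices t) (lookup (vertices t) s)) =
  \sum_y tree_weight w t y.
Proof.
rewrite -(prednK (nvertices_gt0 t)) /=; apply: eq_bigr => y _.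
by rewrite -rooted_sumE.
Qed.

End AssignSum.

Section StepIntegral.
Context {R : realType} {d : measure_display} {T : measurableType d}
  (mu : {measure set T -> \bar R}) (D : set T).
Hypothesis mD : measurable D.

Lemma Rintegral_step (I : Type) (r : seq I) (f : I -> R) (B : I -> set T) :
  (forall i, measurable (B i)) -> (forall i, (mu (B i `&` D) < +oo)%E) ->
  \int[mu]_(x in D) (\sum_(i <- r) f i * \1_(B i) x) =
  \sum_(i <- r) f i * fine (mu (B i `&` D)).
Proof.
move=> mB fB.
have i1 i : mu.-integrable D (EFin \o \1_(B i)).
  apply/integrableP; split; first exact/measurable_EFinP/measurable_indic.
  rewrite (eq_integral (EFin \o \1_(B i))) ?integral_indic // => x _.
  by rewrite /= ger0_norm.
have iB i : mu.-integrable D (EFin \o (fun x => f i * \1_(B i) x)).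
  exact: (integrableZl mD (f i) (i1 i)).
suff [] : mu.-integrable D (EFin \o (fun x => \sum_(i <- r) f i * \1_(B i) x)) /\
  \int[mu]_(x in D) (\sum_(i <- r) f i * \1_(B i) x) =
  \sum_(i <- r) f i * fine (mu (B i `&` D)) by [].
elim: r => [|i r [IHi IH]].
  under [X in EFin \o X]eq_fun do rewrite big_nil.
  under [in X in _ /\ X]eq_Rintegral do rewrite big_nil.
  rewrite big_nil; split; first exact: integrable0.
  by rewrite /Rintegral integral0_eq.
under [X in EFin \o X]eq_fun do rewrite big_cons.
under [in X in _ /\ X]eq_Rintegral do rewrite big_cons.
split; first exact: (integrableD mD (iB i) IHi).
rewrite big_cons -IH (RintegralD mD (iB i) IHi); congr (_ + _).
by rewrite (RintegralZl (f i) mD (i1 i)) /Rintegral integral_indic.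
Qed.

End StepIntegral.

(** * Homomorphism densities as normalized finite sums *)

Section GraphonDensity.
Variables (R : realType) (N : nat).
Local Notation M := N.+1.
Local Notation blk i := (@block R M i).
Implicit Types (i j : 'I_M) (x : R).

Lemma in_block i x : blk i x <->
  (if val i == 0%N then 0 <= x else i%:R / M%:R < x) /\ x <= i.+1%:R / M%:R.
Proof.
rewrite /block; case: eqP => i0 /=.
  by rewrite in_itv /= i0 mul1r; split => [/andP[]|[-> ->]].
by rewrite in_itv /=; split => [/andP[]|[-> ->]].
Qed.

Lemma block_unique i j x : blk i x -> blk j x -> i = j.
Proof.
wlog ij : i j / (i <= j)%N => [H bi bj|].
  by case: (leqP i j) => [/H|/ltnW/H h]; [exact|rewrite h].
move=> /in_block[_ xi] /in_block[xj _].
move: ij; rewrite leq_eqVlt => /orP[/eqP/val_inj //|ij].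
move: xj; rewrite gtn_eqF; last exact: leq_ltn_trans ij.
by rewrite ltNge (le_trans xi) // ler_wpM2r ?invr_ge0 // ler_nat.
Qed.

Lemma block_exists x : 0 <= x <= 1 -> exists i : 'I_M, blk i x.
Proof.
move=> /andP[x0 x1].
(* The wanted block is the least [k] satisfying the upper bound; minimality gives its lower end. *)
have ex : exists k, x <= k.+1%:R / M%:R by exists N; rewrite divff ?pnatr_eq0.
case: (ex_minnP ex) => k xk kmin.
have kM : (k < M)%N by rewrite ltnS; apply: kmin; rewrite divff ?pnatr_eq0.
exists (Ordinal kM); apply/in_block; split => //=.
case: eqP => // k0; rewrite ltNge; apply/negP => xk'.
by have := kmin k.-1; rewrite prednK ?lt0n; [move=> /(_ xk'); lia|apply/eqP].
Qed.

(** The default [ord0] is reached only outside [[0, 1]]. *)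
Definition block_index x : 'I_M := odflt ord0 [pick i | x \in blk i].

Lemma block_indexP x : 0 <= x <= 1 -> blk (block_index x) x.
Proof.
move=> /block_exists[i ix]; rewrite /block_index; case: pickP => [j|/(_ i)] /=.
  by rewrite inE.
by rewrite (mem_set ix).
Qed.

Lemma indic_block x i : 0 <= x <= 1 -> \1_(blk i) x = (i == block_index x)%:R :> R.
Proof.
move=> /block_indexP bx; rewrite indicE; case: eqP => [->|ne]; first by rewrite mem_set.
by rewrite memNset // => bi; apply: ne; exact: block_unique bi bx.
Qed.

Lemma graphon_ofE (A : 'M[R]_M) x y : 0 <= x <= 1 -> 0 <= y <= 1 ->
  graphon_of A x y = A (block_index x) (block_index y).
Proof.
move=> hx hy; rewrite /graphon_of (bigD1 (block_index x)) //= (bigD1 (block_index y)) //=.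
rewrite !indic_block // !eqxx !mulr1 big1 ?addr0 => [|j jy].
  rewrite big1 ?addr0 // => i ix; rewrite big1 // => j _.
  by rewrite !indic_block // (negbTE ix) mulr0 mul0r.
by rewrite indic_block // (negbTE jy) mulr0.
Qed.

Lemma measurable_block i : measurable (blk i).
Proof. by rewrite /block; case: ifP => _; exact: measurable_itv. Qed.

Lemma block_sub i : blk i `<=` `[0, 1]%classic.
Proof.
move=> x /in_block[h1 h2]; rewrite /= in_itv /=.
have M0 : 0 < M%:R :> R by rewrite ltr0n.
rewrite (le_trans h2) ?andbT; last by rewrite ler_pdivrMr // mul1r ler_nat.
by move: h1; case: ifP => // _ /ltW; apply: le_trans; rewrite divr_ge0.
Qed.

Lemma lebesgue_block i : @lebesgue_measure R (blk i) = (M%:R^-1)%:E.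
Proof.
have M0 : 0 < M%:R :> R by rewrite ltr0n.
rewrite /block; case: eqP => i0; rewrite lebesgue_measure_itv /= lte_fin.
  by rewrite invr_gt0 M0 sube0.
rewrite ltr_pM2r ?invr_gt0 // ltr_nat ltnSn -EFinB; congr EFin.
by rewrite -mulrBl -[i.+1%:R]natr1 addrAC subrr add0r mul1r.
Qed.

Lemma integral_block_index (f : 'I_M -> R) :
  \int[@lebesgue_measure R]_(x in `[0, 1]) f (block_index x) = M%:R^-1 * \sum_i f i.
Proof.
transitivity (\int[@lebesgue_measure R]_(x in `[0, 1]) (\sum_i f i * \1_(blk i) x)).
  apply: eq_Rintegral => x; rewrite inE /= in_itv /= => hx.
  rewrite (bigD1 (block_index x)) //= indic_block // eqxx mulr1 big1 ?addr0 // => i ix.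
  by rewrite indic_block // (negbTE ix) mulr0.
rewrite Rintegral_step //; last 2 first.
- exact: measurable_block.
- by move=> i; rewrite (setIidl (@block_sub i)) [X in (X < _)%E]lebesgue_block ltry.
rewrite mulr_sumr; apply: eq_bigr => i _.
by rewrite (setIidl (@block_sub i)) [X in fine X]lebesgue_block mulrC.
Qed.

Lemma eq_cube_integral k (f g : k.-tuple R -> R) :
  (forall v : k.-tuple R, (forall l : 'I_k, 0 <= tnth v l <= 1) -> f v = g v) ->
  cube_integral f = cube_integral g.
Proof.
elim: k f g => [|k IH] f g fg /=; first by apply: fg => -[].
apply: eq_Rintegral => x; rewrite inE /= in_itv /= => hx.
apply: IH => v hv; apply: fg => i.
case: (unliftP ord0 i) => [j ->|->]; last by rewrite tnth0.
by rewrite tnthS.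
Qed.

Lemma cube_integral_assign_sum k (phi : seq 'I_M -> R) :
  cube_integral (fun v : k.-tuple R => phi (map block_index v)) =
  M%:R^-1 ^+ k * assign_sum k phi.
Proof.
elim: k phi => [|k IH] phi /=; first by rewrite expr0 mul1r.
transitivity (\int[@lebesgue_measure R]_(x in `[0, 1])
    (fun i => M%:R^-1 ^+ k * assign_sum k (fun s => phi (i :: s))) (block_index x)).
  by apply: eq_Rintegral => x _; rewrite -IH.
rewrite (integral_block_index (fun i => M%:R^-1 ^+ k * assign_sum k (fun s => phi (i :: s)))).
by rewrite -mulr_sumr exprS mulrA.
Qed.

Lemma hom_density_graphon k (e : rel 'I_k) (A : 'M[R]_M) :
  hom_density e (graphon_of A) = M%:R^-1 ^+ k * assign_sum k (fun s =>
    \prod_(p : 'I_k * 'I_k | (p.1 < p.2)%N && e p.1 p.2)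
      A (nth ord0 s p.1) (nth ord0 s p.2)).
Proof.
rewrite -cube_integral_assign_sum; apply: eq_cube_integral => v hv.
apply: eq_bigr => p _; rewrite graphon_ofE //.
by rewrite !(nth_map 0) ?size_tuple // !(tnth_nth 0).
Qed.

Lemma hom_density_ptree (t : ptree) (A : 'M[R]_M) :
  hom_density (@ptree_graph t) (graphon_of A) =
  M%:R^-1 ^+ (nvertices t) * \sum_y tree_weight (fun i j => A i j) t y.
Proof.
rewrite hom_density_graphon -(assign_sum_tree _ ord0); congr (_ * _).
by apply: eq_assign_sum => s st; rewrite graph_edge_prod.
Qed.

End GraphonDensity.

(** * Measures determined by their transforms at large arguments *)

Section AbsPolynomial.
Variable R : realFieldType.

(* The classical iteration P' = P + (x^2 - P^2) / 2, which increases to |x| on [-1, 1]. *)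
Fixpoint abs_poly (n : nat) : {poly R} :=
  if n is n'.+1 then abs_poly n' + 2^-1 *: ('X^2 - abs_poly n' ^+ 2) else 0.

Lemma abs_poly_approx n (y : R) : `|y| <= 1 ->
  0 <= `|y| - (abs_poly n).[y] <= `|y| * (1 - `|y| / 2) ^+ n /\ 0 <= (abs_poly n).[y].
Proof.
move=> y1; have y0 := normr_ge0 y.
elim: n => [|n [/andP[IH1 IH2] IH3]] /=.
  by rewrite horner0 subr0 expr0 mulr1 y0 !lexx.
set p := (abs_poly n).[y] in IH1 IH2 IH3.
have -> : (abs_poly n + 2^-1 *: ('X^2 - abs_poly n ^+ 2)).[y] = p + (`|y| ^+ 2 - p ^+ 2) / 2.
  by rewrite !hornerE -/p real_normK ?num_real // mulrC.
have -> : `|y| - (p + (`|y| ^+ 2 - p ^+ 2) / 2) = (`|y| - p) * (1 - (`|y| + p) / 2).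
  by field.
have h1 : 0 <= 1 - (`|y| + p) / 2 by move: IH1 y1; lra.
have h2 : 1 - (`|y| + p) / 2 <= 1 - `|y| / 2 by move: IH3; lra.
split; last by rewrite addr_ge0 // divr_ge0 // subr_ge0 lerXn2r ?nnegrE //; move: IH1; lra.
rewrite mulr_ge0 //= exprSr mulrA ler_pM //.
Qed.

(** The error [z (1 - z/2)^n] is small uniformly in [z] by the Bernoulli-type bound
    [(1 - s)^n (1 + n s) <= 1] at [s = z/2]. *)
Lemma abs_poly_error n (y : R) : `|y| <= 1 -> `| `|y| - (abs_poly n).[y] | <= 2 / n.+1%:R.
Proof.
move=> y1; have [/andP[h1 h2] _] := abs_poly_approx n y1.
rewrite ger0_norm //; apply: le_trans h2 _; set z := `|y|.
have z0 : 0 <= z by apply: normr_ge0.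
have bern k : (1 - z / 2) ^+ k * (1 + k%:R * (z / 2)) <= 1.
  elim: k => [|k IH]; first by rewrite expr0 mul0r addr0 mulr1.
  apply: le_trans IH; rewrite exprSr -mulrA ler_wpM2l //.
    by apply: exprn_ge0; move: y1; rewrite -/z; lra.
  rewrite -[k.+1%:R]natr1; have : 0 <= k%:R :> R by [].
  set K := k%:R => K0; have : 0 <= K * (z / 2) ^+ 2 by rewrite mulr_ge0 // sqr_ge0.
  have := sqr_ge0 (z / 2); set q := z / 2.
  have -> : (1 - q) * (1 + (K + 1) * q) = 1 + K * q - (K * q ^+ 2 + q ^+ 2) by ring.
  lra.
rewrite ler_pdivlMr ?ltr0n //.
have pw : 0 <= (1 - z / 2) ^+ n by apply: exprn_ge0; move: y1; rewrite -/z; lra.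
have pw1 : (1 - z / 2) ^+ n <= 1 by apply: exprn_ile1; move: y1; rewrite -/z; lra.
have := bern n; rewrite -[n.+1%:R]natr1; set W := (1 - z / 2) ^+ n in pw pw1 *.
have -> : W * (1 + n%:R * (z / 2)) = W + z * W * n%:R / 2 by field.
have : z * W <= W by rewrite ler_piMl.
rewrite mulrDr mulr1; lra.
Qed.

End AbsPolynomial.

(** * Empirical means and the functions whose means must converge *)

Section Mean.
Variable R : realType.
Implicit Types (s : seq R) (f g : R -> R).

(** The integral against the empirical measure of [s]. An empty list gives 0, so constants are
    preserved only when [0 < size s]. *)
Definition mean s f : R := (size s)%:R^-1 * \sum_(x <- s) f x.

Lemma meanD s f g : mean s (fun x => f x + g x) = mean s f + mean s g.
Proof. by rewrite /mean big_split mulrDr. Qed.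

Lemma meanZ s c f : mean s (fun x => c * f x) = c * mean s f.
Proof. by rewrite /mean -mulr_sumr mulrCA. Qed.

Lemma meanB s f g : mean s (fun x => f x - g x) = mean s f - mean s g.
Proof. by rewrite /mean sumrB mulrBr. Qed.

Lemma mean_sum s n (f : 'I_n -> R -> R) :
  mean s (fun x => \sum_(i < n) f i x) = \sum_(i < n) mean s (f i).
Proof. by rewrite /mean exchange_big mulr_sumr. Qed.

Lemma mean_cst s c : (0 < size s)%N -> mean s (fun=> c) = c.
Proof.
move=> s0; rewrite /mean big_const_seq count_predT iter_addr_0 -[c *+ _]mulr_natl.
by rewrite mulrA mulVf ?mul1r // pnatr_eq0 -lt0n.
Qed.

Lemma le_mean s f g : all (>= 0) s -> (forall x, 0 <= x -> f x <= g x) ->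
  mean s f <= mean s g.
Proof.
move=> /allP s0 fg; rewrite /mean ler_wpM2l ?invr_ge0 //.
by rewrite big_seq [leRHS]big_seq; apply: ler_sum => x /s0; exact: fg.
Qed.

Lemma eq_mean s f g : all (>= 0) s -> (forall x, 0 <= x -> f x = g x) ->
  mean s f = mean s g.
Proof.
by move=> s0 fg; apply/eqP; rewrite eq_le !le_mean // => x x0; rewrite fg.
Qed.

Lemma mean_dist s f g e : all (>= 0) s -> 0 <= e -> (forall x, 0 <= x -> `|f x - g x| <= e) ->
  `|mean s f - mean s g| <= e.
Proof.
move=> s0 e0 fg; have [z|n0] := posnP (size s).
  by rewrite /mean z invr0 !mul0r subrr normr0.
rewrite -meanB ler_norml -{1}(mean_cst (- e) n0) -{2}(mean_cst e n0).
by rewrite !le_mean // => x /fg; rewrite ler_norml => /andP[].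
Qed.

End Mean.

Section Convergence.
Variables (R : realType) (t0 : R) (r : R -> R).
Hypothesis t0_gt0 : 0 < t0.
Implicit Types (s : nat -> seq R) (f g : R -> R).

(** The kernel is [t] times the Stieltjes kernel at [-t]; on the half-line it lies in []0, 1]]. *)
Definition stieltjes_cvg s := [/\ forall n, all (>= 0) (s n),
  \forall n \near \oo, (0 < size (s n))%N &
  forall t, t0 <= t -> mean (s n) (fun x => t / (x + t)) @[n --> \oo] --> r t].

(* The limit depends on [r] only, not on [s]. *)
Definition common_cvg f := forall e, 0 < e -> exists l, forall s, stieltjes_cvg s ->
  \forall n \near \oo, `|mean (s n) f - l| <= e.

Lemma common_cvg_resolvent t : t0 <= t -> common_cvg (fun x => t / (x + t)).
Proof.
move=> tt0 e e0; exists (r t) => s [_ _ /(_ t tt0)] /cvgrPdist_le /(_ e e0).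
by apply: filterS => n; rewrite distrC.
Qed.

Lemma common_cvg_cst c : common_cvg (fun=> c).
Proof.
move=> e e0; exists c => s [_ sn _]; apply: filterS sn => n n0.
by rewrite mean_cst // subrr normr0 ltW.
Qed.

Lemma common_cvgD f g : common_cvg f -> common_cvg g -> common_cvg (fun x => f x + g x).
Proof.
move=> cf cg e e0; have e2 : 0 < e / 2 by rewrite divr_gt0.
have [l fl] := cf _ e2; have [l' gl'] := cg _ e2; exists (l + l') => s gs.
have h1 := fl s gs; have h2 := gl' s gs; near=> n.
rewrite meanD opprD addrACA; apply: le_trans (ler_normD _ _) _.
rewrite [leRHS]splitr; apply: lerD; near: n; [exact: h1|exact: h2].
Unshelve. all: by end_near. Qed.

Lemma common_cvgZ c f : common_cvg f -> common_cvg (fun x => c * f x).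
Proof.
move=> cf e e0; have c1 : 0 < `|c| + 1 by rewrite ltr_wpDl.
have e2 : 0 < e / (`|c| + 1) by rewrite divr_gt0.
have [l fl] := cf _ e2; exists (c * l) => s /fl; apply: filterS => n h.
rewrite meanZ -mulrBr normrM; apply: le_trans (ler_wpM2l (normr_ge0 c) h) _.
by rewrite mulrA ler_pdivrMr // [leLHS]mulrC ler_wpM2l ?lerDl // ltW.
Qed.

Lemma common_cvg_ext f g : (forall x, 0 <= x -> f x = g x) -> common_cvg f -> common_cvg g.
Proof.
move=> fg cf e e0; have [l fl] := cf e e0; exists l => s gs.
have [s0 _ _] := gs; apply: filterS (fl s gs) => n.
by rewrite (eq_mean (s0 n) fg).
Qed.

Lemma common_cvg_uniform f : (forall e, 0 < e -> exists2 g, common_cvg g &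
  forall x, 0 <= x -> `|f x - g x| <= e) -> common_cvg f.
Proof.
move=> H e e0; have e2 : 0 < e / 2 by rewrite divr_gt0.
have [g cg fg] := H _ e2; have [l gl] := cg _ e2; exists l => s gs.
have [s0 _ _] := gs; apply: filterS (gl s gs) => n h.
rewrite -(subrK (mean (s n) g) (mean (s n) f)) -addrA; apply: le_trans (ler_normD _ _) _.
by rewrite [leRHS]splitr lerD // mean_dist // ltW.
Qed.

Let Rt (t x : R) : R := (x + t)^-1.

(* Powers of the kernel t / (x + t) are its derivatives in t up to a factor, so they are limits of
   combinations of kernels. *)
Lemma difference_quotient_bound (a b h M : R) k : 0 <= b -> b <= a -> a <= M ->
  0 < h -> a - b = h * (a * b) ->
  `|a ^+ k.+2 - (a ^+ k.+1 - b ^+ k.+1) / (k.+1%:R * h)| <= h * (k.+1%:R * M ^+ k.+3).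
Proof.
move=> b0 ba aM h0 E; have a0 : 0 <= a by apply: le_trans ba.
have M0 : 0 <= M by apply: le_trans aM.
have k0 : 0 < k.+1%:R :> R by rewrite ltr0n.
have diffX j : 0 <= a ^+ j - b ^+ j <= j%:R * (a ^+ j.-1 * (a - b)).
  case: j => [|j]; first by rewrite !expr0 subrr mul0r lexx.
  rewrite subr_ge0 lerXn2r ?nnegrE // andTb subrXX mulrC mulrA ler_wpM2r ?subr_ge0 //.
  apply: (@le_trans _ _ (\sum_(i < j.+1) a ^+ j)); last first.
    by rewrite sumr_const card_ord -[leLHS]mulr_natl.
  apply: ler_sum => i _; rewrite (_ : a ^+ j = a ^+ (j - i) * a ^+ i); last first.
    by rewrite -exprD subnK // -ltnS.
  by rewrite /= ler_wpM2l ?exprn_ge0 // lerXn2r ?nnegrE.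
have -> : (a ^+ k.+1 - b ^+ k.+1) / (k.+1%:R * h) =
    k.+1%:R^-1 * \sum_(j < k.+1) a ^+ (k.+1 - j) * b ^+ j.+1.
  have -> : \sum_(j < k.+1) a ^+ (k.+1 - j) * b ^+ j.+1 =
      a * b * \sum_(j < k.+1) a ^+ (k.+1.-1 - j) * b ^+ j.
    rewrite mulr_sumr; apply: eq_bigr => i _.
    have ik : (i <= k)%N by rewrite -ltnS.
    by rewrite subSn // !exprS; ring.
  rewrite subrXX E; have k0' : k.+1%:R != 0 :> R by rewrite gt_eqF.
  have h0' : h != 0 by rewrite gt_eqF.
  move: (\sum_(i < _) _) k0' => S; move: (k.+1%:R : R) => K k0'.
  by field; rewrite k0' h0'.
have -> : a ^+ k.+2 - k.+1%:R^-1 * \sum_(j < k.+1) a ^+ (k.+1 - j) * b ^+ j.+1 =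
    k.+1%:R^-1 * \sum_(j < k.+1) (a ^+ k.+2 - a ^+ (k.+1 - j) * b ^+ j.+1).
  rewrite sumrB sumr_const card_ord -[a ^+ k.+2 *+ _]mulr_natl mulrBr.
  by rewrite [X in _ = X - _]mulrA mulVf ?gt_eqF // mul1r.
rewrite normrM (ger0_norm (_ : 0 <= k.+1%:R^-1)) ?invr_ge0 // ler_pdivrMl //.
apply: le_trans (ler_norm_sum _ _ _) _.
apply: (@le_trans _ _ (\sum_(j < k.+1) h * (k.+1%:R * M ^+ k.+3))); last first.
  by rewrite sumr_const card_ord -[leLHS]mulr_natl.
apply: ler_sum => j _; have jk : (j <= k)%N by rewrite -ltnS.
have -> : a ^+ k.+2 = a ^+ (k.+1 - j) * a ^+ j.+1.
  by rewrite -exprD addnS subnK // ltnW.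
have /andP[d0 d1] := diffX j.+1.
rewrite -mulrBr ger0_norm ?mulr_ge0 ?exprn_ge0 //.
apply: (@le_trans _ _ (a ^+ (k.+1 - j) * (k.+1%:R * (a ^+ j * (h * (a * a)))))).
  rewrite ler_wpM2l ?exprn_ge0 //; apply: le_trans d1 _; rewrite E.
  apply: ler_pM; rewrite ?ler_nat //; first by rewrite !mulr_ge0 ?exprn_ge0 // ltW.
  by rewrite !ler_wpM2l ?exprn_ge0 // ltW.
have -> : a ^+ (k.+1 - j) * (k.+1%:R * (a ^+ j * (h * (a * a)))) =
    h * (k.+1%:R * (a ^+ (k.+1 - j) * a ^+ j * a * a)) by ring.
have -> : a ^+ (k.+1 - j) * a ^+ j * a * a = a ^+ k.+3.
  by rewrite -exprD subnK; [rewrite !exprSr|exact: ltnW].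
apply: ler_wpM2l; first exact: ltW.
by apply: ler_wpM2l => //; rewrite lerXn2r ?nnegrE.
Qed.

(** The power [k.+2] at [t] is approximated through powers [k.+1] at [t] and [t + h], both in the
    admissible range; the error is uniform in [x >= 0] because [Rt t x <= t^-1]. *)
Lemma common_cvg_power k t : t0 <= t -> common_cvg (fun x => Rt t x ^+ k.+1).
Proof.
elim: k t => [|k IH] t tt0.
  have tp : 0 < t by apply: lt_le_trans tt0.
  apply: common_cvg_ext (common_cvgZ t^-1 (common_cvg_resolvent tt0)) => x x0.
  by rewrite /Rt expr1; field; rewrite !gt_eqF // ltr_wpDl.
have tp : 0 < t by apply: lt_le_trans tt0.
apply: common_cvg_uniform => e e0.
pose M : R := t^-1; have M0 : 0 <= M by rewrite invr_ge0 ltW.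
pose L : R := k.+1%:R * M ^+ k.+3; have L0 : 0 <= L by rewrite mulr_ge0 // exprn_ge0.
pose h := e / (L + 1); have h0 : 0 < h by rewrite divr_gt0 // ltr_wpDl.
exists (fun x => (k.+1%:R * h)^-1 * (Rt t x ^+ k.+1 + (-1) * Rt (t + h) x ^+ k.+1)).
  apply: common_cvgZ; apply: common_cvgD; first exact: IH.
  by apply: common_cvgZ; apply: IH; rewrite (le_trans tt0) // lerDl ltW.
move=> x x0; rewrite mulrC mulN1r.
have xt : 0 < x + t by rewrite ltr_wpDl.
have xth : 0 < x + (t + h) by rewrite addrA addr_gt0.
apply: le_trans (difference_quotient_bound k (M := M) _ _ _ h0 _) _.
- by rewrite invr_ge0 ltW.
- by rewrite lef_pV2 ?posrE // addrA lerDl ltW.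
- by rewrite /M lef_pV2 ?posrE // lerDr.
- by rewrite /Rt; field; rewrite (gt_eqF xt) (gt_eqF xth).
by rewrite -/L /h mulrAC ler_pdivrMr ?ltr_wpDl // ler_wpM2l ?lerDl // ltW.
Qed.

(** A decreasing change of variable from the half-line onto []0, 1]], where polynomial approximation
    is available. *)
Definition uvar (x : R) : R := t0 / (x + t0).

Lemma common_cvg_poly (p : {poly R}) : common_cvg (fun x => p.[uvar x]).
Proof.
have pw k : common_cvg (fun x => uvar x ^+ k).
  case: k => [|k].
    by apply: common_cvg_ext (common_cvg_cst 1) => x _; rewrite expr0.
  apply: common_cvg_ext (common_cvgZ (t0 ^+ k.+1) (common_cvg_power k (lexx t0))) => x _.
  by rewrite /uvar /Rt exprMn.
apply: common_cvg_ext (_ : common_cvg (fun x => \sum_(i < size p) p`_i * uvar x ^+ i)) => [x _|].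
  by rewrite horner_coef.
elim: (size p) => [|n IH].
  by apply: common_cvg_ext (common_cvg_cst 0) => x _; rewrite big_ord0.
apply: common_cvg_ext (common_cvgD IH (common_cvgZ p`_n (pw n))) => x _.
by rewrite big_ord_recr.
Qed.

Lemma uvar_bounds x : 0 <= x -> 0 < uvar x <= 1.
Proof.
move=> x0; have xt : 0 < x + t0 by rewrite ltr_wpDl.
by rewrite divr_gt0 //= ler_pdivrMr // mul1r lerDr.
Qed.

Lemma common_cvg_abs (a : R) : 0 <= a <= 1 -> common_cvg (fun x => `|uvar x - a|).
Proof.
move=> /andP[a0 a1]; apply: common_cvg_uniform => e e0.
have [n ne] := @ltr_add_invr R 0 (e / 2) (divr_gt0 e0 (ltr0n R 2)).
exists (fun x => (abs_poly R n \Po ('X - a%:P)).[uvar x]); first exact: common_cvg_poly.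
move=> x /uvar_bounds/andP[u0 u1]; rewrite horner_comp !hornerE.
apply: le_trans (abs_poly_error n _) _; first by rewrite ler_norml; apply/andP; split; lra.
by move: ne; rewrite add0r => /ltW; rewrite ler_pdivlMr // mulrC.
Qed.

(** Piecewise linear, 0 up to [a] and 1 from [c] on. It is written with absolute values because
    these are what [abs_poly] approximates. *)
Definition ramp (a c u : R) : R := (`|u - a| - `|u - c| + (c - a)) / (2 * (c - a)).

Lemma common_cvg_ramp (a c : R) : 0 <= a -> a < c -> c <= 1 ->
  common_cvg (fun x => ramp a c (uvar x)).
Proof.
move=> a0 ac c1.
have ha : common_cvg (fun x => `|uvar x - a|) by apply: common_cvg_abs; apply/andP; split; lra.
have hc : common_cvg (fun x => `|uvar x - c|) by apply: common_cvg_abs; apply/andP; split; lra.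
apply: common_cvg_ext (common_cvgZ (2 * (c - a))^-1 (common_cvgD (common_cvgD ha
  (common_cvgZ (-1) hc)) (common_cvg_cst (c - a)))) => x _.
by rewrite /ramp mulN1r mulrC.
Qed.

Lemma ramp_right (a c u : R) : a < c -> c <= u -> ramp a c u = 1.
Proof.
move=> ac cu; rewrite /ramp !ger0_norm ?subr_ge0 //; last by lra.
have : c - a != 0 by rewrite subr_eq0 gt_eqF.
by move=> ?; field.
Qed.

Lemma ramp_left (a c u : R) : a < c -> u <= a -> ramp a c u = 0.
Proof.
move=> ac ua; rewrite /ramp !ler0_norm ?subr_le0 //; last by lra.
by rewrite (_ : _ + _ = 0) ?mul0r //; ring.
Qed.

Lemma ramp_middle (a c u : R) : a < c -> a <= u <= c -> ramp a c u = (u - a) / (c - a).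
Proof.
move=> ac /andP[au uc]; rewrite /ramp ger0_norm ?subr_ge0 // ler0_norm ?subr_le0 //.
have : c - a != 0 by rewrite subr_eq0 gt_eqF.
by move=> ?; field.
Qed.

Lemma ramp_bounds (a c u : R) : a < c -> 0 <= ramp a c u <= 1.
Proof.
move=> ac; have [ua|au] := leP u a; first by rewrite ramp_left // lexx ler01.
have [cu|uc] := leP c u; first by rewrite ramp_right // lexx ler01.
have ca : 0 < c - a by rewrite subr_gt0.
rewrite ramp_middle ?(ltW au) ?(ltW uc) //; apply/andP; split.
  by apply: divr_ge0; rewrite subr_ge0 ltW.
by rewrite ler_pdivrMr // mul1r lerD2r ltW.
Qed.

End Convergence.

Section Limit.
Variables (R : realType) (t0 : R) (r : R -> R).
Hypothesis t0_gt0 : 0 < t0.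
Variable s0 : nat -> seq R.
Hypothesis s0_cvg : stieltjes_cvg t0 r s0.

(** [s0] is only a reference: by [common_lim_cvg] every sequence of the class has the same
    limits. *)
Definition common_lim (f : R -> R) : R := lim (mean (s0 n) f @[n --> \oo]).

Lemma common_lim_cvg0 f : common_cvg t0 r f ->
  mean (s0 n) f @[n --> \oo] --> common_lim f.
Proof.
move=> cf; apply/cauchy_cvgP/cauchy_exP => e e0.
have [l fl] := cf _ (divr_gt0 e0 (ltr0n R 2)); exists l.
apply: filterS (fl s0 s0_cvg) => n h; rewrite /ball /= distrC.
by apply: le_lt_trans h _; lra.
Qed.

Lemma common_lim_cvg f s : common_cvg t0 r f -> stieltjes_cvg t0 r s ->
  mean (s n) f @[n --> \oo] --> common_lim f.
Proof.
move=> cf gs; apply/cvgrPdist_le => e e0.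
have e3 : 0 < e / 3 by rewrite divr_gt0.
have [l fl] := cf _ e3; have h0 := fl s0 s0_cvg; have h1 := fl s gs.
have /cvgrPdist_le /(_ _ e3) h2 := common_lim_cvg0 cf.
near=> n.
have : `|mean (s0 n) f - l| <= e / 3 by near: n; exact: h0.
have : `|mean (s n) f - l| <= e / 3 by near: n; exact: h1.
have : `|common_lim f - mean (s0 n) f| <= e / 3 by near: n; exact: h2.
rewrite !ler_norml => /andP[? ?] /andP[? ?] /andP[? ?].
by apply/andP; split; lra.
Unshelve. all: by end_near. Qed.

End Limit.

(** * The limit distribution function *)

Section CdfMeasure.
Variables (R : realType) (F : R -> R).
Hypothesis F_nd : {homo F : x y / x <= y}.
Hypothesis F_rc : right_continuous F.
Hypothesis F_Ny : F @ -oo --> (0 : R).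
Hypothesis F_y : F @ +oo --> (1 : R).

Let G : R -> R := F.
HB.instance Definition _ := isCumulative.Build R _ R G F_nd F_rc.
HB.instance Definition _ := isCumulativeBounded.Build R 0 1 G F_Ny F_y.

Lemma cdf_measure_exists : exists mu : probability (measurableTypeR R) R,
  forall x, mu `]-oo, x]%classic = (F x)%:E.
Proof.
exists [the probability _ _ of lebesgue_stieltjes_measure [the cumulativeBounded 0 1 of G]] => x.
have := @cdf_lebesgue_stieltjes_id R [the cumulativeBounded 0 1 of G] x.
by rewrite /cdf /distribution /pushforward preimage_id.
Qed.

End CdfMeasure.

Lemma seq_lim_ge (R : realType) (v : nat -> R) l c :
  v n @[n --> \oo] --> l -> (\forall n \near \oo, c <= v n) -> c <= l.
Proof.
by move=> vl h; rewrite -(cvg_lim _ vl) //; apply: limr_ge => //; apply/cvg_ex; exists l.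
Qed.

Lemma seq_lim_le (R : realType) (v : nat -> R) l c :
  v n @[n --> \oo] --> l -> (\forall n \near \oo, v n <= c) -> l <= c.
Proof.
by move=> vl h; rewrite -(cvg_lim _ vl) //; apply: limr_le => //; apply/cvg_ex; exists l.
Qed.

Section LimitCdf.
Variables (R : realType) (t0 : R) (r : R -> R).
Hypothesis t0_gt0 : 0 < t0.
Variable s0 : nat -> seq R.
Hypothesis s0_cvg : stieltjes_cvg t0 r s0.
Hypothesis r_cvg1 : r @ +oo --> (1 : R).

Local Notation u := (uvar t0).

Definition ramp_lim (a c : R) : R := common_lim s0 (fun x => ramp a c (u x)).

Lemma uvar_lt (x c : R) : 0 <= x -> 0 < c -> (c < u x) = (x < t0 / c - t0).
Proof.
move=> x0 c0; have xt : 0 < x + t0 by rewrite ltr_wpDl.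
by rewrite /uvar ltr_pdivlMr // mulrC -ltr_pdivlMr // ltrBrDr.
Qed.

Lemma uvar_le (x y : R) : 0 <= x -> x <= y -> u y <= u x.
Proof.
move=> x0 xy; apply: (ler_wpM2l (ltW t0_gt0)); rewrite lef_pV2 ?posrE ?lerD2r //.
  by rewrite ltr_wpDl // (le_trans x0).
by rewrite ltr_wpDl.
Qed.

Lemma uvar_ltW (x y : R) : 0 <= x -> x < y -> u y < u x.
Proof.
move=> x0 xy; rewrite ltr_pM2l // ltf_pV2 ?posrE ?ltrD2r //.
  by rewrite ltr_wpDl // (le_trans x0) // ltW.
by rewrite ltr_wpDl.
Qed.

Lemma ramp_lim_cvg s a c : stieltjes_cvg t0 r s -> 0 <= a -> a < c -> c <= 1 ->
  mean (s n) (fun x => ramp a c (u x)) @[n --> \oo] --> ramp_lim a c.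
Proof.
move=> gs a0 ac c1; apply: (common_lim_cvg s0_cvg) => //.
exact: common_cvg_ramp.
Qed.

(** As [u] is decreasing, a ramp with [c < u x] dominates the indicator of [l <= x]. The strict
    inequality persists for slightly larger [x], which makes the infimum right continuous. *)
Definition limit_cdf (x : R) : R :=
  if x < 0 then 0 else inf [set y | exists a c, [/\ 0 <= a, a < c, c < u x & y = ramp_lim a c]].

Lemma ramp_lim_ge0 a c : 0 <= a -> a < c -> c <= 1 -> 0 <= ramp_lim a c.
Proof.
move=> a0 ac c1; have h := ramp_lim_cvg s0_cvg a0 ac c1.
apply: (seq_lim_ge h); near=> n; rewrite mulr_ge0 ?invr_ge0 // sumr_ge0 // => x _.
by have /andP[] := ramp_bounds (u x) ac.
Unshelve. all: by end_near. Qed.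

Lemma ramp_lim_le1 a c : 0 <= a -> a < c -> c <= 1 -> ramp_lim a c <= 1.
Proof.
move=> a0 ac c1; have h := ramp_lim_cvg s0_cvg a0 ac c1.
have [sp sn _] := s0_cvg.
apply: (seq_lim_le h); apply: filterS sn => n n0.
rewrite -[leRHS](mean_cst 1 n0); apply: le_mean => // x x0.
by have /andP[] := ramp_bounds (u x) ac.
Qed.

Let cdf_set x := [set y | exists a c, [/\ 0 <= a, a < c, c < u x & y = ramp_lim a c]].

Let cdf_set_lb x : 0 <= x -> lbound (cdf_set x) 0.
Proof.
move=> /(uvar_bounds t0_gt0)/andP[_ u1] y [a [c [a0 ac cu ->]]].
by apply: ramp_lim_ge0 => //; rewrite ltW // (lt_le_trans cu).
Qed.

Let cdf_set_has_inf x : 0 <= x -> has_inf (cdf_set x).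
Proof.
move=> x0; have /andP[u0 u1] := uvar_bounds t0_gt0 x0; split; last by exists 0; exact: cdf_set_lb.
exists (ramp_lim 0 (u x / 2)); exists 0, (u x / 2); split => //; first by rewrite divr_gt0.
by rewrite ltr_pdivrMr // mulr_natr mulr2n ltrDl.
Qed.

Lemma limit_cdf_neg x : x < 0 -> limit_cdf x = 0.
Proof. by rewrite /limit_cdf => ->. Qed.

Lemma limit_cdf_le x a c : 0 <= x -> 0 <= a -> a < c -> c < u x -> limit_cdf x <= ramp_lim a c.
Proof.
move=> x0 a0 ac cu; rewrite /limit_cdf ltNge x0 /=.
apply: ge_inf; first by exists 0; exact: cdf_set_lb.
by exists a, c.
Qed.

Lemma limit_cdf_lb x y : 0 <= x ->
  (forall a c, 0 <= a -> a < c -> c < u x -> y <= ramp_lim a c) -> y <= limit_cdf x.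
Proof.
move=> x0 h; rewrite /limit_cdf ltNge x0 /=.
apply: lb_le_inf; first by case: (cdf_set_has_inf x0).
by move=> z [a [c [a0 ac cu ->]]]; exact: h.
Qed.

Lemma limit_cdf_ge0 x : 0 <= limit_cdf x.
Proof.
have [x0|x0] := ltP x 0; first by rewrite limit_cdf_neg.
apply: limit_cdf_lb => // a c a0 ac cu; apply: ramp_lim_ge0 => //.
by have /andP[_ ?] := uvar_bounds t0_gt0 x0; rewrite ltW // (lt_le_trans cu).
Qed.

Lemma limit_cdf_le1 x : limit_cdf x <= 1.
Proof.
have [x0|x0] := ltP x 0; first by rewrite limit_cdf_neg.
have /andP[u0 u1] := uvar_bounds t0_gt0 x0.
have h : u x / 2 < u x by rewrite ltr_pdivrMr // mulr_natr mulr2n ltrDl.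
apply: le_trans (limit_cdf_le x0 (lexx 0) (divr_gt0 u0 (ltr0n R 2)) h) _.
by apply: ramp_lim_le1 => //; [exact: divr_gt0|exact: le_trans (ltW h) u1].
Qed.

Lemma limit_cdf_approx x e : 0 <= x -> 0 < e -> exists a c,
  [/\ 0 <= a, a < c, c < u x & ramp_lim a c < limit_cdf x + e].
Proof.
move=> x0 e0; have [y [a [c [a0 ac cu ->]]] h] := inf_adherent e0 (cdf_set_has_inf x0).
by exists a, c; split => //; rewrite /limit_cdf (ltNge x 0) x0 /=.
Qed.

Lemma limit_cdf_nd : {homo limit_cdf : x y / x <= y}.
Proof.
move=> x y xy; have [x0|x0] := ltP x 0; first by rewrite limit_cdf_neg ?limit_cdf_ge0.
apply: limit_cdf_lb => [|a c a0 ac cu]; first exact: le_trans xy.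
by apply: limit_cdf_le => //; apply: lt_le_trans cu _; exact: uvar_le.
Qed.

Lemma limit_cdf_rc : right_continuous limit_cdf.
Proof.
move=> x; apply/cvgrPdist_le => e e0; have [x0|x0] := ltP x 0.
  near=> y; have y0 : y < 0 by near: y; exact: nbhs_right_lt.
  by rewrite !limit_cdf_neg // subrr normr0 ltW.
have [a [c [a0 ac cu h]]] := limit_cdf_approx x0 e0.
have c0 : 0 < c by apply: le_lt_trans ac.
near=> y; have xy : x < y by near: y; exact: nbhs_right_gt.
have yX : y < t0 / c - t0 by near: y; apply: nbhs_right_lt; rewrite -uvar_lt.
have y0 : 0 <= y by rewrite ltW // (le_lt_trans x0).
have h1 := limit_cdf_nd (ltW xy).
have h2 : limit_cdf y <= ramp_lim a c by apply: limit_cdf_le => //; rewrite uvar_lt.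
by rewrite distrC ger0_norm ?subr_ge0 //; move: h h1 h2; lra.
Unshelve. all: by end_near. Qed.

Lemma limit_cdf_Ny : limit_cdf @ -oo --> (0 : R).
Proof.
apply/cvgrPdist_le => e e0; near=> x.
rewrite limit_cdf_neg ?subrr ?normr0 ?ltW //; near: x; apply: nbhs_ninfty_lt; exact: num_real.
Unshelve. all: by end_near. Qed.

(** Tightness: [2 x / (l + x) - 1] is at most 1, and negative for [l > x], so it lies below every
    ramp that enters the infimum. Since [r] tends to 1, no mass escapes to infinity. *)
Lemma limit_cdf_ge_stieltjes x : t0 <= x -> 2 * r x - 1 <= limit_cdf x.
Proof.
move=> tx; have x0 : 0 < x by apply: lt_le_trans tx.
apply: limit_cdf_lb => [|a c a0 ac cu]; first exact: ltW.
have c1 : c <= 1.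
  by have /andP[_ ?] := uvar_bounds t0_gt0 (ltW x0); rewrite ltW // (lt_le_trans cu).
have h := ramp_lim_cvg s0_cvg a0 ac c1.
have [sp sn /(_ x tx) hr] := s0_cvg.
have hr2 : mean (s0 n) (fun l => ramp a c (u l)) - 2 * mean (s0 n) (fun l => x / (l + x))
    @[n --> \oo] --> ramp_lim a c - 2 * r x.
  by apply: cvgB => //; apply: cvgMr.
suff : -1 <= ramp_lim a c - 2 * r x by lra.
apply: (seq_lim_ge hr2); apply: filterS sn => n n0.
rewrite -meanZ -meanB -(mean_cst (-1) n0); apply: le_mean => // l l0.
have lx : 0 < l + x by rewrite ltr_wpDl.
have /andP[rp0 _] := ramp_bounds (u l) ac.
have [cl|lc] := leP c (u l).
  rewrite ramp_right //.
  have : x / (l + x) <= 1 by rewrite ler_pdivrMr // mul1r lerDr.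
  by move: (x / (l + x)) => q ?; lra.
have xl : x < l by apply: contraTT (lt_trans lc cu); rewrite -!leNgt; exact: uvar_le.
have : x / (l + x) <= 1 / 2.
  by rewrite ler_pdivrMr //; lra.
by move: (x / (l + x)) (ramp a c (u l)) rp0 => q p ? ?; lra.
Qed.

Lemma limit_cdf_y : limit_cdf @ +oo --> (1 : R).
Proof.
apply/cvgrPdist_le => e e0; move/cvgrPdist_le : r_cvg1 => /(_ _ (divr_gt0 e0 (ltr0n R 2))) h.
near=> x.
have tx : t0 <= x by near: x; apply: nbhs_pinfty_ge; exact: num_real.
have hx : `|1 - r x| <= e / 2 by near: x; exact: h.
have := limit_cdf_ge_stieltjes tx; have := limit_cdf_le1 x.
move: hx; rewrite ler_norml => /andP[_ hx] x1 rx.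
by rewrite ger0_norm ?subr_ge0 //; lra.
Unshelve. all: by end_near. Qed.

Definition ecdf (s : seq R) (x : R) : R := mean s (fun l => (l <= x)%R%:R).

Lemma ecdf_upper s x e : stieltjes_cvg t0 r s -> 0 < e ->
  \forall n \near \oo, ecdf (s n) x <= limit_cdf x + e.
Proof.
move=> gs e0; have [sp sn _] := gs; have [x0|x0] := ltP x 0.
  near=> n; have -> : ecdf (s n) x = 0; last by rewrite limit_cdf_neg // add0r ltW.
  transitivity (mean (s n) (fun l => 0 * l)); last by rewrite meanZ mul0r.
  apply: eq_mean => // l l0; rewrite mul0r; case: leP => // lx.
  by have := le_lt_trans (le_trans l0 lx) x0; rewrite ltxx.
have [a [c [a0 ac cu h]]] := limit_cdf_approx x0 e0.
have c1 : c <= 1.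
  by have /andP[_ ?] := uvar_bounds t0_gt0 x0; rewrite ltW // (lt_le_trans cu).
have hc := ramp_lim_cvg gs a0 ac c1.
have d0 : 0 < limit_cdf x + e - ramp_lim a c by rewrite subr_gt0.
move/cvgrPdist_le : hc => /(_ _ d0) hc; near=> n.
have hn : `|ramp_lim a c - mean (s n) (fun x => ramp a c (u x))| <= limit_cdf x + e - ramp_lim a c.
  by near: n; exact: hc.
have : ecdf (s n) x <= mean (s n) (fun x => ramp a c (u x)).
  apply: le_mean => // l l0; case: (leP l x) => lx; last by case/andP: (ramp_bounds (u l) ac).
  by rewrite ramp_right // ltW // (lt_le_trans cu) // uvar_le.
by move: hn; rewrite ler_norml => /andP[hn _] ?; lra.
Unshelve. all: by end_near. Qed.

Lemma ecdf_lower s x y e : stieltjes_cvg t0 r s -> y < x -> 0 < e ->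
  \forall n \near \oo, limit_cdf y - e <= ecdf (s n) x.
Proof.
move=> gs yx e0; have [sp sn _] := gs; have [y0|y0] := ltP y 0.
  near=> n; rewrite limit_cdf_neg // sub0r; apply: le_trans (_ : 0 <= _); first by lra.
  by rewrite mulr_ge0 ?invr_ge0 // sumr_ge0.
have x0 : 0 <= x by rewrite ltW // (le_lt_trans y0).
have /andP[ux0 _] := uvar_bounds t0_gt0 x0; have /andP[_ uy1] := uvar_bounds t0_gt0 y0.
have uxy := uvar_ltW y0 yx.
(* This ramp vanishes for [l >= x] and equals 1 for [l <= y], so it lies below the indicator of
   [l <= x], and [c < u y] admits it in the infimum at [y]. *)
pose a := u x; pose c := (u x + u y) / 2.
have ac : a < c by rewrite /a /c; lra.
have cu : c < u y by rewrite /c; lra.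
have c1 : c <= 1 by rewrite ltW // (lt_le_trans cu).
have hc := ramp_lim_cvg gs (ltW ux0) ac c1.
have hy := limit_cdf_le y0 (ltW ux0) ac cu.
move/cvgrPdist_le : hc => /(_ _ e0) hc; near=> n.
have hn : `|ramp_lim a c - mean (s n) (fun x => ramp a c (u x))| <= e.
  by near: n; exact: hc.
have : mean (s n) (fun x => ramp a c (u x)) <= ecdf (s n) x.
  apply: le_mean => // l l0; case: (leP l x) => lx; first by case/andP: (ramp_bounds (u l) ac).
  by rewrite ramp_left // uvar_le // ltW.
by move: hn hy; rewrite ler_norml -/a => /andP[_ hn] ? ?; lra.
Unshelve. all: by end_near. Qed.

Lemma ecdf_cvg s x : stieltjes_cvg t0 r s -> {for x, continuous limit_cdf} ->
  ecdf (s n) x @[n --> \oo] --> limit_cdf x.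
Proof.
move=> gs /cvgrPdist_le cx; apply/cvgrPdist_le => e e0.
have e2 : 0 < e / 2 by rewrite divr_gt0.
have [y yx hy] : exists2 y, y < x & `|limit_cdf x - limit_cdf y| <= e / 2.
  have h : \forall y \near x^'-, `|limit_cdf x - limit_cdf y| <= e / 2.
    exact: (cvg_within _ (cx _ e2)).
  have /filter_ex[y []] : \forall y \near x^'-, y < x /\ `|limit_cdf x - limit_cdf y| <= e / 2.
    near=> y; split; near: y; [exact: nbhs_left_lt|exact: h].
  by exists y.
have hu := ecdf_upper x gs e0; have hl := ecdf_lower gs yx e2.
near=> n.
have h1 : ecdf (s n) x <= limit_cdf x + e by near: n; exact: hu.
have h2 : limit_cdf y - e / 2 <= ecdf (s n) x by near: n; exact: hl.
move: hy; rewrite !ler_norml => /andP[_ hy]; apply/andP; split; lra.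
Unshelve. all: by end_near. Qed.

End LimitCdf.

(** * The transform of the limit measure *)

Section CountBelow.
Variable R : realType.

(* A staircase approximation of [v], through which an integral is computed from a distribution
   function. *)
Definition count_below (K : nat) (v : R) : R := \sum_(j < K) (j.+1%:R <= v)%R%:R.

Lemma count_below_le K v : 0 <= v -> count_below K v <= v.
Proof.
move=> v0; elim: K => [|K IH]; first by rewrite /count_below big_ord0.
rewrite /count_below big_ord_recr /=; have [Kv|_] := leP K.+1%:R v; last by rewrite addr0.
apply: le_trans Kv; rewrite -[K.+1%:R]natr1 lerD2r.
apply: (@le_trans _ _ (\sum_(j < K) 1)); last by rewrite sumr_const card_ord.
by apply: ler_sum => j _; rewrite lern1; case: leP.
Qed.

Lemma count_below_ge K v : v <= K%:R -> v <= count_below K v + 1.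
Proof.
elim: K => [|K IH] vK; first by rewrite /count_below big_ord0 (le_trans vK) // add0r.
rewrite /count_below big_ord_recr /=.
have [vK'|Kv] := leP v K%:R.
  by rewrite (le_trans (IH vK')) // lerD2r lerDl.
have -> : \sum_(i < K) (i.+1%:R <= v)%R%:R = K%:R :> R.
  transitivity (\sum_(i < K) (1 : R)); last by rewrite sumr_const card_ord.
  apply: eq_bigr => i _; rewrite (le_trans _ (ltW Kv)) // ler_nat.
  exact: ltn_ord.
by rewrite (le_trans vK) // -[K.+1%:R]natr1 lerD2r lerDl.
Qed.

Lemma near_sum_le (I : Type) (s : seq I) (a : I -> nat -> R) (b : I -> R) :
  (forall i, \forall n \near \oo, a i n <= b i) ->
  \forall n \near \oo, \sum_(i <- s) a i n <= \sum_(i <- s) b i.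
Proof.
move=> H; elim: s => [|i s IH].
  by near=> n; rewrite !big_nil.
have h := H i; near=> n; rewrite !big_cons; apply: lerD; near: n; [exact: h|exact: IH].
Unshelve. all: by end_near. Qed.

End CountBelow.

Section Moments.
Variables (R : realType) (t0 : R) (r : R -> R).
Hypothesis t0_gt0 : 0 < t0.
Variable s0 : nat -> seq R.
Hypothesis s0_cvg : stieltjes_cvg t0 r s0.
Hypothesis r_cvg1 : r @ +oo --> (1 : R).
Local Notation F := (limit_cdf t0 s0).
Variable mu : probability (measurableTypeR R) R.
Hypothesis mu_cdf : forall x, mu `]-oo, x]%classic = (F x)%:E.

Lemma mu_neg : mu `]-oo, 0[%classic = 0%E.
Proof.
have E : `]-oo, (0:R)[%classic = \bigcup_k (`]-oo, (- k.+1%:R^-1 : R)]%classic).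
  apply/seteqP; split => [x|x [k _]] /=; rewrite !in_itv /= => x0.
    have [k hk] := @ltr_add_invr R 0 (- x) ltac:(by rewrite oppr_gt0).
    by exists k => //=; rewrite in_itv /=; move: hk; rewrite add0r => /ltW; rewrite lerNr.
  by apply: le_lt_trans x0 _; rewrite oppr_lt0 invr_gt0.
have neg : mu.-negligible `]-oo, (0:R)[%classic.
  rewrite E; apply: negligible_bigcup => k; apply/negligibleP => //.
  by apply: etrans (mu_cdf _) _; rewrite limit_cdf_neg // oppr_lt0 invr_gt0.
by apply/negligibleP.
Qed.

Lemma mu_abs_le (z : R) : 0 <= z ->
  \int[mu]_x ((`|x| <= z)%R%:R : R) = F z.
Proof.
move=> z0.
have -> : (fun x : R => (`|x| <= z)%R%:R : R) = \1_(`[- z, z]%classic).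
  by apply/funext => x; rewrite indicE mem_setE in_itv /= ler_norml.
rewrite /Rintegral integral_indic // setIT.
have h : (mu `]-oo, z]%classic = mu `]-oo, (- z)%R[%classic + mu `[(- z)%R, z]%classic)%E.
  rewrite -measureU //.
    congr (mu _); apply/seteqP; split => [x|x [|]] /=; rewrite !in_itv /=.
    - by move=> xz; case: (ltP x (- z)) => h; [left|right; apply/andP; split].
    - by move=> xz; rewrite (le_trans (ltW xz)) // (le_trans _ z0) // oppr_le0.
    - by case/andP.
  apply/seteqP; split => // x [] /=; rewrite !in_itv /= => xz /andP[zx _].
  by have := lt_le_trans xz zx; rewrite ltxx.
have z1 : mu `]-oo, (- z)%R[%classic = 0%E.
  apply/eqP; rewrite eq_le measure_ge0 andbT -mu_neg; apply: le_measure; rewrite ?inE //.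
  by move=> x /=; rewrite !in_itv /= => xz; rewrite (lt_le_trans xz) // oppr_le0.
by move: h; rewrite mu_cdf z1 add0e => h; exact: (congr1 fine (esym h)).
Qed.

(** The absolute value keeps the denominator positive on the whole line; [mu] does not see it, by
    [mu_neg]. *)
Let f (t x : R) : R := t / (`|x| + t).

Let f_ge0 t x : 0 < t -> 0 <= f t x.
Proof. by move=> tp; rewrite divr_ge0 // ?addr_ge0 // ltW. Qed.

Let f_le1 t x : 0 < t -> f t x <= 1.
Proof. by move=> tp; rewrite ler_pdivrMr ?ltr_wpDl // mul1r lerDr. Qed.

Let mf t : 0 < t -> measurable_fun setT (f t).
Proof.
move=> tp; have -> : f t = fun x => t * expR (- ln (`|x| + t)).
  apply/funext => x; rewrite /f expRN lnK // posrE; exact: ltr_wpDl.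
apply: measurable_funM => //; apply: measurableT_comp => //; apply: measurableT_comp => //.
apply: measurableT_comp; first exact: measurable_ln.
by apply: measurable_funD => //; exact: measurableT_comp.
Qed.

(** Layer cake with [M] levels: the superlevel sets of [f t] are the intervals [|x| <= z j], whose
    masses under [mu] and under the empirical measures are compared through [limit_cdf]. After
    multiplication by [M] the errors add up to at most 3. *)
Lemma stieltjes_mu t : t0 <= t -> \int[mu]_x f t x = r t.
Proof.
move=> tt0; have tp : 0 < t by apply: lt_le_trans tt0.
have [sp sn /(_ t tt0) hr] := s0_cvg.
suff H K : `|r t - \int[mu]_x f t x| <= 3 / K.+1%:R.
  apply/esym/eqP; rewrite -subr_eq0 -normr_le0; apply/ler_addgt0Pl => e e0.
  have [k hk] := @ltr_add_invr R 0 (e / 3) ltac:(by rewrite divr_gt0).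
  apply: le_trans (H k) _; rewrite addr0.
  by move: hk; rewrite add0r => /ltW; rewrite ler_pdivlMr // mulrC.
set M := K.+1; pose z j := t * M%:R / j.+1%:R - t.
have M0 : 0 < M%:R :> R by rewrite ltr0n.
have cntE x j : (j.+1%:R <= M%:R * f t x) = (`|x| <= z j).
  have xt : 0 < `|x| + t by rewrite ltr_wpDl.
  rewrite /f /z mulrA ler_pdivlMr // lerBrDr ler_pdivlMr ?ltr0n // mulrC.
  by rewrite [_ * t]mulrC.
have z_ge0 (j : 'I_M) : 0 <= z j.
  rewrite /z subr_ge0 ler_pdivlMr ?ltr0n // ler_wpM2l ?(ltW tp) // ler_nat.
  exact: ltn_ord.
pose S (x : R) := \sum_(j < M) (`|x| <= z j)%R%:R : R.
have S_lo x : S x <= M%:R * f t x.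
  have := count_below_le M (mulr_ge0 (ltW M0) (f_ge0 x tp)).
  by rewrite /count_below; under eq_bigr do rewrite cntE.
have S_hi x : M%:R * f t x <= S x + 1.
  have : M%:R * f t x <= M%:R by rewrite ler_piMr ?(ltW M0) // f_le1.
  by move=> /count_below_ge; rewrite /count_below; under eq_bigr do rewrite cntE.
have mS j : measurable_fun setT (fun x : measurableTypeR R => (`|x| <= z j)%R%:R : R).
  rewrite (_ : (fun x => _) = \1_(`[- z j, z j]%classic)); first exact: measurable_indic.
  by apply/funext => x; rewrite indicE mem_setE in_itv /= ler_norml.
have bS j : bmeas (fun x : measurableTypeR R => (`|x| <= z j)%R%:R : R).
  by split => //; exists 1 => x; rewrite ger0_norm // lern1 leq_b1.
have bf : bmeas (f t : measurableTypeR R -> R).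
  by split; [exact: mf|exists 1 => x; rewrite ger0_norm ?f_ge0 ?f_le1].
have bSS : bmeas (S : measurableTypeR R -> R) by exact: bmeas_sum.
have IS : \int[mu]_x S x = \sum_(j < M) F (z j).
  rewrite Rintegral_sum => [|j]; last exact: bmeas_integrable.
  by apply: eq_bigr => j _; exact: mu_abs_le.
have I_lo : \sum_(j < M) F (z j) <= M%:R * \int[mu]_x f t x.
  rewrite -IS -RintegralZ; last exact: bmeas_integrable.
  by apply: le_Rintegral_all => //; apply: bmeas_integrable => //; exact: bmeasZ.
have I_hi : M%:R * \int[mu]_x f t x <= \sum_(j < M) F (z j) + 1.
  rewrite -IS -RintegralZ; last exact: bmeas_integrable.
  rewrite -[X in _ <= _ + X](Rintegral_prob_cst mu).
  rewrite -RintegralD //; try by apply: bmeas_integrable => //; exact: bmeas_cst.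
  apply: le_Rintegral_all => //; apply: bmeas_integrable; first exact: bmeasZ.
  by apply: bmeasD => //; exact: bmeas_cst.
have E1 n : mean (s0 n) (fun l => M%:R * f t l) = M%:R * mean (s0 n) (fun x => t / (x + t)).
  by rewrite meanZ; congr (_ * _); apply: eq_mean => // l l0; rewrite /f ger0_norm.
have ES n : mean (s0 n) S = \sum_(j < M) ecdf (s0 n) (z j).
  rewrite mean_sum; apply: eq_bigr => j _; apply: eq_mean => // l l0.
  by rewrite ger0_norm.
(* With this tolerance the [M] levels cost at most 1 in total. *)
pose e := M%:R^-1 : R; have e0 : 0 < e by rewrite invr_gt0.
have Mr : M%:R * mean (s0 n) (fun x => t / (x + t)) @[n --> \oo] --> M%:R * r t.
  exact: cvgMr.
have R_hi : M%:R * r t <= \sum_(j < M) F (z j) + 2.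
  apply: (seq_lim_le Mr).
  have hS := near_sum_le (index_enum 'I_M) (fun j => ecdf_upper t0_gt0 s0_cvg (z j) s0_cvg e0).
  near=> n; rewrite -E1.
  have n0 : (0 < size (s0 n))%N by near: n; exact: sn.
  apply: le_trans (le_mean (sp n) (fun l _ => S_hi l)) _.
  rewrite meanD mean_cst // ES.
  have : \sum_(j < M) ecdf (s0 n) (z j) <= \sum_(j < M) (F (z j) + e) by near: n; exact: hS.
  rewrite big_split /= sumr_const card_ord -[e *+ M]mulr_natl mulfV ?gt_eqF //; lra.
have R_lo : \sum_(j < M) F (z j) - 2 <= M%:R * r t.
  apply: (seq_lim_ge Mr).
  (* [ecdf_lower] compares [ecdf] at [z j] with [limit_cdf] at a strictly smaller point, for which
     [z j.+1] is taken; the shift by one level loses a single term, at most 1. *)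
  have zlt j : z j.+1 < z j.
    by rewrite ltrD2r ltr_pM2l ?mulr_gt0 // ltf_pV2 ?posrE // ltr_nat.
  have hS : \forall n \near \oo,
      \sum_(j < K) - ecdf (s0 n) (z j) <= \sum_(j < K) - (F (z j.+1) - e).
    apply: near_sum_le => j.
    by apply: filterS (ecdf_lower t0_gt0 s0_cvg s0_cvg (zlt j) e0) => n; rewrite lerN2.
  near=> n; rewrite -E1.
  apply: le_trans (le_mean (sp n) (fun l _ => S_lo l)).
  rewrite ES [leRHS]big_ord_recr /=.
  have ec0 : 0 <= ecdf (s0 n) (z K) by rewrite mulr_ge0 ?invr_ge0 // sumr_ge0.
  have : \sum_(j < K) - ecdf (s0 n) (z j) <= \sum_(j < K) - (F (z j.+1) - e) by near: n; exact: hS.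
  rewrite !sumrN lerN2 sumrB sumr_const card_ord -[e *+ K]mulr_natl.
  have -> : \sum_(j < M) F (z j) = F (z 0) + \sum_(j < K) F (z j.+1) by rewrite big_ord_recl.
  have : K%:R * e <= 1 by rewrite ler_pdivrMr // mul1r ler_nat.
  by have := limit_cdf_le1 t0_gt0 s0_cvg (z 0); lra.
have : `|M%:R * (r t - \int[mu]_x f t x)| <= 3.
  by rewrite mulrBr ler_norml; apply/andP; split; move: I_lo I_hi R_lo R_hi; lra.
by rewrite normrM ger0_norm ?(ltW M0) // ler_pdivlMr // mulrC.
Unshelve. all: by end_near. Qed.

End Moments.

(** * Moments from the expansion of the transform at infinity *)

Section MomentExpansion.
Variables (R : realType) (mu : probability (measurableTypeR R) R) (r : R -> R) (t0 : R).
Hypothesis t0_gt0 : 0 < t0.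
Let f (t x : R) : R := t / (`|x| + t).
Hypothesis stieltjes : forall t, t0 <= t -> \int[mu]_x f t x = r t.
Variable a : nat -> R.
Hypothesis a0 : a 0%N = 1.
Hypothesis expansion : forall K, exists D, exists2 t1, t0 <= t1 & forall t, t1 <= t ->
  `|r t - \sum_(k < K) (- t^-1) ^+ k * a k| <= D * t^-1 ^+ K.

Let f_ge0 t x : 0 < t -> 0 <= f t x.
Proof. by move=> tp; rewrite divr_ge0 // ?addr_ge0 // ltW. Qed.

Let f_le1 t x : 0 < t -> f t x <= 1.
Proof. by move=> tp; rewrite ler_pdivrMr ?ltr_wpDl // mul1r lerDr. Qed.

Let mf t : 0 < t -> measurable_fun setT (f t).
Proof.
move=> tp; have -> : f t = fun x => t * expR (- ln (`|x| + t)).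
  apply/funext => x; rewrite /f expRN lnK // posrE; exact: ltr_wpDl.
apply: measurable_funM => //; apply: measurableT_comp => //; apply: measurableT_comp => //.
apply: measurableT_comp; first exact: measurable_ln.
by apply: measurable_funD => //; exact: measurableT_comp.
Qed.

Let mabs k : measurable_fun setT (fun x : measurableTypeR R => `|x| ^+ k).
Proof. by apply: measurable_funX; exact: normr_measurable. Qed.

Let geometric (t y : R) k : 0 < t -> 0 <= y ->
  t / (y + t) - \sum_(j < k) (- t^-1) ^+ j * y ^+ j = (- t^-1) ^+ k * (y ^+ k * (t / (y + t))).
Proof.
move=> tp y0; have yt : 0 < y + t by apply: ltr_wpDl.
elim: k => [|k IH]; first by rewrite !expr0 big_ord0 subr0 !mul1r.
rewrite big_ord_recr /= opprD addrA IH !exprS.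
have -> : (- t^-1) ^+ k * (y ^+ k * (t / (y + t))) - (- t^-1) ^+ k * y ^+ k =
  (- t^-1) ^+ k * y ^+ k * (t / (y + t) - 1) by ring.
have -> : t / (y + t) - 1 = - t^-1 * (y * (t / (y + t))).
  by field; rewrite !gt_eqF.
by ring.
Qed.

Let powK (t : R) j : 0 < t -> (- t) ^+ j * (- t^-1) ^+ j = 1.
Proof. by move=> tp; rewrite -exprMn mulrNN mulfV ?gt_eqF // expr1n. Qed.

(** Induction on the order: once the moments below [m] are known, the geometric expansion turns the
    integral of [|x|^m t / (|x| + t)] into a remainder of the transform, which tends to [a m]. The
    kernel increases to 1 with [t], so monotone convergence yields both integrability and the
    value. *)
Lemma moments k : mu.-integrable setT (EFin \o (fun x : measurableTypeR R => `|x| ^+ k)) /\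
  \int[mu]_x `|x| ^+ k = a k.
Proof.
elim/ltn_ind: k => -[|k] IH.
  under [X in EFin \o X]eq_fun do rewrite expr0.
  under eq_Rintegral do rewrite expr0.
  by split; [exact: finite_measure_integrable_cst|rewrite Rintegral_prob_cst a0].
set m := k.+1 in IH *.
pose h (t : R) (x : measurableTypeR R) : R := `|x| ^+ m * f t x.
have [D [t1 t01 Dt]] := expansion m.+1.
have t1_gt0 : 0 < t1 by apply: lt_le_trans t01.
have h_ge0 t x : 0 < t -> 0 <= h t x by move=> tp; rewrite mulr_ge0 ?exprn_ge0 ?f_ge0.
have mh t : 0 < t -> measurable_fun setT (h t).
  by move=> tp; apply: measurable_funM; [exact: mabs|exact: mf].
have ih t : 0 < t -> mu.-integrable setT (EFin \o h t).
  move=> tp; have [ik _] := IH k (ltnSn k).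
  apply: (integrable_sub (integrableZl measurableT t ik) (mh t tp)) => x.
  rewrite ger0_norm ?h_ge0 //.
  have xt : 0 < `|x| + t by apply: ltr_wpDl.
  have -> : h t x = `|x| * (t / (`|x| + t)) * `|x| ^+ k by rewrite /h /m /f exprS; ring.
  apply: ler_wpM2r; first exact: exprn_ge0.
  by rewrite mulrA ler_pdivrMr // [leLHS]mulrC ler_wpM2l ?(ltW tp) // lerDl ltW.
have int_h t : t1 <= t -> \int[mu]_x h t x = (- t) ^+ m * (r t - \sum_(j < m) (- t^-1) ^+ j * a j).
  move=> tt1; have tp : 0 < t by apply: lt_le_trans tt1.
  have bf : mu.-integrable setT (EFin \o (f t : measurableTypeR R -> R)).
    apply: bmeas_integrable; split; first exact: mf.
    by exists 1 => x; rewrite ger0_norm ?f_ge0 ?f_le1.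
  have ipow j : (j < m)%N -> mu.-integrable setT
      (EFin \o (fun x : measurableTypeR R => (- t^-1) ^+ j * `|x| ^+ j)).
    by move=> /IH[ij _]; exact: (integrableZl measurableT _ ij).
  have isum : mu.-integrable setT
      (EFin \o (fun x : measurableTypeR R => \sum_(j < m) (- t^-1) ^+ j * `|x| ^+ j)).
    by apply: integrable_sumR => j; exact: ipow.
  rewrite -(stieltjes (le_trans t01 tt1)).
  have -> : \sum_(j < m) (- t^-1) ^+ j * a j =
      \int[mu]_x (\sum_(j < m) (- t^-1) ^+ j * `|x| ^+ j).
    rewrite Rintegral_sum => [|j]; last exact: ipow.
    apply: eq_bigr => j _; have [ij aj] := IH j (ltn_ord j).
    by rewrite RintegralZ // aj.
  rewrite -(RintegralB measurableT bf isum) -RintegralZ; last first.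
    exact: (integrableB measurableT bf isum).
  apply: eq_Rintegral => x _; rewrite /h /f geometric // [RHS]mulrA powK // mul1r; by [].
have h_close : forall t : R, t1 <= t -> `|\int[mu]_x h t x - a m| <= D / t.
  move=> t tt1; have tp : 0 < t by apply: lt_le_trans tt1.
  have := Dt t tt1; rewrite int_h // big_ord_recr /= opprD addrA.
  set q := r t - _ => hq.
  have -> : (- t) ^+ m * q - a m = (- t) ^+ m * (q - (- t^-1) ^+ m * a m).
    by rewrite [RHS]mulrBr [X in _ = _ - X]mulrA powK // mul1r.
  rewrite normrM normrX normrN (gtr0_norm tp) -ler_pdivlMl ?exprn_gt0 //.
  apply: le_trans hq _; rewrite exprS le_eqVlt; apply/orP; left; apply/eqP.
  by rewrite exprVn mulrA mulrC.
have hcvg : ((\int[mu]_x (h (t1 + n%:R) x)%:E) @[n --> \oo] --> (a m)%:E)%E.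
  have -> : (fun n => \int[mu]_x (h (t1 + n%:R)%R x)%:E)%E =
      (fun n => (\int[mu]_x h (t1 + n%:R) x)%:E).
    apply/funext => n; rewrite fineK //; apply: (integrable_fin_num _ (ih _ _)) => //.
    by rewrite ltr_pwDl.
  apply: cvg_EFin; first by near=> n.
  apply/cvgrPdist_le => e e0; near=> n.
  rewrite distrC; apply: le_trans (h_close _ _) _; first by rewrite lerDl.
  rewrite ler_pdivrMr ?ltr_pwDl // -ler_pdivrMl //.
  apply: (@le_trans _ _ n%:R); last by rewrite lerDr ltW.
  by near: n; exact: nbhs_infty_ger.
have hmono : ((\int[mu]_x (h (t1 + n%:R) x)%:E) @[n --> \oo] -->
    \int[mu]_x (`|x| ^+ m)%:E)%E.
  have tn n : 0 < t1 + n%:R by rewrite ltr_pwDl.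
  have xtn n (x : R) : 0 < `|x| + (t1 + n%:R) by apply: ltr_wpDl.
  rewrite (_ : (\int[mu]_x _)%E = \int[mu]_x (limn (fun n => (h (t1 + n%:R) x)%:E)))%E; last first.
    apply: eq_integral => x _; apply/esym/cvg_lim => //.
    apply: cvg_EFin; first by near=> n.
    rewrite -[X in _ --> X]mulr1; apply: cvgMr.
    apply/cvgrPdist_le => e e0; near=> n.
    have -> : 1 - f (t1 + n%:R) x = `|x| / (`|x| + (t1 + n%:R)).
      by rewrite /f; have := xtn n x => xt; field; rewrite gt_eqF.
    rewrite ger0_norm ?divr_ge0 ?(ltW (xtn n x)) // ler_pdivrMr // -ler_pdivrMl //.
    apply: (@le_trans _ _ n%:R); last by rewrite addrA lerDr addr_ge0 // ltW.
    by near: n; exact: nbhs_infty_ger.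
  apply: cvg_monotone_convergence => //.
  - by move=> n; apply/measurable_EFinP; exact: mh.
  - by move=> n x _; rewrite lee_fin h_ge0.
  - move=> x _ n p np; rewrite lee_fin /h ler_wpM2l ?exprn_ge0 //.
    rewrite /f ler_pdivrMr // mulrAC ler_pdivlMr //.
    have np' : n%:R <= p%:R :> R by rewrite ler_nat.
    have := ler_wpM2r (normr_ge0 x) (lerD (lexx t1) np').
    by move: (t1 + n%:R) (t1 + p%:R) `|x| => b c y bc; lra.
have E : (\int[mu]_x (`|x| ^+ m)%:E = (a m)%:E)%E by exact: cvg_unique hmono hcvg.
split; last by rewrite /Rintegral E.
apply/integrableP; split; first by apply/measurable_EFinP; exact: (mabs m).
under eq_integral do rewrite /= ger0_norm ?exprn_ge0 //.
by rewrite E ltry.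
Unshelve. all: by end_near. Qed.

End MomentExpansion.

(** [mu] is built from the single sequence [s0], yet attracts every sequence with the same [r]; this
    is what makes the almost sure limit deterministic. *)
Theorem stieltjes_moment_limit (R : realType) (t0 : R) (r : R -> R) (s0 : nat -> seq R)
    (a : nat -> R) : 0 < t0 -> stieltjes_cvg t0 r s0 -> a 0%N = 1 ->
  (forall K, exists D, exists2 t1, t0 <= t1 & forall t, t1 <= t ->
    `|r t - \sum_(k < K) (- t^-1) ^+ k * a k| <= D * t^-1 ^+ K) ->
  exists mu : probability (measurableTypeR R) R,
    (forall s, stieltjes_cvg t0 r s -> weak_cvg (fun n => ecdf (s n)) mu) /\
    forall k, (\int[mu]_x (x ^+ k)%:E = (a k)%:E)%E.
Proof.
move=> t0_gt0 s0_cvg a0 expansion.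
have r1 : r @ +oo --> (1 : R).
  have [D [t1 t01 Dt]] := expansion 1%N.
  apply/cvgrPdist_le => e e0; near=> t.
  have tt1 : t1 <= t by near: t; apply: nbhs_pinfty_ge; exact: num_real.
  have tp : 0 < t by apply: lt_le_trans (lt_le_trans t0_gt0 t01) tt1.
  have te : e^-1 * D <= t by near: t; apply: nbhs_pinfty_ge; exact: num_real.
  have := Dt t tt1; rewrite big_ord1 expr0 mul1r a0 expr1 distrC => h.
  apply: le_trans h _; rewrite ler_pdivrMr // -ler_pdivrMl //.
have [mu mu_cdf] := cdf_measure_exists (limit_cdf_nd t0_gt0 s0_cvg)
  (limit_cdf_rc t0_gt0 s0_cvg) (limit_cdf_Ny t0 s0) (limit_cdf_y t0_gt0 s0_cvg r1).
have dE : distr_fun mu = limit_cdf t0 s0.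
  by apply/funext => x; rewrite /distr_fun mu_cdf.
exists mu; split => [s gs x|k].
  by rewrite dE => cx; exact: (ecdf_cvg t0_gt0 s0_cvg gs cx).
have [ik Ek] := moments t0_gt0 (stieltjes_mu t0_gt0 s0_cvg mu_cdf) a0 expansion k.
have mx j : measurable_fun setT (fun x : measurableTypeR R => x ^+ j) by exact: measurable_funX.
rewrite -Ek fineK; last exact: integrable_fin_num ik.
(* [x ^+ k] and its version with absolute value differ only on the negative half-line, which is
   [mu]-null. *)
apply: ae_eq_integral => //; [exact/measurable_EFinP|
  by apply/measurable_EFinP; apply: measurable_funX; exact: normr_measurable|].
exists `]-oo, (0:R)[%classic; split => //; first exact: mu_neg mu_cdf.
move=> x /= /not_implyP[_ h]; rewrite in_itv /= ltNge; apply/negP => x0; apply: h.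
by rewrite ger0_norm.
Unshelve. all: by end_near. Qed.

(** * Almost sure convergence from fourth moments *)

Section FourthMoment.
Context d (Omega : measurableType d) (R : realType) (P : probability Omega R).

(** Telescoping: [1 / (k+2)^2 <= 1 / (k+1) - 1 / (k+2)]. *)
Lemma sum_inv_sqr_le (n : nat) : \sum_(0 <= k < n) (k.+2%:R ^+ 2)^-1 <= 1 - n.+1%:R^-1 :> R.
Proof.
elim: n => [|n IH]; first by rewrite big_geq // invr1 subrr.
rewrite big_nat_recr //=; apply: le_trans (lerD IH (lexx _)) _.
have n0 : 0 < n.+1%:R :> R by rewrite ltr0n.
have -> : n.+2%:R = n.+1%:R + 1 :> R by rewrite -natr1.
move: (n.+1%:R) n0 => x x0.
have -> : 1 - (x + 1)^-1 = 1 - x^-1 + (x * (x + 1))^-1.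
  by field; rewrite !gt_eqF // addr_gt0.
rewrite lerD2l lef_pV2 ?posrE ?exprn_gt0 ?mulr_gt0 ?addr_gt0 //; nra.
Qed.

(** The sum of the series has integral at most [D], so it is finite almost everywhere and its terms
    tend to zero. *)
Lemma ae_cvg0_series (f : nat -> Omega -> R) (b : nat -> R) (D : R) :
  (forall n, measurable_fun setT (f n)) -> (forall n w, 0 <= f n w) ->
  (forall n, (\int[P]_w (f n w)%:E <= (b n)%:E)%E) ->
  (forall n, \sum_(0 <= k < n) b k <= D) ->
  {ae P, forall w, f n w @[n --> \oo] --> 0}.
Proof.
move=> mf f0 fb bD.
pose F w := (\sum_(0 <= k <oo) (f k w)%:E)%E.
have mF : measurable_fun setT F.
  apply: (@ge0_emeasurable_sum _ _ _ _ (fun k w => (f k w)%:E) xpredT) => [k w _ _|k _].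
    by rewrite lee_fin.
  exact/measurable_EFinP.
have F0 w : (0 <= F w)%E by apply: nneseries_ge0 => k _ _; rewrite lee_fin.
have iF : P.-integrable setT F.
  apply/integrableP; split => //; under eq_integral do rewrite gee0_abs //.
  rewrite integral_nneseries //; last 2 first.
  - by move=> k; apply/measurable_EFinP.
  - by move=> k w _; rewrite lee_fin.
  apply: (@le_lt_trans _ _ D%:E); last by rewrite ltry.
  apply: lime_le; first by apply: is_cvg_nneseries => k _ _; apply: integral_ge0 => w _; rewrite lee_fin.
  apply: nearW => n; apply: (@le_trans _ _ (\sum_(0 <= k < n) (b k)%:E)%E); first exact: lee_sum.
  by rewrite sumEFin lee_fin.
apply: filterS (integrable_ae measurableT iF) => w /(_ I) Ffin.
apply: cvg_series_cvg_0; apply: nondecreasing_is_cvgn.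
  apply/nondecreasing_seqP => n; rewrite -subr_ge0 seriesSB //.
exists (fine (F w)) => _ [n _ <-].
rewrite -lee_fin fineK // -sumEFin; apply: nneseries_lim_ge => k _ _; by rewrite lee_fin.
Qed.

(** The martingale bound on the variance of a normalized trace is only of order [1/n], which is not
    summable; the bound on the fourth moment is of order [1/n^2]. *)
Lemma ae_cvg0_moment4 (Y : nat -> Omega -> R) (D : R) :
  (forall n, measurable_fun setT (Y n)) ->
  (\forall n \near \oo, (\int[P]_w (Y n w ^+ 4)%:E <= (D / n%:R ^+ 2)%:E)%E) ->
  {ae P, forall w, Y n w @[n --> \oo] --> 0}.
Proof.
move=> mY [N _ YD].
(* The shift skips the finitely many indices where the bound may fail; its last two units match
   [sum_inv_sqr_le]. *)
pose f k w := Y (k + N.+2)%N w ^+ 4.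
have : {ae P, forall w, f n w @[n --> \oo] --> 0}.
  apply: (@ae_cvg0_series f (fun k => `|D| * (k.+2%:R ^+ 2)^-1) `|D|).
  - by move=> k; apply: measurable_funX.
  - by move=> k w; rewrite exprn_even_ge0.
  - move=> k; apply: le_trans (YD _ _) _; first by rewrite /=; lia.
    rewrite lee_fin; apply: le_trans (_ : `|D| * ((k + N.+2)%:R ^+ 2)^-1 <= _).
      by apply: ler_wpM2r; rewrite ?invr_ge0 ?exprn_ge0 ?ler_norm.
    apply: ler_wpM2l; first exact: normr_ge0.
    rewrite lef_pV2 ?posrE ?exprn_gt0 ?ltr0n ?addnS // ler_pXn2r ?nnegrE ?ler0n //.
    by rewrite ler_nat; lia.
  - move=> n; rewrite -mulr_sumr; apply: ler_piMr; first exact: normr_ge0.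
    apply: le_trans (sum_inv_sqr_le n) _.
    by rewrite lerBlDr lerDl invr_ge0 ler0n.
apply: filterS => w fw; rewrite -(cvg_shiftn N.+2).
apply/cvgr0Pnorm_lt => e e0.
have e4 : 0 < e ^+ 4 by rewrite exprn_gt0.
move/cvgr0Pnorm_lt : fw => /(_ _ e4); apply: filterS => k.
by rewrite /f normrX ltr_pXn2r ?nnegrE ?(ltW e0).
Qed.

End FourthMoment.

Local Open Scope sesquilinear_scope.

(** * Resolvents of Gram matrices *)

Section Resolvent.
Variable C : numClosedFieldType.
Implicit Types (m n : nat) (t : C).

(** The resolvent of the Gram matrix at [-t]: for [t > 0] the inverted matrix is positive
    definite. *)
Definition resolvent m n t (A : 'M[C]_(m, n)) : 'M[C]_n :=
  invmx (A^t* *m A + t%:M).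

Definition sqnorm n (v : 'cV[C]_n) : C := \sum_i `|v i 0| ^+ 2.

Lemma sqnormE n (v : 'cV[C]_n) : (v^t* *m v) 0 0 = sqnorm v.
Proof. by rewrite mxE; apply: eq_bigr => i _; rewrite !mxE normCKC. Qed.

Lemma sqnorm_ge0 n (v : 'cV[C]_n) : 0 <= sqnorm v.
Proof. by apply: sumr_ge0 => i _; rewrite exprn_ge0. Qed.

Lemma trmxC_mul m n p (A : 'M[C]_(m, n)) (B : 'M[C]_(n, p)) :
  (A *m B)^t* = B^t* *m A^t*.
Proof. by rewrite trmx_mul map_mxM. Qed.

Lemma quad_form m n t (A : 'M[C]_(m, n)) (u : 'cV[C]_n) :
  (u^t* *m (A^t* *m A + t%:M) *m u) 0 0 = sqnorm (A *m u) + t * sqnorm u.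
Proof.
rewrite mulmxDr mulmxDl mxE -!sqnormE trmxC_mul !mulmxA; congr (_ + _).
by rewrite mul_mx_scalar -scalemxAl mxE.
Qed.

Section Positive.
Variables (m n : nat) (t : C) (A : 'M[C]_(m, n)).
Hypothesis t_gt0 : 0 < t.

Lemma gram_unit : A^t* *m A + t%:M \in unitmx.
Proof.
rewrite -unitmx_tr -row_free_unit -kermx_eq0; apply/rowV0P => v /sub_kermxP.
move=> /(congr1 trmx); rewrite trmx_mul trmxK trmx0 => vG.
have := quad_form t A v^T; rewrite -mulmxA vG mulmx0 mxE => /esym/eqP.
rewrite paddr_eq0 ?sqnorm_ge0 ?mulr_ge0 ?sqnorm_ge0 ?ltW // => /andP[_].
rewrite mulf_eq0 gt_eqF //= psumr_eq0 => [/allP v0|i _]; last by rewrite exprn_ge0.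
apply/matrixP => i j; rewrite ord1 mxE.
have := v0 j (mem_index_enum _); rewrite /= sqrf_eq0 normr_eq0 mxE => /eqP //.
Qed.

Lemma resolvent_mull : resolvent t A *m (A^t* *m A + t%:M) = 1%:M.
Proof. by rewrite mulVmx ?gram_unit. Qed.

Lemma resolvent_mulr : (A^t* *m A + t%:M) *m resolvent t A = 1%:M.
Proof. by rewrite mulmxV ?gram_unit. Qed.

Lemma gram_herm : (A^t* *m A + t%:M)^t* = A^t* *m A + t%:M.
Proof.
rewrite linearD /= map_mxD trmxC_mul trmxCK tr_scalar_mx map_scalar_mx /=.
by rewrite (CrealP _) ?gtr0_real.
Qed.

Lemma resolvent_herm : (resolvent t A)^t* = resolvent t A.
Proof.
have := congr1 (fun B => B^t*) resolvent_mulr.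
rewrite trmxC_mul gram_herm trmx1 map_mx1 => GV.
by rewrite -[LHS]mulmx1 -resolvent_mulr mulmxA GV mul1mx.
Qed.

Lemma resolvent_herm_entry j k :
  resolvent t A k j = (resolvent t A j k)^*.
Proof. by rewrite -[in LHS]resolvent_herm !mxE. Qed.

(** In terms of [u = resolvent t A *m v] the right-hand side is the form [|A u|^2 + t |u|^2] of
    [quad_form]. The bounds on the entries below all come from here. *)
Lemma resolvent_quad (v : 'cV[C]_n) :
  t * sqnorm (resolvent t A *m v) <= (v^t* *m resolvent t A *m v) 0 0.
Proof.
set u := resolvent t A *m v.
have vE : v = (A^t* *m A + t%:M) *m u by rewrite mulmxA resolvent_mulr mul1mx.
rewrite -mulmxA -/u [X in X^t*]vE trmxC_mul gram_herm.
by rewrite quad_form lerDr sqnorm_ge0.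
Qed.

Lemma resolvent_quad_ge0 (v : 'cV[C]_n) :
  0 <= (v^t* *m resolvent t A *m v) 0 0.
Proof.
by apply: le_trans (resolvent_quad v); rewrite mulr_ge0 ?sqnorm_ge0 ?ltW.
Qed.

Lemma delta_quad (G : 'M[C]_n) j :
  ((delta_mx j 0 : 'cV[C]_n)^t* *m G *m (delta_mx j 0 : 'cV[C]_n)) 0 0 = G j j.
Proof.
rewrite trmx_delta map_delta_mx -rowE -colE !mxE.
by [].
Qed.

Lemma resolvent_diag_ge0 j : 0 <= resolvent t A j j.
Proof. by rewrite -delta_quad resolvent_quad_ge0. Qed.

Lemma resolvent_col j :
  t * (\sum_k `|resolvent t A k j| ^+ 2) <= resolvent t A j j.
Proof.
rewrite -[leRHS]delta_quad; apply: le_trans (resolvent_quad _).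
by rewrite -colE /sqnorm; under [in leRHS]eq_bigr do rewrite mxE.
Qed.

Lemma resolvent_diag_le j : resolvent t A j j <= t^-1.
Proof.
set g := resolvent t A j j; have g0 : 0 <= g by apply: resolvent_diag_ge0.
have : t * g ^+ 2 <= g.
  apply: le_trans (resolvent_col j); rewrite ler_pM2l //.
  rewrite (bigD1 j) //= ger0_norm -/g // lerDl.
  by apply: sumr_ge0 => k _; rewrite exprn_ge0.
have [g_eq0|gn0] := eqVneq g 0; first by move=> _; rewrite g_eq0 invr_ge0 ltW.
have gp : 0 < g by rewrite lt_def gn0.
rewrite expr2 mulrA -[leRHS]mul1r ler_pM2r // => tg.
by rewrite -[leRHS]mul1r ler_pdivlMr // mulrC.
Qed.

Lemma resolvent_row_sqnorm j :
  \sum_k `|resolvent t A j k| ^+ 2 <= t^-1 ^+ 2.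
Proof.
have : t * (\sum_k `|resolvent t A k j| ^+ 2) <= t^-1.
  exact: le_trans (resolvent_col j) (resolvent_diag_le j).
rewrite mulrC -ler_pdivlMr // expr2; apply: le_trans.
by apply: ler_sum => k _; rewrite (resolvent_herm_entry k j) norm_conjC.
Qed.

End Positive.

Section RankOne.
Variables (m n : nat) (t : C) (A : 'M[C]_(m, n)) (i : 'I_m).
Hypothesis t_gt0 : 0 < t.

(** Zeroing the row keeps the dimensions and has the same Gram matrix as deleting it. *)
Definition zero_row : 'M[C]_(m, n) := \matrix_(k, j) (A k j *+ (k != i)).

Let B := zero_row.
Let a := row i A.
Let Q := resolvent t B.
Let G := resolvent t A.

Definition row_form : C := (a *m Q *m a^t*) 0 0.
Local Notation alpha := row_form.

Lemma gram_zero_row : A^t* *m A = B^t* *m B + a^t* *m a.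
Proof.
apply/matrixP => j k; rewrite !mxE (bigD1 i) //= [in RHS](bigD1 i) //=.
rewrite big_ord1 !mxE eqxx mulr0 add0r addrC; congr (_ + _).
by apply: eq_bigr => l li; rewrite !mxE li.
Qed.

Lemma row_form_ge0 : 0 <= alpha.
Proof.
have := resolvent_quad_ge0 B t_gt0 (a^t*); rewrite trmxCK; exact.
Qed.

Let alpha1 : 1 + alpha != 0.
Proof. by rewrite gt_eqF // ltr_wpDr ?ltr01 // row_form_ge0. Qed.

Lemma row_formE : a *m Q *m a^t* = alpha%:M.
Proof. by rewrite [LHS]mx11_scalar. Qed.

(** The Sherman-Morrison formula, verified by multiplying with the matrix to be inverted. *)
Lemma resolvent_zero_row :
  G = Q - (1 + alpha)^-1 *: (Q *m a^t* *m (a *m Q)).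
Proof.
set H := RHS; suff HG : H *m (A^t* *m A + t%:M) = 1%:M.
  by rewrite -[LHS]mul1mx -HG -mulmxA resolvent_mulr ?mulmx1.
have QB : Q *m (B^t* *m B + t%:M) = 1%:M by rewrite resolvent_mull.
rewrite gram_zero_row addrAC mulmxDr /H !mulmxBl -!scalemxAl -!mulmxA QB mulmx1.
have -> : a *m (Q *m (a^t* *m a)) = alpha *: a.
  by rewrite !mulmxA row_formE mul_scalar_mx.
rewrite -!scalemxAr scalerA -addrA -[RHS]addr0; congr (_ + _).
rewrite -scaleNr -scaleNr -{2}[Q *m (_ *m _)]scale1r -!scalerDl.
rewrite (_ : _ + _ = 0) ?scale0r //.
by field.
Qed.

Lemma row_form_resolvent : (a *m G *m a^t*) 0 0 = alpha / (1 + alpha).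
Proof.
rewrite resolvent_zero_row mulmxBr mulmxBl row_formE -scalemxAr -scalemxAl.
have -> : a *m (Q *m a^t* *m (a *m Q)) *m a^t* = (alpha * alpha)%:M.
  by rewrite scalar_mxM -!row_formE !mulmxA.
by rewrite scale_scalar_mx !mxE eqxx !mulr1n; field.
Qed.

Lemma trace_zero_row_ge0 j : 0 <= Q j j - G j j.
Proof.
rewrite resolvent_zero_row [X in _ <= Q j j - X]mxE mxE opprD opprK addNKr.
rewrite mxE mulr_ge0 ?invr_ge0 ?addr_ge0 ?row_form_ge0 //.
rewrite mxE big_ord1 mulrC.
have -> : (Q *m a^t*) j 0 = ((a *m Q) 0 j)^*.
  by rewrite -[Q in LHS](resolvent_herm B t_gt0) -trmxC_mul !mxE.
by rewrite -normCK exprn_ge0.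
Qed.

(** The difference of traces is the squared norm of [Q *m a^t*] divided by [1 + alpha], and [t]
    times that squared norm is at most [alpha] by [resolvent_quad]. The bound involves neither the
    dimension nor the size of the row. *)
Lemma trace_zero_row_le : \sum_j (Q j j - G j j) <= t^-1.
Proof.
have -> : \sum_j (Q j j - G j j) = \tr ((1 + alpha)^-1 *: (Q *m a^t* *m (a *m Q))).
  apply: eq_bigr => j _; rewrite resolvent_zero_row [X in Q j j - X]mxE [in RHS]mxE.
  by rewrite [X in Q j j - (Q j j + X)]mxE mxE opprD opprK addNKr.
rewrite mxtraceZ mxtrace_mulC trace_mx11.
have -> : (a *m Q *m (Q *m a^t*)) 0 0 = sqnorm (Q *m a^t*).
  by rewrite -sqnormE trmxC_mul trmxCK (resolvent_herm B t_gt0).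
rewrite mulrC ler_pdivrMr ?ltr_wpDr ?row_form_ge0 //.
rewrite ler_pdivlMl //.
apply: le_trans (resolvent_quad B t_gt0 _) _; rewrite trmxCK -/Q.
by rewrite -/alpha lerDr.
Qed.

End RankOne.

Section Duality.
Variables (m n : nat) (t : C) (A : 'M[C]_(m, n)).
Hypothesis t_gt0 : 0 < t.

(** The push-through identity: the adjoint of [A] intertwines the two shifted Gram matrices, which
    is the equation [E] of the proof. *)
Lemma resolvent_adj :
  t *: resolvent t (A^t*) = 1%:M - A *m resolvent t A *m A^t*.
Proof.
set H := RHS; have HG : H *m (A^t*^t* *m A^t* + t%:M) = t%:M.
  have E : A^t* *m (A *m A^t* + t%:M) = (A^t* *m A + t%:M) *m A^t*.
    by rewrite mulmxDr mulmxDl mulmxA mul_mx_scalar mul_scalar_mx.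
  rewrite trmxCK /H mulmxBl mul1mx -[_ *m A^t* *m _]mulmxA E mulmxA.
  by rewrite -[A *m _ *m _]mulmxA resolvent_mull // mulmx1 addrC addKr.
rewrite -[H]mulmx1 -(resolvent_mulr (A^t*) t_gt0) mulmxA HG.
by rewrite mul_scalar_mx.
Qed.

Lemma resolvent_adj_diag i :
  t * resolvent t (A^t*) i i = (1 + row_form t A i)^-1.
Proof.
have -> : t * resolvent t (A^t*) i i = (t *: resolvent t (A^t*)) i i by rewrite mxE.
rewrite resolvent_adj mxE [X in X + _]mxE eqxx mulr1n [X in _ + X]mxE.
have -> : (A *m resolvent t A *m A^t*) i i = (row i A *m resolvent t A *m (row i A)^t*) 0 0.
  by rewrite -row_mul !mxE; apply: eq_bigr => k _; rewrite !mxE.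
rewrite row_form_resolvent //.
have : 1 + row_form t A i != 0 by rewrite gt_eqF // ltr_wpDr ?ltr01 // row_form_ge0.
by move=> ?; field.
Qed.

(** By cyclicity both sides are minus the trace of [A *m resolvent t A *m A^t*]. This ties the row
    unknowns to the column unknowns. *)
Lemma trace_resolvent_adj :
  \sum_i t * resolvent t (A^t*) i i - m%:R = \sum_j t * resolvent t A j j - n%:R.
Proof.
rewrite -!mulr_sumr -![\sum_i resolvent _ _ i i]/(\tr _) -!mxtraceZ resolvent_adj.
rewrite linearB /= mxtrace1 addrC addKr -mulmxA mxtrace_mulC -mulmxA.
have -> : A^t* *m A = (A^t* *m A + t%:M) - t%:M by rewrite addrK.
by rewrite mulmxBr resolvent_mull // linearB /= mxtrace1 mul_mx_scalar opprB.
Qed.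

End Duality.
End Resolvent.

Local Open Scope complex_scope.

(** * Real parts and measurability of complex matrix functions *)

Section ComplexParts.
Variable R : realType.
Local Notation C := R[i].
Local Notation Re := (@complex.Re R).
Local Notation Im := (@complex.Im R).
Implicit Types x y : C.

Lemma ReD x y : Re (x + y) = Re x + Re y.
Proof. by case: x => a b; case: y. Qed.

Lemma ImD x y : Im (x + y) = Im x + Im y.
Proof. by case: x => a b; case: y. Qed.

Lemma ReB x y : Re (x - y) = Re x - Re y.
Proof. by case: x => a b; case: y. Qed.

Lemma ReM x y : Re (x * y) = Re x * Re y - Im x * Im y.
Proof. by case: x => a b; case: y. Qed.

Lemma ImM x y : Im (x * y) = Re x * Im y + Im x * Re y.
Proof. by case: x => a b; case: y. Qed.

Lemma ReZ (a : R) x : Re (a%:C * x) = a * Re x.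
Proof. by case: x => b c /=; rewrite mul0r subr0. Qed.

Lemma conjCE x : (x^*)%R = x^*%C.
Proof. by []. Qed.

Lemma Re_sum (I : Type) (r : seq I) (Q : pred I) (F : I -> C) :
  Re (\sum_(i <- r | Q i) F i) = \sum_(i <- r | Q i) Re (F i).
Proof. by elim: r => [|i r IH]; rewrite ?big_nil // !big_cons; case: (Q i); rewrite ?ReD ?IH. Qed.

Lemma Re_le x y : x <= y -> Re x <= Re y.
Proof. by rewrite lecE => /andP[]. Qed.

Lemma ge0_ReE x : 0 <= x -> x = (Re x)%:C.
Proof. by case: x => a b; rewrite lecE /= => /andP[/eqP -> _]. Qed.

Lemma Re_ge0 x : 0 <= x -> 0 <= Re x.
Proof. exact: Re_le. Qed.

Lemma Re_sqr_norm x : Re (`|x| ^+ 2) = Re x ^+ 2 + Im x ^+ 2.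
Proof. by rewrite -add_Re2_Im2. Qed.

Lemma real_complexV (a : R) : (a^-1)%:C = (a%:C)^-1.
Proof. exact: (fmorphV (real_complex R)). Qed.

End ComplexParts.

Section ComplexMeasurable.
Context {R : realType} {d : measure_display} {T : measurableType d}.
Local Notation C := R[i].
Local Notation Re := (@complex.Re R).
Local Notation Im := (@complex.Im R).
Implicit Types f g : T -> C.

Definition cmeas f := measurable_fun setT (Re \o f) /\
  measurable_fun setT (Im \o f).

Lemma cmeas_cst c : cmeas (fun=> c).
Proof. by split; exact: measurable_cst. Qed.

Lemma cmeasD f g : cmeas f -> cmeas g -> cmeas (fun w => f w + g w).
Proof.
move=> [rf jf] [rg jg]; split.
  by under [X in measurable_fun _ X]eq_fun do rewrite /= ReD; exact: measurable_funD.
by under [X in measurable_fun _ X]eq_fun do rewrite /= ImD; exact: measurable_funD.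
Qed.

Lemma cmeasM f g : cmeas f -> cmeas g -> cmeas (fun w => f w * g w).
Proof.
move=> [rf jf] [rg jg]; split.
  under [X in measurable_fun _ X]eq_fun do rewrite /= ReM.
  by apply: measurable_funB; exact: measurable_funM.
under [X in measurable_fun _ X]eq_fun do rewrite /= ImM.
by apply: measurable_funD; exact: measurable_funM.
Qed.

Lemma cmeas_conj f : cmeas f -> cmeas (fun w => (f w)^*).
Proof.
move=> [rf jf]; split.
  by rewrite (_ : _ \o _ = Re \o f) //; apply/funext => w /=; case: (f w).
rewrite (_ : _ \o _ = fun w => - Im (f w)); first exact: measurableT_comp.
by apply/funext => w /=; case: (f w).
Qed.

Lemma cmeas_sum (I : Type) (r : seq I) (Q : pred I) (f : I -> T -> C) :
  (forall i, cmeas (f i)) -> cmeas (fun w => \sum_(i <- r | Q i) f i w).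
Proof.
move=> mf; elim: r => [|i r IH].
  by under eq_fun do rewrite big_nil; exact: cmeas_cst.
by under eq_fun do rewrite big_cons; case: (Q i) => //; exact: cmeasD.
Qed.

Lemma cmeas_prod (I : Type) (r : seq I) (Q : pred I) (f : I -> T -> C) :
  (forall i, cmeas (f i)) -> cmeas (fun w => \prod_(i <- r | Q i) f i w).
Proof.
move=> mf; elim: r => [|i r IH].
  by under eq_fun do rewrite big_nil; exact: cmeas_cst.
by under eq_fun do rewrite big_cons; case: (Q i) => //; exact: cmeasM.
Qed.

Lemma cmeasV f : (forall w, f w != 0) -> cmeas f -> cmeas (fun w => (f w)^-1).
Proof.
move=> f0 [rf jf].
pose N w : R := Re (f w) ^+ 2 + Im (f w) ^+ 2.
have N0 w : 0 < N w.
  rewrite lt_def addr_ge0 ?sqr_ge0 // andbT paddr_eq0 ?sqr_ge0 // !sqrf_eq0.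
  by apply: contra (f0 w); rewrite eq_complex.
have mNV : measurable_fun setT (fun w => (N w)^-1).
  rewrite (_ : (fun w => _) = fun w => expR (- ln (N w))); last first.
    by apply/funext => w; rewrite expRN lnK ?posrE.
  apply: measurableT_comp => //; apply: measurableT_comp => //.
  apply: measurableT_comp; first exact: measurable_ln.
  by apply: measurable_funD; apply: measurable_funX.
split.
  rewrite (_ : _ \o _ = fun w => Re (f w) * (N w)^-1).
    exact: measurable_funM.
  by apply/funext => w; rewrite /N /=; case: (f w).
rewrite (_ : _ \o _ = fun w => - (Im (f w) * (N w)^-1)).
  by apply: measurableT_comp => //; exact: measurable_funM.
by apply/funext => w; rewrite /N /=; case: (f w).
Qed.

Lemma cmeas_det n (M : T -> 'M[C]_n) : (forall i j, cmeas (fun w => M w i j)) ->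
  cmeas (fun w => \det (M w)).
Proof.
move=> mM; rewrite /determinant; apply: cmeas_sum => s; apply: cmeasM.
  exact: cmeas_cst.
by apply: cmeas_prod => i.
Qed.

Lemma cmeas_invmx n (M : T -> 'M[C]_n) : (forall w, M w \in unitmx) ->
  (forall i j, cmeas (fun w => M w i j)) ->
  forall i j, cmeas (fun w => invmx (M w) i j).
Proof.
move=> uM mM i j.
under eq_fun do rewrite /invmx uM mxE.
apply: cmeasM.
  apply: cmeasV; last exact: cmeas_det.
  by move=> w; have := uM w; rewrite unitmxE unitfE.
under eq_fun do rewrite mxE /cofactor; apply: cmeasM; first exact: cmeas_cst.
apply: cmeas_det => k l; under eq_fun do rewrite !mxE; exact: mM.
Qed.

Lemma cmeas_mulmx m n p (M : T -> 'M[C]_(m, n)) (N : T -> 'M[C]_(n, p)) :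
  (forall i j, cmeas (fun w => M w i j)) -> (forall i j, cmeas (fun w => N w i j)) ->
  forall i j, cmeas (fun w => (M w *m N w) i j).
Proof.
move=> mM mN i j; under eq_fun do rewrite mxE.
by apply: cmeas_sum => k; apply: cmeasM.
Qed.

Lemma cmeas_resolvent m n (t : C) (M : T -> 'M[C]_(m, n)) : 0 < t ->
  (forall i j, cmeas (fun w => M w i j)) ->
  forall i j, cmeas (fun w => resolvent t (M w) i j).
Proof.
move=> t0 mM; apply: cmeas_invmx => [w|i j]; first exact: gram_unit.
under eq_fun do rewrite mxE; apply: cmeasD; last exact: cmeas_cst.
apply: cmeas_mulmx => // k l; under eq_fun do rewrite !mxE.
exact: cmeas_conj.
Qed.

End ComplexMeasurable.

Lemma sum_symmetric (V : comNzRingType) n (T : 'I_n -> 'I_n -> V) :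
  (forall j k, T j k = T k j) ->
  \sum_j \sum_k T j k = \sum_j T j j + 2 * \sum_(j < n) \sum_(k < n | (k < j)%N) T j k.
Proof.
move=> Tsym.
have -> : \sum_j \sum_k T j k = \sum_j (T j j + (\sum_(k < n | (k < j)%N) T j k +
    \sum_(k < n | (j < k)%N) T j k)).
  apply: eq_bigr => j _; rewrite (bigD1 j) //=; congr (_ + _).
  rewrite (bigID (fun k : 'I_n => (k < j)%N)) /=; congr (_ + _); apply: eq_bigl => k.
    by case: ltngtP => [kj|kj|/val_inj ->]; rewrite ?andbT ?andbF ?eqxx //;
      apply: contraTneq kj => ->; rewrite ltnn.
  by case: ltngtP => [kj|kj|/val_inj ->]; rewrite ?andbT ?andbF ?eqxx //;
      apply: contraTneq kj => ->; rewrite ltnn.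
rewrite !big_split /=; congr (_ + _); rewrite mulr_natl mulr2n; congr (_ + _).
rewrite (exchange_big_dep predT) //=; apply: eq_bigr => j _.
by apply: eq_bigr => k _.
Qed.

Section RealParts.
Variables (R : realType) (m n : nat) (t : R) (A : 'M[R[i]]_(m, n)).
Hypothesis t_gt0 : 0 < t.
Local Notation tC := (t%:C).
Local Notation Re := (@complex.Re R).
Local Notation Im := (@complex.Im R).

Let tC_gt0 : 0 < tC. Proof. by rewrite ltcR. Qed.

Lemma row_form_Re i : row_form tC A i = (Re (row_form tC A i))%:C.
Proof. exact/ge0_ReE/row_form_ge0. Qed.

Lemma Re_row_form_ge0 i : 0 <= Re (row_form tC A i).
Proof. exact/Re_ge0/row_form_ge0. Qed.

Lemma Re_resolvent_adj_diag i :
  Re (tC * resolvent tC (A^t*) i i) = (1 + Re (row_form tC A i))^-1.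
Proof.
rewrite resolvent_adj_diag // row_form_Re -[1]/(1%:C) -rmorphD -real_complexV /=.
by [].
Qed.

Lemma Re_resolvent_diag_ge0 j : 0 <= Re (resolvent tC A j j).
Proof. exact/Re_ge0/resolvent_diag_ge0. Qed.

Lemma Re_resolvent_diag_le j : Re (resolvent tC A j j) <= t^-1.
Proof. by have := Re_le (resolvent_diag_le A tC_gt0 j); rewrite -real_complexV. Qed.

Lemma Re_resolvent_row_le j :
  \sum_k (Re (resolvent tC A j k) ^+ 2 + Im (resolvent tC A j k) ^+ 2) <= t^-1 ^+ 2.
Proof.
have := Re_le (resolvent_row_sqnorm A tC_gt0 j).
rewrite -real_complexV -rmorphXn Re_sum; apply: le_trans.
by apply: ler_sum => k _; rewrite Re_sqr_norm.
Qed.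

Lemma Re_zero_row_diff i j :
  0 <= Re (resolvent tC (zero_row A i) j j) - Re (resolvent tC A j j).
Proof. by rewrite -ReB; exact/Re_ge0/trace_zero_row_ge0. Qed.

Lemma Re_zero_row_trace i :
  \sum_j (Re (resolvent tC (zero_row A i) j j) - Re (resolvent tC A j j)) <= t^-1.
Proof.
have := Re_le (trace_zero_row_le A i tC_gt0); rewrite -real_complexV Re_sum.
by apply: le_trans; apply: ler_sum => j _; rewrite ReB.
Qed.

Lemma Re_row_form_quad i : Re (row_form tC A i) =
  quad_form_re (fun j k => Re (resolvent tC (zero_row A i) j k))
    (fun j k => Im (resolvent tC (zero_row A i) j k)) (fun j => reim (A i j)).
Proof.
set Q := resolvent tC (zero_row A i).
pose T j k := Re (A i j * Q j k * (A i k)^*).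
have TE j k : T j k = Re (Q j k) * ((reim (A i j)).1 * (reim (A i k)).1 + (reim (A i j)).2 * (reim (A i k)).2)
   - Im (Q j k) * ((reim (A i j)).2 * (reim (A i k)).1 - (reim (A i j)).1 * (reim (A i k)).2).
  rewrite /T /reim; case: (A i j) (A i k) (Q j k) => a1 a2 [b1 b2] [c1 c2] /=.
  by ring.
have -> : Re (row_form tC A i) = \sum_j \sum_k T j k.
  rewrite /row_form -/Q mxE exchange_big Re_sum /=; apply: eq_bigr => k _.
  rewrite mxE mulr_suml Re_sum; apply: eq_bigr => j _.
  by rewrite !mxE.
have Qsym j k : Q j k = (Q k j)^* by apply: resolvent_herm_entry.
rewrite sum_symmetric => [|j k]; last first.
  rewrite !TE Qsym; case: (Q k j) => c1 c2 /=; ring.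
rewrite /quad_form_re; congr (_ + 2 * _).
  apply: eq_bigr => j _; rewrite TE /abs2; ring.
by apply: eq_bigr => j _; apply: eq_bigr => k _; rewrite TE.
Qed.

Lemma Re_trace_resolvent_adj :
  \sum_i Re (tC * resolvent tC (A^t*) i i) = m%:R - n%:R + t * \sum_j Re (resolvent tC A j j).
Proof.
have := congr1 Re (trace_resolvent_adj A tC_gt0).
rewrite !ReB !Re_sum mulr_sumr => E.
have reN k : Re (k%:R : R[i]) = k%:R by elim: k => // k IH; rewrite -!natr1 ReD IH.
move: E; rewrite !reN => E; rewrite -[LHS](subrK m%:R) E.
under eq_bigr do rewrite ReZ.
by ring.
Qed.

End RealParts.

Lemma weighted_sum_bounds (R : numDomainType) n (u D : 'I_n -> R) (K T : R) :
  0 <= K -> (forall j, 0 <= u j <= K) -> (forall j, 0 <= D j) -> \sum_j D j <= T ->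
  0 <= \sum_j u j * D j <= K * T.
Proof.
move=> K0 uK D0 DT; apply/andP; split.
  by apply: sumr_ge0 => j _; case/andP: (uK j) => u0 _; rewrite mulr_ge0.
apply: (@le_trans _ _ (K * \sum_j D j)); last by rewrite ler_wpM2l.
rewrite mulr_sumr; apply: ler_sum => j _; case/andP: (uK j) => _ uj.
by rewrite ler_wpM2r.
Qed.

Lemma common_upper_dist (R : realDomainType) (a x y T : R) :
  0 <= a - x <= T -> 0 <= a - y <= T -> `|x - y| <= T.
Proof.
move=> /andP[x1 x2] /andP[y1 y2].
by rewrite ler_norml; apply/andP; split; lra.
Qed.

(** * The self-consistent equations *)

Section RandomResolvent.
Context {R : realType} {d : measure_display} {Omega : measurableType d}.
Variables (P : probability Omega R) (m n : nat).
Local Notation I := ('I_m * 'I_n)%type.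
Variables (Z : I -> Omega -> R * R).
Hypothesis Z_meas : forall i, measurable_fun setT (Z i).
Hypothesis Z_indep : mutually_independent P Z.
Local Notation fam := (@famType _ (R * R)%type I).
Local Notation joint_of := (@joint _ _ _ _ _).
Local Notation joint := (joint Z).
Local Notation Re := (@complex.Re R).
Local Notation Im := (@complex.Im R).

Variable t : R.
Hypothesis t_gt0 : 0 < t.
Local Notation tC := (t%:C).
Let tC_gt0 : 0 < tC. Proof. by rewrite ltcR. Qed.

Definition mat_of (z : I -> R * R) : 'M[R[i]]_(m, n) :=
  \matrix_(i, j) ((z (i, j)).1 +i* (z (i, j)).2).

Lemma cmeas_mat_of i j : cmeas (fun z : fam => mat_of z i j).
Proof.
split; under [X in measurable_fun _ X]eq_fun do rewrite /= mxE /=.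
  exact: measurableT_comp measurable_fst (measurable_coord (i, j)).
exact: measurableT_comp measurable_snd (measurable_coord (i, j)).
Qed.

Definition Gdiag (j : 'I_n) (z : I -> R * R) : R := Re (resolvent tC (mat_of z) j j).
Definition Pdiag (i : 'I_m) (z : I -> R * R) : R :=
  Re (tC * resolvent tC ((mat_of z)^t*) i i).
Let alpha (i : 'I_m) (z : I -> R * R) : R := Re (row_form tC (mat_of z) i).
Let Qre (i : 'I_m) (j k : 'I_n) (z : I -> R * R) : R :=
  Re (resolvent tC (zero_row (mat_of z) i) j k).
Let Qim (i : 'I_m) (j k : 'I_n) (z : I -> R * R) : R :=
  Im (resolvent tC (zero_row (mat_of z) i) j k).

Lemma bmeas_Gdiag j : bmeas (Gdiag j : fam -> R).
Proof.
split; first exact: (cmeas_resolvent tC_gt0 (fun i j => cmeas_mat_of i j) j j).1.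
exists t^-1 => z; rewrite ger0_norm; first exact: Re_resolvent_diag_le.
exact: Re_resolvent_diag_ge0.
Qed.

Lemma PdiagE i z : Pdiag i z = (1 + alpha i z)^-1.
Proof. exact: Re_resolvent_adj_diag. Qed.

Let alpha_ge0 i z : 0 <= alpha i z. Proof. exact: Re_row_form_ge0. Qed.

Lemma Pdiag_ge0 i z : 0 <= Pdiag i z.
Proof. by rewrite PdiagE invr_ge0 addr_ge0. Qed.

Lemma Pdiag_le1 i z : Pdiag i z <= 1.
Proof. by rewrite PdiagE invf_le1 ?lerDl // ltr_wpDr. Qed.

Lemma bmeas_Pdiag i : bmeas (Pdiag i : fam -> R).
Proof.
split; last by exists 1 => z; rewrite ger0_norm ?Pdiag_ge0 ?Pdiag_le1.
have mad k l : cmeas (fun z : fam => ((mat_of z)^t*) k l).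
  by under [X in cmeas X]eq_fun do rewrite 2!mxE; apply: cmeas_conj; exact: cmeas_mat_of.
exact: (cmeasM (cmeas_cst tC) (cmeas_resolvent tC_gt0 mad i i)).1.
Qed.

Let cmeas_zero_row i k l : cmeas (fun z : fam => zero_row (mat_of z) i k l).
Proof.
under [X in cmeas X]eq_fun do rewrite mxE; case: (k != i) => /=; first exact: cmeas_mat_of.
exact: cmeas_cst.
Qed.

Let cmeas_Q i j k : cmeas (fun z : fam => resolvent tC (zero_row (mat_of z) i) j k).
Proof. exact: (cmeas_resolvent tC_gt0 (cmeas_zero_row i)). Qed.

Let malpha i : measurable_fun setT (alpha i : fam -> R).
Proof.
have mrow k l : cmeas (fun z : fam => row i (mat_of z) k l).
  by under [X in cmeas X]eq_fun do rewrite mxE; exact: cmeas_mat_of.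
have mrowt k l : cmeas (fun z : fam => ((row i (mat_of z))^t*) k l).
  by under [X in cmeas X]eq_fun do rewrite 3!mxE; apply: cmeas_conj; exact: cmeas_mat_of.
exact: (cmeas_mulmx (cmeas_mulmx mrow (cmeas_Q i)) mrowt 0 0).1.
Qed.

Let zero_row_dep i (z z' : I -> R * R) :
  (forall k, k.1 != i -> z k = z' k) -> zero_row (mat_of z) i = zero_row (mat_of z') i.
Proof.
by move=> zz'; apply/matrixP => k l; rewrite !mxE; case: eqP => //= /eqP ki; rewrite zz'.
Qed.

Variables (v : 'I_m -> 'I_n -> R) (c : R).
Hypothesis Z_int : forall i, P.-integrable setT (EFin \o (fun w => abs2 (Z i w))).
Hypothesis Z_var : forall i j, \int[P]_w abs2 (Z (i, j) w) = v i j.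
Hypothesis Z_mean1 : forall i, \int[P]_w (Z i w).1 = 0.
Hypothesis Z_mean2 : forall i, \int[P]_w (Z i w).2 = 0.
Hypothesis v_le : forall i j, v i j <= c.

Let v_ge0 i j : 0 <= v i j.
Proof. by rewrite -Z_var; apply: Rintegral_ge0 => w _; rewrite addr_ge0 ?sqr_ge0. Qed.

Hypothesis c_ge0 : 0 <= c.
Variable eta : R.

Definition tail2 i j : R :=
  \int[P]_w (abs2 (Z (i, j) w) * (eta ^+ 2 <= abs2 (Z (i, j) w))%R%:R).

(** With [c = C / n] the first square root is of order [n^(-1/2)] and the second of order [eta]; the
    tails vanish on average by the Lindeberg condition. *)
Definition quad_bound i : R :=
  2 * Num.sqrt (n%:R * (c ^+ 2 * t^-1 ^+ 2)) +
    Num.sqrt (n%:R * (t^-1 ^+ 2 * (eta ^+ 2 * c))) +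
    2 * t^-1 * \sum_j tail2 i j.

Let quadF i (z : fam) : R := `|alpha i z - \sum_j v i j * Qre i j j z|.

Let mquadF i : measurable_fun setT (quadF i).
Proof.
apply: measurableT_comp => //; apply: measurable_funB => //.
apply: measurable_sum_cond => j; apply: measurable_funM => //.
exact: (cmeas_Q i j j).1.
Qed.

(** The matrix [zero_row] does not involve row [i]. With the other rows frozen, the bound for a
    deterministic matrix therefore applies to the inner integral. *)
Let quadF_bound i : P.-integrable setT (EFin \o (fun w => quadF i (joint w))) /\
  \int[P]_w quadF i (joint w) <= quad_bound i.
Proof.
pose J : {set I} := [set k | k.1 != i]%SET.
pose h (j : 'I_n) : I := (i, j).
have hinj : injective h by move=> j k [].
have inner (z : fam) : (\int[P]_w (quadF i (mix J z (joint w)))%:E <= (quad_bound i)%:E)%E.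
  have [iq qle] := @quad_form_concentration R d Omega P n (Z \o h) (fun j => Z_meas (h j))
    (mutually_independent_sub hinj Z_indep) (v i) c (fun j => Z_int (h j)) (fun j => Z_var i j)
    (fun j => Z_mean1 (h j)) (fun j => Z_mean2 (h j)) (v_le i)
    (fun j k => Qre i j k z) (fun j k => Qim i j k z) t^-1 (ltW (etrans (invr_gt0 t) t_gt0))
    (fun j => etrans (congr1 (fun x => x <= t^-1)
      (ger0_norm (Re_resolvent_diag_ge0 (zero_row (mat_of z) i) t_gt0 j)))
       (Re_resolvent_diag_le (zero_row (mat_of z) i) t_gt0 j))
    (Re_resolvent_row_le (zero_row (mat_of z) i) t_gt0) eta.
  have E w : quadF i (mix J z (joint w)) =
    `|quad_form_re (fun j k => Qre i j k z) (fun j k => Qim i j k z) (joint_of (Z \o h) w)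
      - \sum_j v i j * Qre i j j z|.
    have zr : zero_row (mat_of (mix J z (joint w))) i = zero_row (mat_of z) i.
      by apply: zero_row_dep => k ki; rewrite /mix inE ki.
    rewrite /quadF /alpha (Re_row_form_quad _ t_gt0) zr /Qre zr; congr `| _ - _ |.
    congr quad_form_re; apply/funext => j; rewrite mxE /mix /reim /= inE eqxx /=.
    by rewrite -surjective_pairing.
  under eq_integral do rewrite E.
  rewrite -(fineK (integrable_fin_num measurableT iq)) lee_fin.
  exact: qle.
have iF : (\int[P]_w (quadF i (joint w))%:E <= (quad_bound i)%:E)%E.
  rewrite (decouple Z_meas Z_indep J (F := fun z => (quadF i z)%:E)); last 2 first.
  - exact/measurable_EFinP.
  - by move=> z; rewrite lee_fin normr_ge0.
  have qb : (0 <= quad_bound i)%R.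
    by rewrite /quad_bound !addr_ge0 ?mulr_ge0 ?sqrtr_ge0 ?invr_ge0 ?(ltW t_gt0) ?sumr_ge0 // => j _;
    apply: Rintegral_ge0 => w _; rewrite mulr_ge0 ?ler0n ?addr_ge0 ?sqr_ge0.
  have -> : ((quad_bound i)%:E = \int[P]_w (quad_bound i)%:E)%E.
    by rewrite integral_cst // [X in (_ * X)%E](_ : _ = 1%E) ?mule1 //; exact: probability_setT.
  apply: ge0_le_integral => //.
  - by move=> w _; apply: integral_ge0 => w' _; rewrite lee_fin normr_ge0.
  - apply: (@measurable_fun_fubini_tonelli_F _ _ _ _ _ P
      (fun u : Omega * Omega => (quadF i (joint_mix Z J u))%:E)).
      apply/measurable_EFinP; exact: measurableT_comp (mquadF i) (measurable_joint_mix Z_meas J).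
    by move=> u; rewrite lee_fin normr_ge0.
have iQ : P.-integrable setT (EFin \o (fun w => quadF i (joint w))).
  apply/integrableP; split.
    apply/measurable_EFinP; exact: measurableT_comp (mquadF i) (measurable_joint Z_meas).
  under eq_integral do rewrite /= normr_id.
  exact: le_lt_trans iF (ltry _).
split => //.
by rewrite -lee_fin fineK //; exact: integrable_fin_num iQ.
Qed.

(** Both values are compared with the one where row [k] is zeroed, which [z] and [z'] share. Each
    lies below it by at most [K * t^-1], so no factor 2 appears. *)
Lemma Gdiag_row_change (u : 'I_n -> R) (K : R) (k : 'I_m) (z z' : I -> R * R) :
  0 <= K -> (forall j, 0 <= u j <= K) -> (forall i, i.1 != k -> z i = z' i) ->
  `|\sum_j u j * Gdiag j z - \sum_j u j * Gdiag j z'| <= K * t^-1.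
Proof.
move=> K0 uK zz'; pose H (y : I -> R * R) := \sum_j u j * Qre k j j y.
have Hz : H z = H z' by rewrite /H /Qre (zero_row_dep zz').
have B y : 0 <= H y - \sum_j u j * Gdiag j y <= K * t^-1.
  rewrite -sumrB; under eq_bigr do rewrite -mulrBr.
  exact: (weighted_sum_bounds K0 uK (fun j => Re_zero_row_diff (mat_of y) t_gt0 k j)
    (Re_zero_row_trace (mat_of y) t_gt0 k)).
by apply: (@common_upper_dist _ (H z)); [exact: B|rewrite Hz; exact: B].
Qed.

Let mjoint := measurable_joint Z_meas.
Let bmeas_joint (f : fam -> R) : bmeas f -> bmeas (f \o joint).
Proof.
by move=> [mf [K fK]]; split; [exact: measurableT_comp mf mjoint|exists K => w; exact: fK].
Qed.

Lemma Gdiag_variance (u : 'I_n -> R) (K : R) : 0 <= K -> (forall j, 0 <= u j <= K) ->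
  \int[P]_w ((\sum_j u j * Gdiag j (joint w) -
     \int[P]_w' (\sum_j u j * Gdiag j (joint w'))) ^+ 2) <= m%:R * (K * t^-1) ^+ 2.
Proof.
move=> K0 uK; apply: (@block_variance R d _ Omega _ P _ Z Z_meas Z_indep m (fun i => i.1)
  (fun i => ltn_ord i.1) (fun z => \sum_j u j * Gdiag j z) (K * t^-1)).
- by apply: bmeas_sum => j; apply: bmeasZ; exact: bmeas_Gdiag.
- move=> k z z' zz'; have [km|mk] := ltnP k m.
    by apply: (Gdiag_row_change (k := Ordinal km)) => // i; exact: zz'.
  (* A block index at or beyond [m] is vacuous: all coordinates agree. *)
  have -> : z = z'; last by rewrite subrr normr0 mulr_ge0 // invr_ge0 ltW.
  apply/funext => i; apply: zz'; apply: contraTneq mk => <-.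
  by rewrite -ltnNge.
Qed.

(** Since [p (1 + alpha) = 1] and [0 <= p <= 1], the error is at most the mean of [|beta - alpha|].
    The three terms come from the quadratic form, from putting row [i] back, and from the
    fluctuation of the weighted trace. *)
Lemma self_consistent i :
  `|\int[P]_w Pdiag i (joint w) * (1 + \sum_j v i j * \int[P]_w Gdiag j (joint w)) - 1|
    <= quad_bound i + c * t^-1 + Num.sqrt (m%:R * (c * t^-1) ^+ 2).
Proof.
set beta := \sum_j v i j * _.
have vc j : 0 <= v i j <= c by rewrite v_ge0 v_le.
pose L w := \sum_j v i j * Gdiag j (joint w).
have bG j : bmeas (fun w => Gdiag j (joint w)) by apply/bmeas_joint/bmeas_Gdiag.
have bL : bmeas L by apply: bmeas_sum => j; exact: bmeasZ.
have betaE : beta = \int[P]_w L w.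
  rewrite Rintegral_sum => [|j]; last exact/bmeas_integrable/bmeasZ.
  by apply: eq_bigr => j _; rewrite RintegralZ //; exact: bmeas_integrable.
have bP : bmeas (fun w => Pdiag i (joint w)) by apply/bmeas_joint/bmeas_Pdiag.
have [iq qle] := quadF_bound i.
have bLb : bmeas (fun w => `|L w - beta|).
  by apply/bmeas_norm/bmeasB => //; exact: bmeas_cst.
have iqc := integrableD measurableT iq (finite_measure_integrable_cst P (c * t^-1) measurableT).
have iB := integrableD measurableT iqc (bmeas_integrable P bLb).
have bPb : bmeas (fun w => Pdiag i (joint w) * (1 + beta)).
  by apply: bmeasM => //; exact: bmeas_cst.
have -> : \int[P]_w Pdiag i (joint w) * (1 + beta) - 1 =
    \int[P]_w (Pdiag i (joint w) * (1 + beta) - 1).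
  rewrite (RintegralB measurableT (bmeas_integrable P bPb) (bmeas_integrable P (bmeas_cst 1))).
  rewrite Rintegral_prob_cst; congr (_ - _).
  under [RHS]eq_Rintegral do rewrite mulrC.
  by rewrite RintegralZ; [rewrite mulrC|exact: bmeas_integrable].
apply: le_trans (norm_Rintegral_le (g := fun w => quadF i (joint w) + c * t^-1 + `|L w - beta|) _ iB _) _.
- by apply: bmeas_integrable; apply: bmeasB => //; exact: bmeas_cst.
- move=> w; set z := joint w.
  have -> : Pdiag i z * (1 + beta) - 1 = Pdiag i z * (beta - alpha i z).
    have a1 : 1 + alpha i z != 0 by rewrite gt_eqF // ltr_wpDr.
    by rewrite PdiagE; field.
  rewrite normrM (ger0_norm (Pdiag_ge0 i z)).
  apply: le_trans (_ : `|beta - alpha i z| <= _).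
    by rewrite ler_piMl // Pdiag_le1.
  have -> : beta - alpha i z = - (alpha i z - \sum_j v i j * Qre i j j z)
      - (\sum_j v i j * Qre i j j z - L w) - (L w - beta) by ring.
  apply: le_trans (ler_normB _ _) _; apply: lerD => //.
  apply: le_trans (ler_normB _ _) _; rewrite normrN; apply: lerD => //.
  have /andP[d0 dc] : 0 <= \sum_j v i j * Qre i j j z - L w <= c * t^-1.
    rewrite /L -sumrB; under eq_bigr do rewrite -mulrBr.
    exact: (weighted_sum_bounds c_ge0 vc (fun j => Re_zero_row_diff (mat_of z) t_gt0 i j)
      (Re_zero_row_trace (mat_of z) t_gt0 i)).
  by rewrite (ger0_norm d0).
rewrite (RintegralD measurableT iqc (bmeas_integrable P bLb)).
rewrite (RintegralD measurableT iq (finite_measure_integrable_cst P (c * t^-1) measurableT)).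
rewrite Rintegral_prob_cst; apply: lerD; first by rewrite lerD2r.
apply: Rintegral_norm_sqrt; first by apply: bmeas_sqint; apply: bmeasB => //; exact: bmeas_cst.
by rewrite betaE; exact: Gdiag_variance.
Qed.

Definition Ptrace (z : I -> R * R) : R := \sum_i Pdiag i z.

Lemma PtraceE z : Ptrace z = m%:R - n%:R + t * \sum_j Gdiag j z.
Proof. exact: Re_trace_resolvent_adj. Qed.

Lemma bmeas_Ptrace : bmeas (Ptrace : fam -> R).
Proof. by apply: bmeas_sum => i; exact: bmeas_Pdiag. Qed.

(** The independent blocks are the rows, and by [PtraceE] a row moves the trace by at most
    [t * t^-1 = 1]. *)
Lemma Ptrace_moment4 :
  \int[P]_w ((Ptrace (joint w) - \int[P]_w' Ptrace (joint w')) ^+ 4) <= 7 * m%:R ^+ 2.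
Proof.
have := @block_moment4 R d _ Omega _ P _ Z Z_meas Z_indep m (fun i => i.1) (fun i => ltn_ord i.1)
  Ptrace 1 bmeas_Ptrace; rewrite expr1n mulr1; apply.
move=> k z z' zz'; have [km|mk] := ltnP k m; last first.
  have -> : z = z'; last by rewrite subrr normr0.
  apply/funext => i; apply: zz'; apply: contraTneq mk => <-.
  by rewrite -ltnNge.
rewrite !PtraceE opprD addrACA subrr add0r -mulrBr normrM gtr0_norm //.
rewrite -ler_pdivlMl // -[leRHS]mul1r.
have := @Gdiag_row_change (fun=> 1) 1 (Ordinal km) z z'.
have E1 y : \sum_j 1 * Gdiag j y = \sum_j Gdiag j y.
  by apply: eq_bigr => j _; exact: mul1r.
rewrite !E1 mulr1 mul1r; apply => [|j|i] //; first by rewrite ler01 lexx.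
exact: zz'.
Qed.

End RandomResolvent.

(** * Passage to the limit *)

Section GramSpectrum.
Variables (C : numClosedFieldType) (n m : nat) (B : 'M[C]_(n, m)).
Local Notation M := (B^t* *m B).
Local Notation U := (spectralmx M).
Local Notation d := (spectral_diag M).

Lemma gram_spectral : M = U^t* *m diag_mx d *m U.
Proof.
rewrite -invmx_unitary ?spectral_unitarymx //; apply/orthomx_spectralP.
by apply/normalmxP; rewrite trmxC_mul trmxCK.
Qed.

Let UU : U *m U^t* = 1%:M.
Proof. by apply/unitarymxP; exact: spectral_unitarymx. Qed.

Let UcU : U^t* *m U = 1%:M.
Proof. exact: mulmx1C UU. Qed.

Lemma gram_spectral_ge0 i : 0 <= d 0 i.
Proof.
have -> : d 0 i = sqnorm (B *m col i (U^t*)).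
  rewrite -sqnormE trmxC_mul.
  have -> : (col i (U^t*))^t* = row i U by apply/matrixP => a b; rewrite !mxE conjCK.
  have uM : row i U *m M *m col i (U^t*) = delta_mx 0 i *m diag_mx d *m delta_mx i 0.
    rewrite [X in _ *m X *m _]gram_spectral colE rowE.
    move: (d) => D; move: (U) UU => V VV; rewrite -!mulmxA [V *m (V^t* *m delta_mx _ _)]mulmxA.
    by rewrite VV mul1mx [V *m (V^t* *m _)]mulmxA VV mul1mx.
  by move: uM; rewrite !mulmxA => ->; rewrite -rowE -colE !mxE eqxx mulr1n.
exact: sqnorm_ge0.
Qed.

Lemma trace_resolvent_spectral (t : C) : 0 < t ->
  \sum_i resolvent t B i i = \sum_i (d 0 i + t)^-1.
Proof.
move=> t_gt0.
pose e := \row_i (d 0 i + t)^-1.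
have dt i : d 0 i + t != 0 by rewrite gt_eqF // ltr_wpDl // gram_spectral_ge0.
suff -> : resolvent t B = U^t* *m diag_mx e *m U.
  rewrite -[LHS]/(\tr _) mxtrace_mulC mulmxA UU mul1mx mxtrace_diag.
  by apply: eq_bigr => i _; rewrite mxE.
have inv1 : (M + t%:M) *m (U^t* *m diag_mx e *m U) = 1%:M.
  have -> : M + t%:M = U^t* *m (diag_mx d + t%:M) *m U.
    rewrite mulmxDr mulmxDl -gram_spectral; congr (_ + _).
    by rewrite mul_mx_scalar -scalemxAl UcU scalemx1.
  rewrite !mulmxA -[_ *m U *m U^t*]mulmxA UU mulmx1 -[_ *m diag_mx e]mulmxA.
  suff -> : (diag_mx d + t%:M) *m diag_mx e = 1%:M by rewrite mulmx1 UcU.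
  apply/matrixP => i j; rewrite mul_mx_diag !mxE.
  by case: eqP => [->|_]; rewrite ?mulr1n ?mulr0n ?addr0 ?mul0r ?divff.
by rewrite -[LHS]mulmx1 -inv1 mulmxA resolvent_mull ?mul1mx.
Qed.

End GramSpectrum.

Section EsdResolvent.
Variables (R : realType) (m n : nat) (z : 'I_m * 'I_n -> R * R).
Local Notation M := (mat_of z *m (mat_of z)^t*).

Definition spectrum_list : seq R := [seq complex.Re (spectral_diag M 0 i) | i <- enum 'I_m].

Let MB : M = ((mat_of z)^t*)^t* *m (mat_of z)^t*. Proof. by rewrite trmxCK. Qed.

Lemma size_spectrum_list : size spectrum_list = m.
Proof. by rewrite size_map size_enum_ord. Qed.

Lemma spectrum_list_ge0 : all (>= 0) spectrum_list.
Proof.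
apply/allP => _ /mapP[i _ ->]; rewrite MB; apply: Re_ge0; exact: gram_spectral_ge0.
Qed.

Lemma mean_spectrum_list f :
  mean spectrum_list f = m%:R^-1 * \sum_i f (complex.Re (spectral_diag M 0 i)).
Proof. by rewrite /mean size_spectrum_list /spectrum_list big_map big_enum. Qed.

Lemma mean_spectrum_resolvent (t : R) : 0 < t ->
  mean spectrum_list (fun x => t / (x + t)) = m%:R^-1 * Ptrace t z.
Proof.
move=> t_gt0; rewrite mean_spectrum_list; congr (_ * _).
rewrite /Ptrace /Pdiag; under [RHS]eq_bigr do rewrite ReZ.
rewrite -!mulr_sumr -Re_sum trace_resolvent_spectral ?ltcR // Re_sum; congr (_ * _).
apply: eq_bigr => i _; rewrite -MB.
have /ge0_ReE : 0 <= spectral_diag M 0 i by rewrite MB; exact: gram_spectral_ge0.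
move: (spectral_diag M 0 i) => l; set x := complex.Re l => ->.
have -> : x%:C + t%:C = (x + t)%:C by rewrite -rmorphD.
by rewrite -real_complexV.
Qed.

End EsdResolvent.

Section AdjointFamily.
Variables (R : realType) (m n : nat).
Variable t : R.
Hypothesis t_gt0 : 0 < t.

Definition pair_conj (p : R * R) : R * R := (p.1, - p.2).

(** The conjugate transpose at the level of real pairs; the row results applied to it yield the
    column equations. *)
Definition adj_family (z : 'I_m * 'I_n -> R * R) (k : 'I_n * 'I_m) : R * R :=
  pair_conj (z (k.2, k.1)).

Lemma mat_of_adj z : mat_of (adj_family z) = (mat_of z)^t*.
Proof. by apply/matrixP => i j; rewrite !mxE. Qed.

Lemma Pdiag_adj z j : Pdiag t j (adj_family z) = t * Gdiag t j z.
Proof. by rewrite /Pdiag /Gdiag mat_of_adj trmxCK ReZ. Qed.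

Lemma Gdiag_adj z i : t * Gdiag t i (adj_family z) = Pdiag t i z.
Proof. by rewrite /Pdiag /Gdiag mat_of_adj ReZ. Qed.

Lemma abs2_conj p : abs2 (pair_conj p) = abs2 p.
Proof. by rewrite /abs2 /= sqrrN. Qed.

Lemma measurable_pair_conj : measurable_fun setT pair_conj.
Proof.
apply: measurable_fun_pair; first exact: measurable_fst.
by apply: (@measurable_funN _ _ _ setT snd); exact: measurable_snd.
Qed.

End AdjointFamily.

Section ExpectedTrace.
Context (R : realType) d (Omega : measurableType d) (P : probability Omega R).
Variables (m n : nat) (Z : 'I_m * 'I_n -> Omega -> R * R).
Hypothesis Z_meas : forall i, measurable_fun setT (Z i).
Hypothesis Z_indep : mutually_independent P Z.
Variable t : R.
Hypothesis t_gt0 : 0 < t.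
Variables (v : 'I_m -> 'I_n -> R) (c : R).
Hypothesis Z_int : forall i, P.-integrable setT (EFin \o (fun w => abs2 (Z i w))).
Hypothesis Z_var : forall i j, \int[P]_w abs2 (Z (i, j) w) = v i j.
Hypothesis Z_mean1 : forall i, \int[P]_w (Z i w).1 = 0.
Hypothesis Z_mean2 : forall i, \int[P]_w (Z i w).2 = 0.
Hypothesis v_le : forall i j, v i j <= c.
Hypothesis c_ge0 : 0 <= c.
Variable eta : R.

Let Z' (k : 'I_n * 'I_m) (w : Omega) : R * R := pair_conj (Z (k.2, k.1) w).

Let Z'_meas k : measurable_fun setT (Z' k).
Proof. exact: (measurableT_comp (@measurable_pair_conj R) (Z_meas (k.2, k.1))). Qed.

Let Z'_indep : mutually_independent P Z'.
Proof.
apply: (mutually_independent_comp (@measurable_pair_conj R) (Z := fun k => Z (k.2, k.1))).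
by apply: (mutually_independent_sub (h := fun k => (k.2, k.1))) => // -[? ?] [? ?] [-> ->].
Qed.

Let joint' w : joint Z' w = adj_family (joint Z w). Proof. by []. Qed.

Let bG j : bmeas (fun w => Gdiag t j (joint Z w)).
Proof.
have [mf [K fK]] := @bmeas_Gdiag R m n t t_gt0 j.
split; last by exists K => w.
exact: (measurableT_comp mf (measurable_joint Z_meas)).
Qed.

Let bP i : bmeas (fun w => Pdiag t i (joint Z w)).
Proof.
have [mf [K fK]] := @bmeas_Pdiag R m n t t_gt0 i.
split; last by exists K => w.
exact: (measurableT_comp mf (measurable_joint Z_meas)).
Qed.

Let bG' i : bmeas (fun w => Gdiag t i (joint Z' w)).
Proof.
have [mf [K fK]] := @bmeas_Gdiag R n m t t_gt0 i.
split; last by exists K => w.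
exact: (measurableT_comp mf (measurable_joint Z'_meas)).
Qed.

(** Taking [t] times the mean of [Gdiag] as unknown gives row and column equations the same factor
    [t^-1], hence a single symmetric system. *)
Lemma self_consistent_col j :
  `|(t * \int[P]_w Gdiag t j (joint Z w)) *
    (1 + t^-1 * \sum_i v i j * \int[P]_w Pdiag t i (joint Z w)) - 1| <=
  2 * Num.sqrt (m%:R * (c ^+ 2 * t^-1 ^+ 2)) +
    Num.sqrt (m%:R * (t^-1 ^+ 2 * (eta ^+ 2 * c))) +
    2 * t^-1 * \sum_i tail2 P Z eta i j +
  c * t^-1 + Num.sqrt (n%:R * (c * t^-1) ^+ 2).
Proof.
have t0 : t != 0 by rewrite gt_eqF.
have Z'_int k : P.-integrable setT (EFin \o (fun w => abs2 (Z' k w))).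
  rewrite (_ : (fun w => _) = fun w => abs2 (Z (k.2, k.1) w)); first exact: Z_int.
  by apply/funext => w; rewrite abs2_conj.
have Z'_var (i : 'I_n) (k : 'I_m) : \int[P]_w abs2 (Z' (i, k) w) = v k i.
  by rewrite -Z_var; under eq_Rintegral do rewrite abs2_conj.
have Z'_mean1 i : \int[P]_w (Z' i w).1 = 0 by exact: Z_mean1.
have Z'_mean2 i : \int[P]_w (Z' i w).2 = 0.
  rewrite /= -[LHS]opprK -[X in - X = _]mulN1r -RintegralZ; last first.
    apply: sqint_integrable; split; first exact: measurableT_comp measurable_snd (Z'_meas i).
    apply: integrable_sub (Z'_int i) _ _.
      by apply: measurable_funX; exact: measurableT_comp measurable_snd (Z'_meas i).
    by move=> w; rewrite ger0_norm ?sqr_ge0 // /abs2 lerDr sqr_ge0.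
  under eq_Rintegral do rewrite mulN1r opprK.
  by rewrite Z_mean2 oppr0.
have := self_consistent Z'_meas Z'_indep t_gt0 Z'_int Z'_var Z'_mean1 Z'_mean2
  (fun i k => v_le k i) c_ge0 eta j.
under eq_Rintegral do rewrite joint' Pdiag_adj.
rewrite RintegralZ; last exact: bmeas_integrable (bG j).
have -> : quad_bound P Z' t c eta j = 2 * Num.sqrt (m%:R * (c ^+ 2 * t^-1 ^+ 2)) +
    Num.sqrt (m%:R * (t^-1 ^+ 2 * (eta ^+ 2 * c))) +
    2 * t^-1 * \sum_i tail2 P Z eta i j.
  rewrite /quad_bound; congr (_ + _ * _); apply: eq_bigr => i _.
  by apply: eq_Rintegral => w _; rewrite abs2_conj.
have -> // : \sum_i v i j * \int[P]_w Gdiag t i (joint Z' w) =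
  t^-1 * \sum_i v i j * \int[P]_w Pdiag t i (joint Z w).
rewrite mulr_sumr; apply: eq_bigr => i _; rewrite mulrCA; congr (_ * _).
under [in RHS]eq_Rintegral do rewrite -Gdiag_adj -joint'.
by rewrite RintegralZ ?mulKf //; exact: bmeas_integrable (bG' i).
Qed.


Hypothesis eta_ge0 : 0 <= eta.
Local Notation N := (m + n)%N.
Variable B : R.
Hypothesis Nc_le : N%:R * c <= B.
Hypothesis B_le : 8 * (B * t^-1) <= 1.

Definition bipartite_weight (i j : 'I_N) : R :=
  match fintype.split i, fintype.split j with
  | inl a, inr b => v a b
  | inr b, inl a => v a b
  | _, _ => 0
  end.

(** The sum of all row and column errors with [m] and [n] raised to [N] under the roots: 3 is 2 from
    the quadratic form and 1 from the fluctuation of the trace, 4 is 2 from each side. *)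
Definition trace_error : R :=
  N%:R * (3 * (t^-1 * Num.sqrt (N%:R * c ^+ 2)) + t^-1 * eta * Num.sqrt (N%:R * c) + c * t^-1) +
  4 * t^-1 * \sum_i \sum_j tail2 P Z eta i j.

Let v_ge0 i j : 0 <= v i j.
Proof. by rewrite -Z_var; apply: Rintegral_ge0 => w _; rewrite addr_ge0 ?sqr_ge0. Qed.

Let wgt_ge0 i j : 0 <= bipartite_weight i j.
Proof. by rewrite /bipartite_weight; case: fintype.split => ?; case: fintype.split. Qed.

Let wgt_le i j : bipartite_weight i j <= c.
Proof. by rewrite /bipartite_weight; case: fintype.split => ?; case: fintype.split. Qed.

Let row_le i : \sum_j bipartite_weight i j <= B.
Proof.
apply: le_trans Nc_le; apply: (@le_trans _ _ (\sum_(j < N) c)); first exact: ler_sum.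
by rewrite sumr_const card_ord mulr_natl.
Qed.

Let wgt_sym i j : bipartite_weight i j = bipartite_weight j i.
Proof. by rewrite /bipartite_weight; case: fintype.split => ?; case: fintype.split. Qed.

Lemma expected_trace_expansion K : (0 < K)%N ->
  `|2 * \int[P]_w Ptrace t (joint Z w) - m%:R + n%:R -
    \sum_i tree_series bipartite_weight t^-1 K i| <=
  2 * (trace_error + N%:R * ((K * K)%:R * (4 * (B * t^-1)) ^+ K)).
Proof.
move=> K0; have ti0 : 0 <= t^-1 by rewrite invr_ge0 ltW.
have t0 : t != 0 by rewrite gt_eqF.
pose p i := \int[P]_w Pdiag t i (joint Z w).
pose q j := t * \int[P]_w Gdiag t j (joint Z w).
pose g (i : 'I_N) := match fintype.split i with inl a => p a | inr b => q b end.
pose rt (k : nat) := Num.sqrt (k%:R * (c * t^-1) ^+ 2).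
pose rc (k : nat) := Num.sqrt (k%:R * (t^-1 ^+ 2 * (eta ^+ 2 * c))).
pose e (i : 'I_N) := match fintype.split i with
  | inl a => 2 * rt n + rc n + 2 * t^-1 * (\sum_j tail2 P Z eta a j) + c * t^-1 + rt m
  | inr b => 2 * rt m + rc m + 2 * t^-1 * (\sum_a tail2 P Z eta a b) + c * t^-1 + rt n
  end.
have g0 i : 0 <= g i.
  rewrite /g; case: fintype.split => a; rewrite ?mulr_ge0 ?(ltW t_gt0) //;
    apply: Rintegral_ge0 => w _; [exact: Pdiag_ge0|exact: Re_resolvent_diag_ge0].
have sumN (V : zmodType) (f : 'I_N -> V) :
    \sum_i f i = \sum_a f (lshift n a) + \sum_b f (rshift m b) by rewrite big_split_ord.
have splitl (a : 'I_m) : fintype.split (lshift n a) = inl a by exact: (unsplitK (inl a)).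
have splitr (b : 'I_n) : fintype.split (rshift m b) = inr b by exact: (unsplitK (inr b)).
have gl a : g (lshift n a) = p a by rewrite /g splitl.
have gr b : g (rshift m b) = q b by rewrite /g splitr.
have wl a : \sum_j bipartite_weight (lshift n a) j * g j = \sum_b v a b * q b.
  rewrite sumN big1 ?add0r => [|a' _]; last by rewrite /bipartite_weight !splitl mul0r.
  by apply: eq_bigr => b _; rewrite /bipartite_weight splitl splitr gr.
have wr b : \sum_j bipartite_weight (rshift m b) j * g j = \sum_a v a b * p a.
  rewrite sumN addrC big1 ?add0r => [|b' _]; last by rewrite /bipartite_weight !splitr mul0r.
  by apply: eq_bigr => a _; rewrite /bipartite_weight splitl splitr gl.
have el a : e (lshift n a) =
    2 * rt n + rc n + 2 * t^-1 * (\sum_j tail2 P Z eta a j) + c * t^-1 + rt m.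
  by rewrite /e splitl.
have er b : e (rshift m b) =
    2 * rt m + rc m + 2 * t^-1 * (\sum_a tail2 P Z eta a b) + c * t^-1 + rt n.
  by rewrite /e splitr.
have g_eq i : `|g i * (1 + t^-1 * \sum_j bipartite_weight i j * g j) - 1| <= e i.
  rewrite -(splitK i); case: (fintype.split i) => a /=.
    rewrite wl gl el mulr_sumr.
    under eq_bigr do rewrite mulrCA /q mulKf //.
    have := self_consistent Z_meas Z_indep t_gt0 Z_int Z_var Z_mean1 Z_mean2 v_le c_ge0 eta a.
    by rewrite /quad_bound -exprMn.
  rewrite wr gr er.
  by have := self_consistent_col a; rewrite -exprMn.
(* By duality the column sum is the row sum minus [m] plus [n], so the total over all vertices
   determines the row part alone. *)
have Pq : 2 * \int[P]_w Ptrace t (joint Z w) - m%:R + n%:R = \sum_i g i.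
  have -> : \sum_i g i = \sum_a p a + \sum_b q b.
    by rewrite sumN; congr (_ + _); apply: eq_bigr => ? _; rewrite ?gl ?gr.
  have iPt : \int[P]_w Ptrace t (joint Z w) = \sum_i p i.
    by rewrite /Ptrace Rintegral_sum // => i; exact: bmeas_integrable (bP i).
  have iGt : \int[P]_w Ptrace t (joint Z w) = m%:R - n%:R + \sum_j q j.
    under eq_Rintegral do rewrite PtraceE //.
    have iG : P.-integrable setT (EFin \o (fun w => \sum_j Gdiag t j (joint Z w))).
      by apply: integrable_sumR => j; exact: bmeas_integrable (bG j).
    have itG : P.-integrable setT (EFin \o (fun w => t * \sum_j Gdiag t j (joint Z w))).
      exact: (integrableZl measurableT t iG).
    rewrite (RintegralD measurableT (finite_measure_integrable_cst P (m%:R - n%:R) measurableT) itG).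
    rewrite Rintegral_prob_cst RintegralZ // Rintegral_sum ?mulr_sumr // => j.
    exact: bmeas_integrable (bG j).
  by rewrite mulr2n mulrDl !mul1r {1}iPt iGt; ring.
rewrite Pq; apply: le_trans (approx_solution_tree_series wgt_ge0 row_le _ ti0 B_le g0 g_eq K0) _.
  by move=> j; under eq_bigr do rewrite wgt_sym.
rewrite ler_pM2l ?ltr0n // lerD2r.
have sqrtZ s u : 0 <= s -> s * Num.sqrt u = Num.sqrt (s ^+ 2 * u).
  by move=> s0; rewrite sqrtrM ?sqr_ge0 // sqrtr_sqr ger0_norm.
have rtN k : (k <= N)%N -> rt k <= t^-1 * Num.sqrt (N%:R * c ^+ 2).
  move=> kN; rewrite sqrtZ // /rt ler_wsqrtr //.
  have -> : t^-1 ^+ 2 * (N%:R * c ^+ 2) = N%:R * (c * t^-1) ^+ 2 by ring.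
  by rewrite ler_wpM2r ?sqr_ge0 // ler_nat.
have rcN k : (k <= N)%N -> rc k <= t^-1 * eta * Num.sqrt (N%:R * c).
  move=> kN; rewrite sqrtZ ?mulr_ge0 // /rc ler_wsqrtr //.
  have -> : (t^-1 * eta) ^+ 2 * (N%:R * c) = N%:R * (t^-1 ^+ 2 * (eta ^+ 2 * c)) by ring.
  by rewrite ler_wpM2r ?mulr_ge0 ?sqr_ge0 // ler_nat.
pose T := \sum_i \sum_j tail2 P Z eta i j.
pose A := 3 * (t^-1 * Num.sqrt (N%:R * c ^+ 2)) + t^-1 * eta * Num.sqrt (N%:R * c) + c * t^-1.
have sl : \sum_a e (lshift n a) <= m%:R * A + 2 * t^-1 * T.
  apply: le_trans (_ : \sum_a (A + 2 * t^-1 * \sum_j tail2 P Z eta a j) <= _); last first.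
    by rewrite big_split /= -mulr_sumr sumr_const card_ord -[A *+ _]mulr_natl.
  apply: ler_sum => a _; rewrite el /A.
  move: (rtN n (leq_addl _ _)) (rtN m (leq_addr _ _)) (rcN n (leq_addl _ _)) => h1 h2 h3.
  by move: (\sum_j _) => u; lra.
have sr : \sum_b e (rshift m b) <= n%:R * A + 2 * t^-1 * T.
  apply: le_trans (_ : \sum_b (A + 2 * t^-1 * \sum_a tail2 P Z eta a b) <= _); last first.
    by rewrite big_split /= -mulr_sumr sumr_const card_ord -[A *+ _]mulr_natl /T exchange_big.
  apply: ler_sum => a _; rewrite er /A.
  move: (rtN n (leq_addl _ _)) (rtN m (leq_addr _ _)) (rcN m (leq_addr _ _)) => h1 h2 h3.
  by move: (\sum_a _) => u; lra.
rewrite sumN /trace_error -/A -/T natrD mulrDl.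
move: sl sr; move: (\sum_a e _) (\sum_b e _) A T => x1 x2 A T; lra.
Qed.

End ExpectedTrace.

(** * From the matrices X_n to the normalized entries *)

Section ScaledEntries.
Context (R : realType) d (Omega : measurableType d) (P : probability Omega R).
Variables (m n : nat) (X : Omega -> 'M[R[i]]_(m, n)) (S : 'M[R]_(m, n)) (C : R).
Hypothesis X_meas : forall i j, measurable_fun setT (fun w => reim (X w i j)).
Hypothesis X_indep : mutually_independent P
  (fun (ij : 'I_m * 'I_n) w => reim (X w ij.1 ij.2)).
Hypothesis X_mean : forall i j,
  ('E_P[fun w => complex.Re (X w i j)] = 0)%E /\
  ('E_P[fun w => complex.Im (X w i j)] = 0)%E.
Hypothesis X_var : forall i j,
  ('E_P[fun w => (ComplexField.Normc.normc (X w i j) ^+ 2)%R] = (S i j)%:E)%E.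
Hypothesis C_ge0 : 0 <= C.
Hypothesis S_bound : forall i j, S i j <= C.

Definition scale_pair (s : R) (p : R * R) : R * R := (s * p.1, s * p.2).

Definition scaled_entry (k : 'I_m * 'I_n) (w : Omega) : R * R :=
  scale_pair (Num.sqrt n%:R)^-1 (reim (X w k.1 k.2)).
Local Notation Z := scaled_entry.

Lemma measurable_scale_pair s : measurable_fun setT (scale_pair s).
Proof.
by apply: measurable_fun_pair; apply: measurable_funM.
Qed.

Lemma scaled_entry_meas k : measurable_fun setT (Z k).
Proof. exact: (measurableT_comp (@measurable_scale_pair _) (X_meas k.1 k.2)). Qed.

Lemma scaled_entry_indep : mutually_independent P Z.
Proof. exact: (mutually_independent_comp (@measurable_scale_pair _) X_indep). Qed.

Lemma normc_sqr (x : R[i]) : ComplexField.Normc.normc x ^+ 2 = abs2 (reim x).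
Proof. by case: x => a b; rewrite /= sqr_sqrtr ?addr_ge0 ?sqr_ge0. Qed.

Lemma normc_ge0 (x : R[i]) : 0 <= ComplexField.Normc.normc x.
Proof. by case: x => a b; rewrite /= sqrtr_ge0. Qed.

Lemma abs2_scaled_entry k w : abs2 (Z k w) = n%:R^-1 * abs2 (reim (X w k.1 k.2)).
Proof. by rewrite /abs2 /= !exprMn exprVn sqr_sqrtr ?ler0n // mulrDr. Qed.

Let abs2_meas k : measurable_fun setT (fun w => abs2 (reim (X w k.1 k.2))).
Proof.
apply: measurable_funD; apply: measurable_funX.
  exact: (measurableT_comp measurable_fst (X_meas k.1 k.2)).
exact: (measurableT_comp measurable_snd (X_meas k.1 k.2)).
Qed.

Let abs2E k : (\int[P]_w (abs2 (reim (X w k.1 k.2)))%:E = (S k.1 k.2)%:E)%E.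
Proof.
rewrite -X_var unlock; apply: eq_integral => w _; by rewrite /= normc_sqr.
Qed.

Let abs2_int k : P.-integrable setT (EFin \o (fun w => abs2 (reim (X w k.1 k.2)))).
Proof.
apply/integrableP; split; first exact/measurable_EFinP.
under eq_integral do rewrite /= ger0_norm ?addr_ge0 ?sqr_ge0 //.
by rewrite abs2E ltry.
Qed.

Lemma scaled_entry_int k : P.-integrable setT (EFin \o (fun w => abs2 (Z k w))).
Proof.
rewrite (_ : (fun w => _) = fun w => n%:R^-1 * abs2 (reim (X w k.1 k.2))).
  exact: (integrableZl measurableT n%:R^-1 (abs2_int k)).
by apply/funext => w; rewrite abs2_scaled_entry.
Qed.

Lemma scaled_entry_var i j : \int[P]_w abs2 (Z (i, j) w) = n%:R^-1 * S i j.
Proof.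
under eq_Rintegral do rewrite abs2_scaled_entry.
rewrite RintegralZ; last exact: abs2_int (i, j).
by rewrite /Rintegral (abs2E (i, j)).
Qed.

Lemma scaled_entry_mean1 k : \int[P]_w (Z k w).1 = 0.
Proof.
rewrite /= RintegralZ; last first.
  apply: sqint_integrable; split.
    exact: (measurableT_comp measurable_fst (X_meas k.1 k.2)).
  apply: integrable_sub (abs2_int k) _ _.
    by apply: measurable_funX; exact: (measurableT_comp measurable_fst (X_meas k.1 k.2)).
  by move=> w; rewrite ger0_norm ?sqr_ge0 // /abs2 lerDl sqr_ge0.
have [h _] := X_mean k.1 k.2; rewrite unlock in h.
by rewrite /Rintegral h mulr0.
Qed.

Lemma scaled_entry_mean2 k : \int[P]_w (Z k w).2 = 0.
Proof.
rewrite /= RintegralZ; last first.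
  apply: sqint_integrable; split.
    exact: (measurableT_comp measurable_snd (X_meas k.1 k.2)).
  apply: integrable_sub (abs2_int k) _ _.
    by apply: measurable_funX; exact: (measurableT_comp measurable_snd (X_meas k.1 k.2)).
  by move=> w; rewrite ger0_norm ?sqr_ge0 // /abs2 lerDr sqr_ge0.
have [_ h] := X_mean k.1 k.2; rewrite unlock in h.
by rewrite /Rintegral h mulr0.
Qed.

Lemma scaled_var_le i j : n%:R^-1 * S i j <= C / n%:R.
Proof. by rewrite mulrC ler_wpM2r ?invr_ge0 ?ler0n. Qed.

Lemma lindeberg_tail2 (eta : R) : 0 <= eta ->
  (((n * m)%:R^-1)%:E * \sum_(i < m) \sum_(j < n)
       'E_P[fun w => (ComplexField.Normc.normc (X w i j) ^+ 2 *
         (eta * Num.sqrt n%:R <= ComplexField.Normc.normc (X w i j))%R%:R)%R])%E =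
  (m%:R^-1 * \sum_i \sum_j tail2 P Z eta i j)%:E.
Proof.
move=> eta0.
have E i j : ('E_P[fun w => (ComplexField.Normc.normc (X w i j) ^+ 2 *
    (eta * Num.sqrt n%:R <= ComplexField.Normc.normc (X w i j))%R%:R)%R] =
    (n%:R * tail2 P Z eta i j)%:E)%E.
  have n0 : 0 < n%:R :> R by rewrite ltr0n (leq_ltn_trans _ (ltn_ord j)).
  rewrite unlock /tail2.
  have ti : P.-integrable setT (EFin \o (fun w => abs2 (Z (i, j) w) *
      (eta ^+ 2 <= abs2 (Z (i, j) w))%R%:R)).
    apply: integrable_sub (scaled_entry_int (i, j)) _ _.
      have ma : measurable_fun setT (fun w => abs2 (Z (i, j) w)).
        exact/measurable_EFinP/(measurable_int P (scaled_entry_int (i, j))).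
      have mle : measurable_fun setT (fun t : R => (eta ^+ 2 <= t)%R%:R : R).
        rewrite (_ : (fun t : R => _) = \1_(`[(eta ^+ 2), +oo[%classic)).
          exact: measurable_indic.
        by apply/funext => t; rewrite indicE mem_setE in_itv /= andbT.
      by apply: measurable_funM => //; exact: (measurableT_comp mle ma).
    move=> w; rewrite normrM (@ger0_norm _ (abs2 _)) ?addr_ge0 ?sqr_ge0 //.
    by rewrite normr_nat ler_piMr ?addr_ge0 ?sqr_ge0 // lern1 leq_b1.
  rewrite -RintegralZ // /Rintegral fineK; last first.
    exact: integrable_fin_num (integrableZl measurableT n%:R ti).
  apply: eq_integral => w _; congr (_%:E).
  rewrite abs2_scaled_entry normc_sqr mulrA mulVKf ?gt_eqF //; congr (_ * _%:R).
  rewrite -(@ler_pXn2r _ 2) ?nnegrE ?mulr_ge0 ?sqrtr_ge0 ?normc_ge0 //.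
  rewrite exprMn sqr_sqrtr ?(ltW n0) // normc_sqr mulrC [in RHS]mulrC.
  by rewrite ler_pdivlMr // mulrC.
under eq_bigr do under eq_bigr do rewrite E.
under eq_bigr do rewrite sumEFin -mulr_sumr.
rewrite sumEFin -mulr_sumr -EFinM; congr (_%:E).
(* For [n = 0] the inner sums are empty. *)
rewrite natrM invfM; case: (posnP n) => [n0|n0].
  rewrite big1 ?mulr0 // => i _; rewrite big1 // => j _.
  by exfalso; have : (0 < n)%N := leq_ltn_trans (leq0n j) (ltn_ord j); rewrite n0.
by rewrite mulrACA mulVf ?mul1r // pnatr_eq0 -lt0n.
Qed.

Lemma mat_of_scaled w :
  mat_of (joint Z w) *m (mat_of (joint Z w))^t* = sample_cov (X w).
Proof.
have -> : mat_of (joint Z w) = ((Num.sqrt n%:R)^-1)%:C *: X w.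
  apply/matrixP => i j; rewrite !mxE /=; case: (X w i j) => a b.
  by simpc.
rewrite /sample_cov linearZ /= map_mxZ -scalemxAl -scalemxAr scalerA; congr (_ *: _).
rewrite [X in _ * X]conjCE conjc_real -rmorphM /= -invfM -expr2 sqr_sqrtr ?ler0n // real_complexV.
by rewrite rmorph_nat.
Qed.

Lemma esd_sample_cov w x :
  esd (sample_cov (X w)) x = ecdf (spectrum_list (joint Z w)) x.
Proof. by rewrite /ecdf mean_spectrum_list mat_of_scaled. Qed.

End ScaledEntries.

Lemma tree_weight_scale (R : realFieldType) N (w : 'I_N -> 'I_N -> R) s t i :
  tree_weight (fun i j => s * w i j) t i = s ^+ (nvertices t).-1 * tree_weight w t i.
Proof.
elim/ptree_nested_ind: t i => ts IH i; rewrite nverticesE /=.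
elim: ts IH => [|c ts IHts] IH /=; first by rewrite expr0 mul1r.
rewrite (IHts (fun c' h => IH c' (or_intror h))).
under eq_bigr do rewrite (IH c (or_introl erefl)) mulrACA -exprS.
have -> : (nvertices c).-1.+1 = nvertices c by case: c {IH}.
by rewrite -mulr_sumr mulrACA -exprD.
Qed.

Section BipartiteTrees.
Variables (R : realType) (m n : nat) (S : 'M[R]_(m, n)).

Lemma block_bipartite (s : R) (i j : 'I_(m + n)) :
  bipartite_weight (fun a b => s * S a b) i j = s * block_mx 0 S S^T 0 i j.
Proof.
rewrite -[in RHS](splitK i) -[in RHS](splitK j) /bipartite_weight.
case: (fintype.split i) => a; case: (fintype.split j) => b /=.
- by rewrite block_mxEul mxE mulr0.
- by rewrite block_mxEur.
- by rewrite block_mxEdl mxE.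
- by rewrite block_mxEdr mxE mulr0.
Qed.

(** A tree with [k] edges has [k.+1] vertices, whence [s ^+ k] beside the power [k.+1] of
    [m + n]. *)
Lemma tree_sum_hom_density (s : R) k : (0 < m + n)%N ->
  \sum_i tree_sum (bipartite_weight (fun a b => s * S a b)) k i =
  s ^+ k * (m + n)%:R ^+ k.+1 *
  \sum_(t <- ptrees k) hom_density (@ptree_graph t) (graphon_of (block_mx 0 S S^T 0)).
Proof.
move=> N0; have -> : bipartite_weight (fun a b => s * S a b) =
    fun i j => s * (block_mx 0 S S^T 0 : 'M[R]_(m + n)) i j.
  by apply/funext => i; apply/funext => j; exact: block_bipartite.
move: (block_mx 0 S S^T 0 : 'M[R]_(m + n)); case: (m + n)%N N0 => // N _ A.
rewrite exchange_big /= mulr_sumr; rewrite [RHS]big_seq [LHS]big_seq.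
apply: eq_bigr => t; rewrite mem_ptrees => /eqP tk.
rewrite hom_density_ptree tk exprVn mulrA -[s ^+ k * _ * _]mulrA divff ?mulr1; last first.
  by rewrite expf_neq0 // pnatr_eq0.
by rewrite mulr_sumr; apply: eq_bigr => i _; rewrite tree_weight_scale tk.
Qed.

End BipartiteTrees.

Section NormalizedTrace.
Context (R : realType) d (Omega : measurableType d) (P : probability Omega R).
Variables (m n : nat) (X : Omega -> 'M[R[i]]_(m, n)) (S : 'M[R]_(m, n)) (C : R).
Hypothesis X_meas : forall i j, measurable_fun setT (fun w => reim (X w i j)).
Hypothesis X_indep : mutually_independent P
  (fun (ij : 'I_m * 'I_n) w => reim (X w ij.1 ij.2)).
Hypothesis X_mean : forall i j,
  ('E_P[fun w => complex.Re (X w i j)] = 0)%E /\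
  ('E_P[fun w => complex.Im (X w i j)] = 0)%E.
Hypothesis X_var : forall i j,
  ('E_P[fun w => (ComplexField.Normc.normc (X w i j) ^+ 2)%R] = (S i j)%:E)%E.
Hypothesis C_ge0 : 0 <= C.
Hypothesis S_bound : forall i j, S i j <= C.
Hypotheses (m_gt0 : (0 < m)%N) (n_gt0 : (0 < n)%N).
Local Notation q := ((m + n)%:R / n%:R : R).
Local Notation Z := (scaled_entry X).

Definition expected_stieltjes (t : R) : R := m%:R^-1 * \int[P]_w Ptrace t (joint Z w).

(** The factor 1/2 comes from the duality of row and column sums, [n / m] from averaging over the
    [m] rows only. *)
Definition tree_coef k : R := 1 / 2 * (n%:R / m%:R) * (q ^+ k.+1 *
  \sum_(t <- ptrees k) hom_density (@ptree_graph t) (graphon_of (block_mx 0 S S^T 0))).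

(** This is [trace_error] at [c = C / n], divided by [m]. *)
Definition stieltjes_error (t eta : R) : R :=
  q * (n%:R / m%:R) * (3 * (t^-1 * Num.sqrt (q * (C ^+ 2 * n%:R^-1))) +
    t^-1 * eta * Num.sqrt (q * C) + C * n%:R^-1 * t^-1) +
  4 * t^-1 * (m%:R^-1 * \sum_i \sum_j tail2 P Z eta i j).

Let nR : 0 < n%:R :> R. Proof. by rewrite ltr0n. Qed.
Let mR : 0 < m%:R :> R. Proof. by rewrite ltr0n. Qed.

Lemma expected_stieltjes_expansion (t eta B : R) K : 0 < t -> 0 <= eta -> (0 < K)%N ->
  q * C <= B -> 8 * (B * t^-1) <= 1 ->
  `|expected_stieltjes t - 1 / 2 * (1 - n%:R / m%:R) - \sum_(k < K) (- t^-1) ^+ k * tree_coef k| <=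
  stieltjes_error t eta + q * (n%:R / m%:R) * ((K * K)%:R * (4 * (B * t^-1)) ^+ K).
Proof.
move=> t0 eta0 K0 qB Bt; have n0 := lt0r_neq0 nR; have m0 := lt0r_neq0 mR.
have c0 : 0 <= C / n%:R by rewrite divr_ge0 // ltW.
have Nc : (m + n)%:R * (C / n%:R) <= B by rewrite mulrCA mulrC.
have := expected_trace_expansion (scaled_entry_meas X_meas) (scaled_entry_indep X_indep) t0
  (scaled_entry_int X_meas X_var) (scaled_entry_var X_meas X_var) (scaled_entry_mean1 X_meas X_mean X_var)
  (scaled_entry_mean2 X_meas X_mean X_var) (scaled_var_le S_bound) c0 eta0 Nc Bt K0.
have -> : \sum_i tree_series (bipartite_weight (fun a b => n%:R^-1 * S a b)) t^-1 K i =
    2 * m%:R * \sum_(k < K) (- t^-1) ^+ k * tree_coef k.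
  rewrite exchange_big mulr_sumr; apply: eq_bigr => k _.
  rewrite -mulr_sumr tree_sum_hom_density ?addn_gt0 ?m_gt0 // /tree_coef.
  move: (\sum_(t <- _) _) ((m + n)%:R) => h N.
  rewrite expr_div_n exprVn [n%:R ^+ k.+1]exprS.
  by field; rewrite m0 n0 expf_neq0.
have -> : trace_error P Z t (C / n%:R) eta + (m + n)%:R * ((K * K)%:R * (4 * (B * t^-1)) ^+ K) =
    m%:R * (stieltjes_error t eta + q * (n%:R / m%:R) * ((K * K)%:R * (4 * (B * t^-1)) ^+ K)).
  rewrite /trace_error /stieltjes_error.
  have -> : (m + n)%:R * (C / n%:R) ^+ 2 = q * (C ^+ 2 * n%:R^-1) by ring.
  have -> : (m + n)%:R * (C / n%:R) = q * C by ring.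
  move: (\sum_i _) (Num.sqrt (q * (C ^+ 2 * n%:R^-1))) (Num.sqrt (q * C)) ((m + n)%:R)
    ((K * K)%:R * _) => T a b N kk.
  by field; rewrite m0 n0 gt_eqF.
rewrite /expected_stieltjes.
set I := \int[P]_w _; set E := stieltjes_error t eta + _; set T := \sum_(k < K) _ => h.
rewrite -(ler_pM2l (mulr_gt0 (ltr0n _ 2) mR)) -[X in X * `|_|]ger0_norm ?mulr_ge0 ?(ltW mR) //.
rewrite -normrM; apply: le_trans (le_trans _ h) _.
  rewrite le_eqVlt; apply/orP; left; apply/eqP; congr `|_|.
  by field.
by rewrite mulrA.
Qed.

End NormalizedTrace.

Lemma cvg_sum_seq (R : realType) (I : Type) (r : seq I) (f : I -> nat -> R) (l : I -> R) :
  (forall i, f i n @[n --> \oo] --> l i) ->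
  \sum_(i <- r) f i n @[n --> \oo] --> \sum_(i <- r) l i.
Proof.
move=> fl; elim: r => [|i r IH].
  by rewrite big_nil; under eq_fun do rewrite big_nil; exact: cvg_cst.
by rewrite big_cons; under eq_fun do rewrite big_cons; exact: cvgD.
Qed.

Lemma cvg_exprn (R : realType) (f : nat -> R) (l : R) k :
  f n @[n --> \oo] --> l -> f n ^+ k @[n --> \oo] --> l ^+ k.
Proof. by move=> fl; exact: (cvg_comp _ _ fl (@exprn_continuous R k l)). Qed.

Lemma sqr_succ_le_expn4 k : (k * k * k.+1 <= 4 * 4 ^ k)%N.
Proof.
by elim: k => [|[|k] IH] //; rewrite expnS; nia.
Qed.

(** * Convergence of the expected transforms *)

Section LimitTransform.
Context (R : realType) d (Omega : measurableType d) (P : probability Omega R).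
Variables (m : nat -> nat) (X : forall n : nat, Omega -> 'M[R[i]]_(m n, n)).
Variables (S : forall n : nat, 'M[R]_(m n, n)) (C y : R).
Hypothesis X_meas : forall n i j, measurable_fun setT (fun w => reim (X n w i j)).
Hypothesis X_indep : forall n, mutually_independent P
  (fun (ij : 'I_(m n) * 'I_n) w => reim (X n w ij.1 ij.2)).
Hypothesis X_mean : forall n i j,
  ('E_P[fun w => complex.Re (X n w i j)] = 0)%E /\
  ('E_P[fun w => complex.Im (X n w i j)] = 0)%E.
Hypothesis X_var : forall n i j,
  ('E_P[fun w => (ComplexField.Normc.normc (X n w i j) ^+ 2)%R] = (S n i j)%:E)%E.
Hypothesis X_lindeberg : forall eta : R, 0 < eta ->
    (((n * m n)%:R^-1)%:E *
     \sum_(i < m n) \sum_(j < n)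
       'E_P[fun w => (ComplexField.Normc.normc (X n w i j) ^+ 2 *
         (eta * Num.sqrt n%:R <= ComplexField.Normc.normc (X n w i j))%R%:R)%R])%E
    @[n --> \oo] --> 0%E.
Hypothesis C_ge0 : 0 <= C.
Hypothesis S_bound : forall n i j, S n i j <= C.
Hypothesis y_gt0 : 0 < y.
Hypothesis m_ratio : (m n)%:R / n%:R @[n --> \oo] --> y.
Local Notation W := (fun n => graphon_of (block_mx 0 (S n) (S n)^T 0)).
Hypothesis W_cvg : forall (k : nat) (e : rel 'I_k), is_tree e ->
    cvg (hom_density e (W n) @[n --> \oo]).

Let y0 : y != 0. Proof. by rewrite gt_eqF. Qed.
Local Notation q n := ((m n + n)%:R / n%:R : R).
Local Notation p n := (n%:R / (m n)%:R : R).

Lemma near_index_gt0 : \forall n \near \oo, (0 < n)%N.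
Proof. by exists 1%N. Qed.

Lemma near_rows_gt0 : \forall n \near \oo, (0 < m n)%N.
Proof.
have : \forall n \near \oo, 0 < (m n)%:R / n%:R :> R by exact: (cvgr_gt y).
by apply: filterS => n; case: (m n) => //; rewrite mul0r ltxx.
Qed.

Lemma cvg_inv_index : n%:R^-1 @[n --> \oo] --> (0 : R).
Proof. by rewrite -cvg_shiftS; exact: cvg_harmonic. Qed.

Lemma cvg_total_ratio : q n @[n --> \oo] --> 1 + y.
Proof.
apply: cvg_trans (_ : (1 + (m n)%:R / n%:R) @[n --> \oo] --> 1 + y).
  apply: near_eq_cvg; apply: filterS near_index_gt0 => n n0.
  by rewrite natrD mulrDl divff ?pnatr_eq0 -?lt0n // addrC.
by apply: cvgD => //; exact: cvg_cst.
Qed.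

Lemma cvg_inv_ratio : p n @[n --> \oo] --> y^-1.
Proof. by under eq_fun do rewrite -invf_div; exact: cvgV. Qed.

Definition tree_limit k : R :=
  \sum_(t <- ptrees k) lim (hom_density (@ptree_graph t) (W n) @[n --> \oo]).

Lemma cvg_tree_coef k :
  tree_coef (S n) k @[n --> \oo] --> 1 / 2 * y^-1 * ((1 + y) ^+ k.+1 * tree_limit k).
Proof.
apply: cvgM; first by apply: cvgM; [exact: cvg_cst|exact: cvg_inv_ratio].
apply: cvgM; first exact/cvg_exprn/cvg_total_ratio.
by apply: cvg_sum_seq => t; apply: W_cvg; exact: ptree_graph_tree.
Qed.

Lemma tree_limit0 : tree_limit 0 = 1.
Proof.
have h : (fun n => \sum_(t <- ptrees 0) hom_density (@ptree_graph t) (W n)) @ \oo --> (1 : R).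
  apply: cvg_trans (_ : (fun=> 1 : R) @ \oo --> (1 : R)); last exact: cvg_cst.
  apply: near_eq_cvg; apply: filterS near_index_gt0 => n n0.
  have N0 : (0 < m n + n)%N by rewrite addn_gt0 n0 orbT.
  have := tree_sum_hom_density (S n) 1 0 N0.
  under eq_bigr do rewrite tree_sum0.
  rewrite sumr_const card_ord expr0 mul1r expr1 -[X in X = _]mulr1.
  by move/mulfI => -> //; rewrite pnatr_eq0 -lt0n.
apply: (cvg_unique _ _ h) => //.
by apply: cvg_sum_seq => t; apply: W_cvg; exact: ptree_graph_tree.
Qed.

Lemma cvg_lindeberg_tail2 eta : 0 < eta ->
  (m n)%:R^-1 * (\sum_i \sum_j tail2 P (scaled_entry (X n)) eta i j) @[n --> \oo] --> (0 : R).
Proof.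
move=> eta0; have := X_lindeberg eta0.
under eq_fun do rewrite (lindeberg_tail2 (@X_meas _) (@X_var _) (ltW eta0)).
by move/fine_cvg.
Qed.

Lemma cvg_stieltjes_error (t eta : R) : 0 < eta ->
  stieltjes_error P (X n) C t eta @[n --> \oo] -->
  (1 + y) * y^-1 * (t^-1 * eta * Num.sqrt ((1 + y) * C)).
Proof.
move=> eta0.
(* The vanishing terms are restored so that the limit has the shape of [stieltjes_error]. *)
rewrite [X in _ --> X](_ : _ = (1 + y) * y^-1 * (3 * (t^-1 * Num.sqrt ((1 + y) * (C ^+ 2 * 0))) +
  t^-1 * eta * Num.sqrt ((1 + y) * C) + C * 0 * t^-1) + 4 * t^-1 * 0); last first.
  by rewrite !mulr0 sqrtr0 !mulr0 mul0r addr0 add0r addr0.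
have sq f (l : R) : f n @[n --> \oo] --> l -> Num.sqrt (f n) @[n --> \oo] --> Num.sqrt l.
  by move=> fl; exact: (cvg_comp _ _ fl (@sqrt_continuous R l)).
have cc (c : R) : (fun _ : nat => c) n @[n --> \oo] --> c by exact: cvg_cst.
have qc := cvg_total_ratio.
apply: cvgD; last by apply: cvgM; [exact: cc|exact: cvg_lindeberg_tail2].
apply: cvgM; first by apply: cvgM; [exact: qc|exact: cvg_inv_ratio].
apply: cvgD; [apply: cvgD|].
- apply: cvgM; first exact: cc.
  apply: cvgM; first exact: cc.
  apply: sq; apply: cvgM; first exact: qc.
  by apply: cvgM; [exact: cc|exact: cvg_inv_index].
- apply: cvgM; first exact: cc.
  by apply: sq; apply: cvgM; [exact: qc|exact: cc].
- apply: cvgM; last exact: cc.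
  by apply: cvgM; [exact: cc|exact: cvg_inv_index].
Qed.


(** [q n] tends to [1 + y], so the unit of slack gives [q n * C <= B] eventually. Beyond the
    threshold the ratio [4 B / t] is at most 1/4, and the added 1 keeps the threshold positive when
    [C = 0]. *)
Let B := C * (y + 2).
Definition stieltjes_threshold : R := 16 * B + 1.
Local Notation t0 := stieltjes_threshold.

(** At [k = 0] the constant [(1 - 1/y) / 2] joins the tree term [(1 + y) / (2 y)], and the sum is
    1. *)
Definition limit_coef k : R :=
  if k is 0 then 1 else (1 + y) ^+ k.+1 / (2 * y) * tree_limit k.

Definition limit_series (t : R) K : R := \sum_(k < K) (- t^-1) ^+ k * limit_coef k.

Definition limit_remainder (t : R) K : R := (1 + y) * y^-1 * ((K * K)%:R * (4 * (B * t^-1)) ^+ K).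

Let B_ge0 : 0 <= B. Proof. by rewrite mulr_ge0 // addr_ge0 // ltW. Qed.

Lemma stieltjes_threshold_gt0 : 0 < t0.
Proof. by rewrite /t0 ltr_wpDl // mulr_ge0. Qed.

Let threshold_le t : t0 <= t -> 0 < t /\ 16 * (B * t^-1) <= 1.
Proof.
move=> tt; have t_gt0 := lt_le_trans stieltjes_threshold_gt0 tt; split=> //.
rewrite mulrA ler_pdivrMr // mul1r; apply: le_trans tt; rewrite /t0; lra.
Qed.

Let ratio0 : 0 <= (1 + y) * y^-1.
Proof. by rewrite mulr_ge0 ?invr_ge0 ?addr_ge0 // ltW. Qed.

Let rho t n := expected_stieltjes P (X n) t.

Lemma cvg_limit_series t K : (0 < K)%N ->
  1 / 2 * (1 - p n) + \sum_(k < K) (- t^-1) ^+ k * tree_coef (S n) k @[n --> \oo] -->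
  limit_series t K.
Proof.
case: K => // K _.
rewrite [X in _ --> X](_ : _ = 1 / 2 * (1 - y^-1) + \sum_(k < K.+1) (- t^-1) ^+ k *
    (1 / 2 * y^-1 * ((1 + y) ^+ k.+1 * tree_limit k))).
  have cc (c : R) : (fun _ : nat => c) n @[n --> \oo] --> c by exact: cvg_cst.
  apply: cvgD.
    by apply: cvgM; [exact: cc|apply: cvgB; [exact: cc|exact: cvg_inv_ratio]].
  apply: cvg_sum_seq => k; apply: cvgM; first exact: cc.
  exact: cvg_tree_coef.
rewrite /limit_series !big_ord_recl /= tree_limit0 addrA; congr (_ + _).
  by rewrite expr0 expr1 mul1r mulr1; field; exact: y0.
by apply: eq_bigr => k _; congr (_ * _); rewrite /=; field; exact: y0.
Qed.

Lemma expected_stieltjes_near t K e : t0 <= t -> (0 < K)%N -> 0 < e ->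
  \forall n \near \oo, `|rho t n - limit_series t K| <= limit_remainder t K + e.
Proof.
move=> tt K0 e0; have [t_gt0 Bt] := threshold_le tt.
pose Q := (1 + y) * y^-1 * (t^-1 * Num.sqrt ((1 + y) * C)).
have Q0 : 0 <= Q by rewrite mulr_ge0 // mulr_ge0 ?sqrtr_ge0 // invr_ge0 ltW.
have e3 : 0 < e / 3 by rewrite divr_gt0.
(* The truncation level is fixed before [n] grows: the error tends to [Q * eta], which this choice
   keeps below [e / 3]. *)
pose eta := e / 3 / (Q + 1).
have Q1 : 0 < Q + 1 by rewrite ltr_wpDl.
have eta0 : 0 < eta by rewrite divr_gt0.
have Qeta : Q * eta <= e / 3.
  by rewrite mulrCA ler_piMr ?(ltW e3) // ler_pdivrMr // mul1r lerDl.
have Vc : stieltjes_error P (X n) C t eta +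
    q n * p n * ((K * K)%:R * (4 * (B * t^-1)) ^+ K) @[n --> \oo] -->
    Q * eta + limit_remainder t K.
  rewrite (_ : Q * eta = (1 + y) * y^-1 * (t^-1 * eta * Num.sqrt ((1 + y) * C))); last first.
    by rewrite /Q; ring.
  apply: cvgD; first exact: cvg_stieltjes_error.
  apply: cvgM; last exact: cvg_cst.
  by apply: cvgM; [exact: cvg_total_ratio|exact: cvg_inv_ratio].
have Vle : \forall n \near \oo, stieltjes_error P (X n) C t eta +
    q n * p n * ((K * K)%:R * (4 * (B * t^-1)) ^+ K) <= limit_remainder t K + 2 * (e / 3).
  by apply: (cvgr_le (Q * eta + limit_remainder t K) Vc); lra.
have Uc : \forall n \near \oo, `|limit_series t K - (1 / 2 * (1 - p n) +
    \sum_(k < K) (- t^-1) ^+ k * tree_coef (S n) k)| <= e / 3.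
  by move/cvgrPdist_le : (@cvg_limit_series t K K0); exact.
have qle : \forall n \near \oo, q n <= y + 2.
  by apply: (cvgr_le (1 + y) cvg_total_ratio); lra.
apply: filterS (filterI (filterI Vle Uc) (filterI qle (filterI near_index_gt0 near_rows_gt0))).
move=> n [[V U] [qn [n0 m0]]].
have Cq : q n * C <= B by rewrite mulrC ler_wpM2l.
have Bt8 : 8 * (B * t^-1) <= 1.
  by apply: le_trans Bt; rewrite ler_wpM2r ?ler_nat // mulr_ge0 // invr_ge0 ltW.
have := expected_stieltjes_expansion (@X_meas n) (@X_indep n) (@X_mean n) (@X_var n) C_ge0
  (@S_bound n) m0 n0 t_gt0 (ltW eta0) K0 Cq Bt8.
rewrite -/(rho t n).
move: (rho t n) (stieltjes_error _ _ _ _ _ + _) (\sum_(k < K) _) (limit_series t K) V U.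
move=> r V T L; rewrite !ler_norml => VL /andP[h1 h2] /andP[h3 h4].
by apply/andP; split; lra.
Qed.

Let remainder_cvg0 t : t0 <= t -> forall e, 0 < e -> exists2 K, (0 < K)%N & limit_remainder t K <= e.
Proof.
move=> tt e e0; have [t_gt0 Bt] := threshold_le tt.
pose z := 4 * ((1 + y) * y^-1) / e; pose K := (Num.truncn z).+1.
have zK : z <= K.+1%:R.
  by apply: (@le_trans _ _ K%:R); [exact/ltW/truncnS_gt|rewrite ler_nat].
exists K => //; rewrite /limit_remainder.
have x0 : 0 <= 4 * (B * t^-1) by rewrite mulr_ge0 // mulr_ge0 // invr_ge0 ltW.
have xK : (4 * (B * t^-1)) ^+ K <= 4^-1 ^+ K by apply: lerXn2r; rewrite ?nnegrE ?invr_ge0 //; lra.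
have Ksmall : (K * K)%:R * (4 * (B * t^-1)) ^+ K <= 4 / K.+1%:R :> R.
  apply: (@le_trans _ _ ((K * K)%:R * 4^-1 ^+ K)); first by rewrite ler_wpM2l.
  rewrite exprVn ler_pdivrMr ?exprn_gt0 // mulrAC ler_pdivlMr ?ltr0n // -natrX -!natrM ler_nat.
  exact: sqr_succ_le_expn4.
apply: le_trans (ler_wpM2l ratio0 Ksmall) _.
rewrite mulrA ler_pdivrMr ?ltr0n //; move: zK; rewrite /z ler_pdivrMr //.
by rewrite [e * _]mulrC [_ * 4]mulrC.
Qed.

Definition limit_stieltjes t : R := lim (rho t n @[n --> \oo]).

(** For every tolerance some partial sum [limit_series t K] is eventually that close, so the
    sequence is Cauchy. *)
Lemma cvg_expected_stieltjes t : t0 <= t -> rho t n @[n --> \oo] --> limit_stieltjes t.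
Proof.
move=> tt; apply/cauchy_cvgP/cauchy_exP => e e0.
have e2 : 0 < e / 3 by rewrite divr_gt0.
have [K K0 hK] := remainder_cvg0 tt e2; exists (limit_series t K).
apply: filterS (expected_stieltjes_near tt K0 e2) => n h; rewrite /ball /= distrC.
by apply: le_lt_trans h _; lra.
Qed.

Lemma limit_stieltjes_expansion t K : t0 <= t -> (0 < K)%N ->
  `|limit_stieltjes t - limit_series t K| <= limit_remainder t K.
Proof.
move=> tt K0; apply/ler_addgt0Pr => e e0.
have h : `|rho t n - limit_series t K| @[n --> \oo] --> `|limit_stieltjes t - limit_series t K|.
  by apply: cvg_norm; apply: cvgB; [exact: cvg_expected_stieltjes|exact: cvg_cst].
rewrite -(cvg_lim _ h) //; apply: limr_le; first
  by apply/cvg_ex; exists `|limit_stieltjes t - limit_series t K|.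
exact: expected_stieltjes_near.
Qed.

End LimitTransform.

(** The bound is uniform in [x], hence in the spectrum; it carries almost sure convergence from
    countably many [t] to all [t >= t0]. *)
Lemma stieltjes_kernel_lipschitz (R : realFieldType) (t0 t t' x : R) :
  0 < t0 -> t0 <= t -> t0 <= t' -> 0 <= x -> `|t / (x + t) - t' / (x + t')| <= `|t - t'| / t0.
Proof.
move=> t00 tt tt' x0.
have xt : 0 < x + t by lra.
have xt' : 0 < x + t' by lra.
have -> : t / (x + t) - t' / (x + t') = (t - t') * (x / ((x + t) * (x + t'))).
  by field; rewrite !gt_eqF.
rewrite normrM ler_wpM2l // ger0_norm; last by rewrite divr_ge0 // mulr_ge0 // ltW.
rewrite ler_pdivrMr ?mulr_gt0 // [leRHS]mulrC ler_pdivlMr //; nra.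
Qed.

(** * Almost sure convergence of the transforms *)

Section AlmostSure.
Context (R : realType) d (Omega : measurableType d) (P : probability Omega R).
Variables (m : nat -> nat) (X : forall n : nat, Omega -> 'M[R[i]]_(m n, n)).
Variables (S : forall n : nat, 'M[R]_(m n, n)) (C y : R).
Hypothesis X_meas : forall n i j, measurable_fun setT (fun w => reim (X n w i j)).
Hypothesis X_indep : forall n, mutually_independent P
  (fun (ij : 'I_(m n) * 'I_n) w => reim (X n w ij.1 ij.2)).
Hypothesis X_mean : forall n i j,
  ('E_P[fun w => complex.Re (X n w i j)] = 0)%E /\
  ('E_P[fun w => complex.Im (X n w i j)] = 0)%E.
Hypothesis X_var : forall n i j,
  ('E_P[fun w => (ComplexField.Normc.normc (X n w i j) ^+ 2)%R] = (S n i j)%:E)%E.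
Hypothesis X_lindeberg : forall eta : R, 0 < eta ->
    (((n * m n)%:R^-1)%:E *
     \sum_(i < m n) \sum_(j < n)
       'E_P[fun w => (ComplexField.Normc.normc (X n w i j) ^+ 2 *
         (eta * Num.sqrt n%:R <= ComplexField.Normc.normc (X n w i j))%R%:R)%R])%E
    @[n --> \oo] --> 0%E.
Hypothesis C_ge0 : 0 <= C.
Hypothesis S_bound : forall n i j, S n i j <= C.
Hypothesis y_gt0 : 0 < y.
Hypothesis m_ratio : (m n)%:R / n%:R @[n --> \oo] --> y.
Local Notation W := (fun n => graphon_of (block_mx 0 (S n) (S n)^T 0)).
Hypothesis W_cvg : forall (k : nat) (e : rel 'I_k), is_tree e ->
    cvg (hom_density e (W n) @[n --> \oo]).


Local Notation t0 := (stieltjes_threshold C y).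
Local Notation Z n := (scaled_entry (X n)).
Local Notation r := (limit_stieltjes P X).

Let t0_gt0 : 0 < t0. Proof. exact: stieltjes_threshold_gt0. Qed.

Let bPt n t : 0 < t -> bmeas (fun w => Ptrace t (joint (Z n) w)).
Proof.
move=> t_gt0; have [mf [K fK]] := @bmeas_Ptrace R (m n) n t t_gt0.
split; last by exists K => w.
exact: (measurableT_comp mf (measurable_joint (scaled_entry_meas (@X_meas n)))).
Qed.

Let cvg_rho t : t0 <= t -> expected_stieltjes P (X n) t @[n --> \oo] --> r t.
Proof.
move=> tt; exact: (cvg_expected_stieltjes X_meas X_indep X_mean X_var X_lindeberg C_ge0
  S_bound y_gt0 m_ratio W_cvg tt).
Qed.

Lemma ae_cvg_stieltjes t : t0 <= t ->
  {ae P, forall w, mean (spectrum_list (joint (Z n) w)) (fun x => t / (x + t)) @[n --> \oo] --> r t}.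
Proof.
move=> tt; have t_gt0 : 0 < t by exact: lt_le_trans tt.
pose Y n w := (m n)%:R^-1 * Ptrace t (joint (Z n) w) - expected_stieltjes P (X n) t.
have bY n : bmeas (Y n).
  by apply: bmeasB; [apply: bmeasZ; exact: bPt|exact: bmeas_cst].
have Y4 n : (\int[P]_w (Y n w ^+ 4)%:E =
    ((m n)%:R^-1 ^+ 4 * \int[P]_w ((Ptrace t (joint (Z n) w) -
      \int[P]_w' Ptrace t (joint (Z n) w')) ^+ 4))%:E)%E.
  have bD : bmeas (fun w => (Ptrace t (joint (Z n) w) -
      \int[P]_w' Ptrace t (joint (Z n) w')) ^+ 4).
    by apply: bmeasX; apply: bmeasB; [exact: bPt|exact: bmeas_cst].
  rewrite -RintegralZ; last exact: bmeas_integrable.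
  rewrite /Rintegral fineK; last first.
    by apply: integrable_fin_num => //; exact: (bmeas_integrable P (bmeasZ _ bD)).
  by apply: eq_integral => w _; congr (_%:E); rewrite -exprMn mulrBr.
have : {ae P, forall w, Y n w @[n --> \oo] --> 0}.
  (* [m^-4 * 7 m^2 = 7 (n / m)^2 / n^2], and [n / m] is eventually at most [y^-1 + 1]. *)
  apply: (@ae_cvg0_moment4 _ _ _ _ _ (7 * (y^-1 + 1) ^+ 2)); first by move=> n; case: (bY n).
  have pc : \forall n \near \oo, n%:R / (m n)%:R <= y^-1 + 1 :> R.
    by apply: (cvgr_le y^-1 (cvg_inv_ratio y_gt0 m_ratio)); lra.
  apply: filterS (filterI pc (filterI near_index_gt0 (near_rows_gt0 y_gt0 m_ratio))) => n [pn [n0 m0]].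
  rewrite Y4 lee_fin.
  have n0R : 0 < n%:R :> R by rewrite ltr0n.
  have m0R : 0 < (m n)%:R :> R by rewrite ltr0n.
  have mom := Ptrace_moment4 (scaled_entry_meas (@X_meas n)) (scaled_entry_indep (@X_indep n)) t_gt0.
  apply: le_trans (ler_wpM2l _ mom) _; first by rewrite exprn_ge0 // invr_ge0 ltW.
  have -> : (m n)%:R^-1 ^+ 4 * (7 * (m n)%:R ^+ 2) = 7 * (n%:R / (m n)%:R) ^+ 2 / n%:R ^+ 2 :> R.
    by field; rewrite !gt_eqF.
  rewrite ler_wpM2r ?invr_ge0 ?exprn_ge0 ?(ltW n0R) // ler_wpM2l //.
  by rewrite ler_pXn2r // nnegrE ?divr_ge0 ?ler0n // addr_ge0 // invr_ge0 ltW.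
apply: filterS => w Yw.
have -> : (fun n => mean (spectrum_list (joint (Z n) w)) (fun x => t / (x + t))) =
    (fun n => Y n w + expected_stieltjes P (X n) t).
  by apply/funext => n; rewrite /Y subrK mean_spectrum_resolvent.
by rewrite -[r t]add0r; apply: cvgD => //; exact: cvg_rho.
Qed.

Let mean_lip n w t t' : t0 <= t -> t0 <= t' ->
  `|mean (spectrum_list (joint (Z n) w)) (fun x => t / (x + t)) -
    mean (spectrum_list (joint (Z n) w)) (fun x => t' / (x + t'))| <= `|t - t'| / t0.
Proof.
move=> tt tt'; apply: mean_dist; first exact: spectrum_list_ge0.
  by rewrite divr_ge0 // ltW.
by move=> x x0; exact: stieltjes_kernel_lipschitz.
Qed.

Lemma limit_stieltjes_lipschitz t t' : t0 <= t -> t0 <= t' -> `|r t - r t'| <= `|t - t'| / t0.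
Proof.
move=> tt tt'.
have h : `|expected_stieltjes P (X n) t - expected_stieltjes P (X n) t'| @[n --> \oo] --> `|r t - r t'|.
  by apply: cvg_norm; apply: cvgB; exact: cvg_rho.
rewrite -(cvg_lim _ h) //; apply: limr_le; first by apply/cvg_ex; exists `|r t - r t'|.
apply: nearW => n.
have t_gt0 : 0 < t by exact: lt_le_trans tt.
have t'_gt0 : 0 < t' by exact: lt_le_trans tt'.
have b1 := bmeasZ (m n)%:R^-1 (bPt n t_gt0); have b2 := bmeasZ (m n)%:R^-1 (bPt n t'_gt0).
have E s (s_gt0 : 0 < s) : expected_stieltjes P (X n) s =
    \int[P]_w ((m n)%:R^-1 * Ptrace s (joint (Z n) w)).
  by rewrite RintegralZ //; exact: bmeas_integrable (bPt n s_gt0).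
rewrite (E t t_gt0) (E t' t'_gt0).
rewrite -(RintegralB measurableT (bmeas_integrable P b1) (bmeas_integrable P b2)).
apply: Rintegral_norm_bound; first by case: (bmeasB b1 b2).
move=> w; have := mean_lip n w tt tt'.
by rewrite (mean_spectrum_resolvent _ t_gt0) (mean_spectrum_resolvent _ t'_gt0).
Qed.

Lemma ae_stieltjes_cvg :
  {ae P, forall w, stieltjes_cvg t0 r (fun n => spectrum_list (joint (Z n) w))}.
Proof.
(* A countable dense grid of [[t0, +oo[], so that a single null set serves for all [t]. *)
pose tt (j k : nat) : R := t0 + j%:R / k.+1%:R.
have tt_ge j k : t0 <= tt j k by rewrite lerDl divr_ge0.
have : {ae P, forall w, forall j k,
    mean (spectrum_list (joint (Z n) w)) (fun x => tt j k / (x + tt j k)) @[n --> \oo] --> r (tt j k)}.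
  apply: ae_foralln => j; apply: ae_foralln => k; exact: ae_cvg_stieltjes.
apply: filterS => w hw; split; first by move=> n; exact: spectrum_list_ge0.
  apply: filterS (near_rows_gt0 y_gt0 m_ratio) => n; by rewrite size_spectrum_list.
move=> t t0t; apply/cvgrPdist_le => e e0.
have [k ke] : exists k : nat, k.+1%:R^-1 / t0 <= e / 3.
  exists (Num.truncn (3 / (e * t0))).
  rewrite ler_pdivrMr // invf_ple ?posrE ?ltr0n ?mulr_gt0 ?divr_gt0 //.
  apply: le_trans (ltW (truncnS_gt _)).
  by rewrite le_eqVlt; apply/orP; left; apply/eqP; field; rewrite !gt_eqF.
pose j := Num.truncn ((t - t0) * k.+1%:R).
have d0 : 0 <= (t - t0) * k.+1%:R by rewrite mulr_ge0 // subr_ge0.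
have td : `|t - tt j k| / t0 <= e / 3.
  apply: le_trans ke; rewrite ler_wpM2r ?invr_ge0 ?(ltW t0_gt0) //.
  have /andP[j1 j2] := truncn_itv d0; rewrite -/j in j1 j2.
  have k0 : 0 < k.+1%:R :> R by rewrite ltr0n.
  have h1 : j%:R / k.+1%:R <= t - t0 by rewrite ler_pdivrMr.
  have h2 : t - t0 <= j.+1%:R / k.+1%:R by rewrite ler_pdivlMr // ltW.
  move: h2; rewrite -[j.+1%:R]natr1 mulrDl mul1r /tt ler_norml => h2.
  by apply/andP; split; move: h1 h2; move: (j%:R / k.+1%:R : R) (k.+1%:R^-1 : R) => a b; lra.
have e3 : 0 < e / 3 by rewrite divr_gt0.
have /cvgrPdist_le/(_ _ e3) := hw j k; apply: filterS => n h.
have l1 := le_trans (limit_stieltjes_lipschitz t0t (tt_ge j k)) td.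
have l2 := le_trans (mean_lip n w t0t (tt_ge j k)) td.
move: h l1 l2; rewrite !ler_norml.
move: (r t) (r (tt j k)) (mean _ (fun x => t / (x + t)))
  (mean _ (fun x => tt j k / (x + tt j k))) => a b c f /andP[? ?] /andP[? ?] /andP[? ?].
by apply/andP; split; lra.
Qed.

Lemma limit_stieltjes_asymptotic K : exists D, exists2 t1, t0 <= t1 & forall t, t1 <= t ->
  `|r t - \sum_(k < K) (- t^-1) ^+ k * limit_coef S y k| <= D * t^-1 ^+ K.
Proof.
have h t j (tt : t0 <= t) (j0 : (0 < j)%N) := limit_stieltjes_expansion X_meas X_indep X_mean
  X_var X_lindeberg C_ge0 S_bound y_gt0 m_ratio W_cvg tt j0.
set B := C * (y + 2); set rho := (1 + y) * y^-1.
have B0 : 0 <= B by rewrite mulr_ge0 // addr_ge0 // ltW.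
have rho0 : 0 <= rho by rewrite mulr_ge0 ?invr_ge0 ?addr_ge0 // ltW.
(* For [K = 0] the claim is that [r] is bounded; it is read off the case [K = 1], whose remainder is
   at most [rho]. *)
case: (posnP K) => [->|K0].
  exists (1 + rho); exists t0 => // t tt; have t_gt0 : 0 < t by exact: lt_le_trans tt.
  have := h t 1%N tt isT; rewrite /limit_series /limit_remainder big_ord_recl !big_ord0 !expr0 expr1.
  rewrite /= mul1r mulr1 subr0 addr0 mul1r -/B -/rho.
  have Bt : 4 * (B * t^-1) <= 1.
    rewrite mulrA ler_pdivrMr // mul1r; apply: le_trans tt; rewrite /stieltjes_threshold -/B; lra.
  have : rho * (4 * (B * t^-1)) <= rho by rewrite ler_piMr.
  move: (rho * _) (r t) => u a hu; rewrite !ler_norml => /andP[? ?].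
  by apply/andP; split; lra.
exists (rho * ((K * K)%:R * (4 * B) ^+ K)); exists t0 => // t tt.
apply: le_trans (h t K tt K0) _; rewrite /limit_remainder -/B -/rho le_eqVlt; apply/orP; left; apply/eqP.
by rewrite [4 * (B * _)]mulrA exprMn; ring.
Qed.

End AlmostSure.

Local Close Scope complex_scope.
Local Close Scope sesquilinear_scope.

Theorem theorem8p2 (R : realType) (d : measure_display)
  (Omega : measurableType d) (P : probability Omega R)
  (m : nat -> nat)
  (X : forall n : nat, Omega -> 'M[R[i]]_(m n, n))
  (S : forall n : nat, 'M[R]_(m n, n))
  (C y : R)
  (X_meas : forall n i j,
    measurable_fun [set: Omega] (fun w => reim (X n w i j)))
  (X_indep : forall n, mutually_independent P
    (fun (ij : 'I_(m n) * 'I_n) w => reim (X n w ij.1 ij.2)))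
  (X_mean : forall n i j,
    ('E_P[fun w => complex.Re (X n w i j)] = 0)%E /\
    ('E_P[fun w => complex.Im (X n w i j)] = 0)%E)
  (X_var : forall n i j,
    ('E_P[fun w => (ComplexField.Normc.normc (X n w i j) ^+ 2)%R] = (S n i j)%:E)%E)
  (X_lindeberg : forall eta : R, 0 < eta ->
    (((n * m n)%:R^-1)%:E *
     \sum_(i < m n) \sum_(j < n)
       'E_P[fun w => (ComplexField.Normc.normc (X n w i j) ^+ 2 *
         (eta * Num.sqrt n%:R <= ComplexField.Normc.normc (X n w i j))%R%:R)%R])%E
    @[n --> \oo] --> 0%E)
  (C_ge0 : 0 <= C)
  (S_bound : forall n i j, S n i j <= C)
  (y_gt0 : 0 < y)
  (m_ratio : (m n)%:R / n%:R @[n --> \oo] --> y)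
  (W := fun n => graphon_of (block_mx 0 (S n) (S n)^T 0))
  (W_cvg : forall (k : nat) (e : rel 'I_k), is_tree e ->
    cvg (hom_density e (W n) @[n --> \oo])) :
  exists mu : probability (measurableTypeR R) R,
    {ae P, forall w, weak_cvg (fun n => esd (sample_cov (X n w))) mu} /\
    forall k : nat, (1 <= k)%N ->
    forall T : 'I_(catalan k) -> ptree, all_ptrees T ->
      (\int[mu]_x (x ^+ k)%:E =
       ((1 + y) ^+ k.+1 / (2 * y) *
        \sum_(j < catalan k)
          lim (hom_density (@ptree_graph (T j)) (W n) @[n --> \oo]))%R%:E)%E.
Proof.
have sc := ae_stieltjes_cvg X_meas X_indep X_mean X_var X_lindeberg C_ge0 S_bound y_gt0 m_ratio W_cvg.
have P0 : (0 < P setT)%E by rewrite probability_setT lte01.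
have ae_proper := ae_properfilter_algebraOfSetsType P0.
(* One outcome in the almost sure event supplies the reference sequence from which [mu] is built;
   the other outcomes share the transform [r], hence the limit. *)
have [w0 sc0] := filter_ex sc.
have [mu [mu_cvg mu_mom]] := stieltjes_moment_limit (stieltjes_threshold_gt0 C_ge0 y_gt0) sc0
  (erefl : limit_coef S y 0 = 1)
  (limit_stieltjes_asymptotic X_meas X_indep X_mean X_var X_lindeberg C_ge0 S_bound y_gt0 m_ratio W_cvg).
exists mu; split.
  apply: filterS sc => w /mu_cvg.
  have -> // : (fun n => esd (sample_cov (X n w))) =
    (fun n => ecdf (spectrum_list (joint (scaled_entry (X n)) w))).
  by apply/funext => n; apply/funext => x; exact: esd_sample_cov.
case=> // k _ T allT; rewrite mu_mom /limit_coef.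
by rewrite (sum_all_ptrees (fun t => lim (hom_density (@ptree_graph t) (W n) @[n --> \oo])) allT).
Qed.
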